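(* Consider the piecewise perturbed polynomial system $$\dot x = X_c(x,y)+X_i(x,y),\qquad \dot y = Y_c(x,y)+Y_i(x,y),\qquad \text{if }(x,y)\in\Sigma_i,\quad i=1,2,$$ where $$\begin{aligned} X_{c} &= x \left(bx - \frac{b^2 + 1}{e}\, y + \frac{b^2 - be + 1}{e}\right),\\ Y_{c} &= y \left(ex - by + b - e\right),\\ X_i &= x \left(q_i x + \frac{(1+b^2)p_i - (2b + q_i)eq_i }{(e + p_i)e}\, y - \frac{(b^2 + e q_i + 1)p_i + (e - 2b - q_i)eq_i}{(e + p_i)e}\right),\\ Y_i &= y \left(p_i x - q_i y + q_i - p_i\right), \end{aligned}$$ with $(e+p_i)e\neq0$ for $i=1,2$, $\mu=(b,e)\in\mathbb{R}^2$, $\lambda=(p_1,q_1,p_2,q_2)\in\mathbb{R}^4$ small enough, and separation straight line $4(x-1)-3(y-1)=0$. Then there exist values of the parameters for which this perturbed polynomial system has an eighth-order weak focus at $(1,1)$, which can unfold at least three crossing limit cycles of small amplitude.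
   Context: Put $h(x,y)=4(x-1)-3(y-1)$, $\Sigma=\{h=0\}$ and $\Sigma_i=\{(x,y):(-1)^ih(x,y)>0\}$. Weak focus order: let $p\in\Sigma$ be a monodromic equilibrium (an equilibrium of both vector fields around which the trajectories of the piecewise system rotate). Parametrize $\Sigma$ near $p$ by a linear coordinate $\rho$ with $\rho=0$ at $p$. Let $\Pi_1(\rho)$, for small $\rho>0$, be the half-return map of $Z_1$ (first intersection with $\Sigma$ of the trajectory in $\Sigma_1$ from $\rho$), and let $(\Pi_2)^{-1}(\rho)$ be the inverse of the half-return map of $Z_2$ through $\Sigma_2$. The difference map $\Delta(\rho)=(\Pi_2)^{-1}(\rho)-\Pi_1(\rho)$ is analytic, and its successive Taylor coefficients, up to sign, are the Lyapunov quantities $W_k$ (coefficient of $\rho^k$). The point $p$ is a weak focus of order $\ell$ if $W_j=0$ for $1\le j\le \ell-1$ and $W_\ell\ne0$. A crossing limit cycle is an isolated periodic orbit meeting both zones and intersecting $\Sigma$ only at points where both vector fields cross $\Sigma$ transversally in the same direction. The weak focus unfolds $k$ crossing limit cycles of small amplitude if, for every neighbourhood of the point, there are parameter values of the given family, arbitrarily close to those of the weak focus, for which the system has $k$ crossing limit cycles contained in that neighbourhood. *)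

(* Defs.v *)
From Stdlib Require Import Reals.
From Coquelicot Require Import Coquelicot.
Open Scope R_scope.

Inductive zone := zone1 | zone2.

Definition h (z : R * R) : R := 4 * (fst z - 1) - 3 * (snd z - 1).

Definition on_sigma (z : R * R) : Prop := h z = 0.

Definition in_zone (i : zone) (z : R * R) : Prop :=
  match i with
  | zone1 => h z < 0
  | zone2 => 0 < h z
  end.

(* [Z zone1] and [Z zone2] are the two vector fields of a piecewise system; both
   are defined on the whole plane. *)
Definition piecewise_field := zone -> R * R -> R * R.

(* [lie_h F z] is the scalar product of [F z] with the gradient of [h]. *)
Definition lie_h (F : R * R -> R * R) (z : R * R) : R :=
  4 * fst (F z) - 3 * snd (F z).

Definition is_solution_at (F : R * R -> R * R) (phi : R -> R * R) (t : R) : Prop :=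
  is_derive (fun s => fst (phi s)) t (fst (F (phi t))) /\
  is_derive (fun s => snd (phi s)) t (snd (F (phi t))).

(* For [z] and [w] on Sigma: the trajectory of [Z i] through [z] enters zone [i],
   its first intersection with Sigma after that is [w], and the arc from [z] to
   [w] lies in [U]. *)
Definition half_return (Z : piecewise_field) (i : zone) (U : R * R -> Prop)
    (z w : R * R) : Prop :=
  exists (T : R) (phi : R -> R * R),
    0 < T /\ phi 0 = z /\ phi T = w /\
    (forall t, 0 <= t <= T -> is_solution_at (Z i) phi t) /\
    (forall t, 0 < t < T -> in_zone i (phi t)) /\
    (forall t, 0 <= t <= T -> U (phi t)).

Definition whole_plane (z : R * R) : Prop := True.

(* Parametrization of Sigma by a linear coordinate vanishing at [p]. *)
Definition linear_coordinate (p : R * R) (gamma : R -> R * R) : Prop :=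
  exists v : R * R, v <> (0, 0) /\
    forall rho, gamma rho = (fst p + rho * fst v, snd p + rho * snd v) /\
                on_sigma (gamma rho).

(* The coordinate is oriented so that trajectories go through zone 1 from
   [rho > 0] to [rho < 0] and come back through zone 2. *)
Definition monodromic_equilibrium (Z : piecewise_field) (p : R * R)
    (gamma : R -> R * R) : Prop :=
  on_sigma p /\ (forall i, Z i p = (0, 0)) /\
  forall U : R * R -> Prop, locally p U ->
    exists delta : R, 0 < delta /\
      forall rho, 0 < rho < delta ->
        (exists sigma, sigma < 0 /\
           half_return Z zone1 U (gamma rho) (gamma sigma)) /\
        (exists sigma, 0 < sigma /\
           half_return Z zone2 U (gamma (- rho)) (gamma sigma)).

(* [d] is the value at [rho] of the difference map, with
   [s2] the inverse half-return map of zone 2 and [s1] the half-return map of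
   zone 1, both at [rho]. *)
Definition is_difference_map (Z : piecewise_field) (gamma : R -> R * R)
    (rho d : R) : Prop :=
  exists s1 s2 : R, s1 < 0 /\ s2 < 0 /\
    half_return Z zone1 whole_plane (gamma rho) (gamma s1) /\
    half_return Z zone2 whole_plane (gamma s2) (gamma rho) /\
    d = s2 - s1.

(* [W k] is the Taylor coefficient of order [k] of the analytic difference map. *)
Definition lyapunov_quantities (Z : piecewise_field) (gamma : R -> R * R)
    (W : nat -> R) : Prop :=
  Rbar_lt 0 (CV_radius W) /\
  exists delta : R, 0 < delta /\
    forall rho, 0 < rho < delta -> is_difference_map Z gamma rho (PSeries W rho).

(* The orientation of [gamma] is forced by [monodromic_equilibrium], and the order
   does not depend on the scale of [gamma]. *)
Definition weak_focus (Z : piecewise_field) (p : R * R) (l : nat) : Prop :=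
  exists gamma : R -> R * R,
    linear_coordinate p gamma /\
    monodromic_equilibrium Z p gamma /\
    exists W : nat -> R,
      lyapunov_quantities Z gamma W /\
      (forall j : nat, (1 <= j < l)%nat -> W j = 0) /\
      W l <> 0.

Definition crossing_point (Z : piecewise_field) (z : R * R) : Prop :=
  on_sigma z /\ 0 < lie_h (Z zone1) z * lie_h (Z zone2) z.

(* The crossing times are required to be isolated, since otherwise nothing would
   constrain a curve that stays on Sigma for a while. *)
Definition crossing_solution (Z : piecewise_field) (phi : R -> R * R) : Prop :=
  forall t,
    continuous phi t /\
    (forall i, in_zone i (phi t) -> is_solution_at (Z i) phi t) /\
    (on_sigma (phi t) ->
       crossing_point Z (phi t) /\ locally' t (fun s => ~ on_sigma (phi s))).

Definition orbit (phi : R -> R * R) (z : R * R) : Prop := exists t, phi t = z.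

Definition same_orbit (phi psi : R -> R * R) : Prop :=
  forall z, orbit phi z <-> orbit psi z.

Definition periodic_orbit (Z : piecewise_field) (phi : R -> R * R) : Prop :=
  crossing_solution Z phi /\
  (exists T, 0 < T /\ forall t, phi (t + T) = phi t) /\
  (exists s t, phi s <> phi t).

Definition crossing_limit_cycle (Z : piecewise_field) (phi : R -> R * R) : Prop :=
  periodic_orbit Z phi /\
  (forall i, exists t, in_zone i (phi t)) /\
  exists U : R * R -> Prop,
    open U /\ (forall t, U (phi t)) /\
    forall psi, periodic_orbit Z psi -> (forall t, U (psi t)) -> same_orbit psi phi.

(* [k] pairwise distinct limit cycles, so at least [k] of them. [D] is the set of
   admissible parameters of the family [Z]. *)
Definition unfolds_at_least {Theta : UniformSpace} (D : Theta -> Prop)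
    (Z : Theta -> piecewise_field) (theta : Theta) (p : R * R) (k : nat) : Prop :=
  forall U : R * R -> Prop, locally p U ->
  forall V : Theta -> Prop, locally theta V ->
    exists theta', V theta' /\ D theta' /\
      exists phi : nat -> R -> R * R,
        (forall i : nat, (i < k)%nat ->
           crossing_limit_cycle (Z theta') (phi i) /\ forall t, U (phi i t)) /\
        (forall i j : nat, (i < j < k)%nat -> ~ same_orbit (phi i) (phi j)).

Definition Xc (b e x y : R) : R :=
  x * (b * x - (b ^ 2 + 1) / e * y + (b ^ 2 - b * e + 1) / e).

Definition Yc (b e x y : R) : R :=
  y * (e * x - b * y + b - e).

Definition Xi (b e p q x y : R) : R :=
  x * (q * x
       + ((1 + b ^ 2) * p - (2 * b + q) * e * q) / ((e + p) * e) * y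
       - ((b ^ 2 + e * q + 1) * p + (e - 2 * b - q) * e * q) / ((e + p) * e)).

Definition Yi (p q x y : R) : R :=
  y * (p * x - q * y + q - p).

(* mu = (b, e) and lambda = ((p_1, q_1), (p_2, q_2)). *)
Definition mu_space := (R * R)%type.
Definition lambda_space := ((R * R) * (R * R))%type.

Definition pert (i : zone) (lambda : lambda_space) : R * R :=
  match i with
  | zone1 => fst lambda
  | zone2 => snd lambda
  end.

Definition admissible (theta : mu_space * lambda_space) : Prop :=
  let '((b, e), lambda) := theta in
  forall i, let (p, q) := pert i lambda in (e + p) * e <> 0.

Definition kolmogorov (theta : mu_space * lambda_space) : piecewise_field :=
  fun i z =>
    let '((b, e), lambda) := theta in
    let (p, q) := pert i lambda in
    let (x, y) := z in
    (Xc b e x y + Xi b e p q x y, Yc b e x y + Yi p q x y).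

(* Main.v *)
Require Import Defs.
From Stdlib Require Import Reals Lra Lia Psatz ZArith ClassicalEpsilon FunctionalExtensionality.
From Coquelicot Require Import Coquelicot.
Open Scope R_scope.

(** Put [u = x - 1], [v = y - 1], [b_i = b + q_i], [e_i = e + p_i] and
    [k_i = (b_i^2 + 1) / e_i].  In zone [i] the field is
    [x' = x (b_i u - k_i v)], [y' = y (e_i u - b_i v)], a center with first
    integral [A ln x + B ln y + ln (1 - A u - B v)], where [A = b_i (b_i - e_i)]
    and [B = b_i (b_i - k_i)].  The line is [r |-> (1 + 3 r, 1 + 4 r)], and on it
    the integral, suitably normalised, has the derivative
    [w(r) = r (1 + s r) / ((1 + 3 r) (1 + 4 r) (1 + t r))].  So on the line a zone
    is known through the pair [(s, t)] alone; conversely [(b_i, e_i)] is an explicit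
    function of [(s, t)] ([box_invariants]), so that the two pairs [(s1, t1)] and
    [(s2, t2)] can be used as parameters of the family.

    The half-return map of a zone is the involution [sigma] of the integral on the
    line, that is the solution [sigma(r) = - r + ...] of
    [sigma' w(sigma) = w(r)].  It is obtained as a convergent power series, whose
    coefficients are majorised by [C M^k / (k + 1)^2] uniformly in bounded [(s, t)].
    As [sigma] is an involution, the sum [S = r + sigma] is a function of the
    product [P = r sigma]:
    [S = kappa1 P + kappa2 P^2 + kappa3 P^3 + O(r^7)], with explicit polynomials
    [kappa_i] in [(s, t)] ([invol_symmetric_expansion]).

    Let [G2] be the integral of zone 2 on the line and
    [F(r) = G2 (sigma1 r) - G2 r].  The displacement of the piecewise system is [F]
    up to a factor of exact order [r], and the periodic orbits near the point correspond
    to the zeros of [F].  The quotient of the two slopes [w1] and [w2] is a rational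
    function of degree 2, so
    [F' = w1(r) (w2/w1 (sigma1 r) - w2/w1 (r))] contains the factor
    [b (m0 + S - m1 P)] with [b = s2 t1 - s1 t2], where [m0], [m1] are defined by
    [s2 (1 - m0 t1) = - (t1 + m1)] and [t2 (1 - m0 s1) = - (s1 + m1)]
    ([ratio_identity]).  Substituting [S] gives
    [F' = - 2 b r^2 (m0 - (kappa1 - m1) r^2 + kappa2 r^4 - kappa3 r^6)] up to a small
    relative error ([disp_estimate]).

    Hence the focus has order 8 as soon as [m0 = 0], [m1 = kappa1], [kappa2 = 0],
    [kappa3 <> 0] and [b <> 0] ([order_eight]).  If the two zones coincide,
    the first three equations read [5 s + t = 14], [5 s^3 - 35 s^2 + 73 s - 42 = 0];
    there [b = 0] and the system is one center.  Its parameters are taken as [mu].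
    On the curve [t1 = 14 - 5 s1 + z], [kappa2 = 0], [s2 = s1 - z / 3],
    [t2 = t1 - z / 3], which starts from that center at [z = 0], the first three
    equations persist while [b] is nonzero for small [z > 0]: this gives weak foci
    of order 8 with arbitrarily small [lambda].

    Three cycles come from the choice [kappa2 = (98/9) kappa3 eps^2],
    [m0 = 12 kappa3 eps^6], [m1 = kappa1 - (245/9) kappa3 eps^4], for which
    [F(eps z)] is close to
    [(2/9) b kappa3 eps^9 z^3 (z^2 - 1) (z^2 - 4) (z^2 - 9)] and has simple zeros
    near [z = 1, 2, 3] ([disp_three_zeros]).  Each zero is the trace of a periodic
    orbit.  It is isolated in a thin annulus between two neighbouring levels: every
    periodic orbit in the annulus crosses the line, its successive crossings of the
    positive half-line are the iterates of an increasing map, periodicity makes the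
    crossing a fixed point of that map, and [F] has one zero only in the annulus
    ([hit_fixed], [loop_limit_cycle]). *)

(** * Sequences majorised by a convolution-stable weight *)

(** The factor [1 / (k + 1)^2] makes the weights stable under convolution up to the
    constant 8 ([conv_weight]), so that products of majorised series are majorised with
    the same rate [M]. *)
Definition weight (M : R) (k : nat) : R := M ^ k / (INR k + 1) ^ 2.
Definition maj (M c : R) (x : nat -> R) : Prop := forall k, Rabs (x k) <= c * weight M k.

(** Multiplication of the power series by its variable. *)
Definition shift (x : nat -> R) (n : nat) : R :=
  match n with O => 0 | S k => x k end.
Definition const_ser (c : R) (n : nat) : R := match n with O => c | S _ => 0 end.
Definition ser_add (x y : nat -> R) (n : nat) : R := x n + y n.
Definition ser_sub (x y : nat -> R) (n : nat) : R := x n - y n.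
Definition ser_scal (c : R) (x : nat -> R) (n : nat) : R := c * x n.

Lemma weight_pos M k : 0 < M -> 0 < weight M k.
Proof.
  intros HM. unfold weight. apply Rdiv_lt_0_compat. now apply pow_lt.
  apply pow_lt. pose proof (pos_INR k). lra.
Qed.

Lemma sum_inv_sqr n : sum_f_R0 (fun j => / (INR j + 1) ^ 2) n <= 2 - / (INR n + 1).
Proof.
  induction n as [|n IH]. simpl. lra.
  rewrite tech5. rewrite S_INR. pose proof (pos_INR n) as Hn. set (a := INR n) in *.
  assert (/ (a + 1 + 1) ^ 2 <= / (a + 1) - / (a + 1 + 1)); [|lra].
  replace (/ (a + 1) - / (a + 1 + 1)) with (/ ((a + 1) * (a + 1 + 1))) by (field; lra).
  apply Rinv_le_contravar; nra.
Qed.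

(** Since [1/a * 1/c = (1/a + 1/c) / (a + c)], the product of two weights is at most
    [2 (1/a^2 + 1/c^2) / (a + c)^2] with [a + c = n + 2], and the sum of [1/a^2] is at
    most 2. *)
Lemma conv_weight M n : 0 < M -> sum_f_R0 (fun j => weight M j * weight M (n - j)) n <= 8 * weight M n.
Proof.
  intros HM. pose proof (pos_INR n) as Hn.
  apply Rle_trans with
    (sum_f_R0 (fun j => (/ (INR j + 1) ^ 2 + / (INR (n - j) + 1) ^ 2) * (2 * weight M n)) n).
  - apply sum_Rle. intros j Hj.
    unfold weight.
    replace (M ^ j / (INR j + 1) ^ 2 * (M ^ (n - j) / (INR (n - j) + 1) ^ 2))
      with (M ^ n * (/ (INR j + 1) * / (INR (n - j) + 1)) ^ 2).
    2:{ replace n with (j + (n - j))%nat at 1 by lia. rewrite pow_add.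
        field. split; pose proof (pos_INR j); pose proof (pos_INR (n - j)); lra. }
    rewrite minus_INR by lia.
    assert (Hj' : INR j <= INR n) by now apply le_INR.
    pose proof (pos_INR j) as Hj0.
    set (a := INR j + 1) in *. set (c := INR n - INR j + 1).
    assert (Ha : 0 < a) by (unfold a; lra). assert (Hc : 0 < c) by (unfold c; lra).
    assert (Hnac : INR n + 1 <= a + c) by (unfold a, c; lra).
    apply Rle_trans with (M ^ n * ((/ a ^ 2 + / c ^ 2) * (2 / (a + c) ^ 2))).
    + apply Rmult_le_compat_l. apply Rlt_le, pow_lt, HM.
      replace (/ a * / c) with ((/ a + / c) / (a + c)) by (field; lra).
      replace (((/ a + / c) / (a + c)) ^ 2) with ((/ a + / c) ^ 2 * / (a + c) ^ 2)
        by (field; lra).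
      replace ((/ a ^ 2 + / c ^ 2) * (2 / (a + c) ^ 2)) with
        ((2 * ((/ a) ^ 2 + (/ c) ^ 2)) * / (a + c) ^ 2) by (field; lra).
      apply Rmult_le_compat_r. apply Rlt_le, Rinv_0_lt_compat, pow_lt; lra.
      assert (0 <= (/ a - / c) ^ 2) by apply pow2_ge_0. nra.
    + replace ((/ a ^ 2 + / c ^ 2) * (2 * (M ^ n / (INR n + 1) ^ 2))) with
        (M ^ n * ((/ a ^ 2 + / c ^ 2) * (2 / (INR n + 1) ^ 2))) by (field; lra).
      apply Rmult_le_compat_l. apply Rlt_le, pow_lt, HM.
      apply Rmult_le_compat_l.
      assert (0 < / a ^ 2) by (apply Rinv_0_lt_compat, pow_lt; lra).
      assert (0 < / c ^ 2) by (apply Rinv_0_lt_compat, pow_lt; lra). lra.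
      unfold Rdiv. apply Rmult_le_compat_l. lra.
      apply Rinv_le_contravar. apply pow_lt; lra. apply pow_incr; lra.
  - rewrite <- scal_sum.
    rewrite sum_plus, (sum_f_R0_skip (fun k => / (INR k + 1) ^ 2)).
    pose proof (sum_inv_sqr n). assert (0 < / (INR n + 1)) by (apply Rinv_0_lt_compat; lra).
    pose proof (weight_pos M n HM).
    nra.
Qed.

Lemma maj_le M c d x : 0 < M -> maj M c x -> c <= d -> maj M d x.
Proof.
  intros HM H Hcd k. eapply Rle_trans. apply H.
  apply Rmult_le_compat_r; auto. apply Rlt_le, weight_pos, HM.
Qed.

Lemma maj_nonneg M c x : 0 < M -> maj M c x -> 0 <= c.
Proof.
  intros HM H. specialize (H 0%nat). unfold weight in H. simpl in H.
  pose proof (Rabs_pos (x 0%nat)). lra.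
Qed.

Lemma maj_add M c d x y : maj M c x -> maj M d y -> maj M (c + d) (ser_add x y).
Proof.
  intros Hx Hy k. unfold ser_add. eapply Rle_trans. apply Rabs_triang.
  specialize (Hx k). specialize (Hy k). lra.
Qed.

Lemma maj_sub M c d x y : maj M c x -> maj M d y -> maj M (c + d) (ser_sub x y).
Proof.
  intros Hx Hy k. unfold ser_sub, Rminus. eapply Rle_trans. apply Rabs_triang.
  rewrite Rabs_Ropp. specialize (Hx k). specialize (Hy k). lra.
Qed.

Lemma maj_scl M c a x : maj M c x -> maj M (Rabs a * c) (ser_scal a x).
Proof.
  intros Hx k. unfold ser_scal. rewrite Rabs_mult, Rmult_assoc.
  apply Rmult_le_compat_l. apply Rabs_pos. apply Hx.
Qed.

Lemma maj_const_ser M a : 0 < M -> maj M (Rabs a) (const_ser a).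
Proof.
  intros HM [|k]; unfold const_ser.
  - unfold weight. simpl. lra.
  - rewrite Rabs_R0. apply Rmult_le_pos. apply Rabs_pos. apply Rlt_le, weight_pos, HM.
Qed.

(** Multiplication by the variable gains a factor [1/M]: for a large rate the terms of
    higher degree become negligible. This is what makes the recursion below preserve a
    ball. *)
Lemma maj_shift M c x : 0 < M -> maj M c x -> maj M (4 * c / M) (shift x).
Proof.
  intros HM H [|k]; unfold shift.
  - rewrite Rabs_R0. apply Rmult_le_pos.
    pose proof (maj_nonneg _ _ _ HM H). apply Rmult_le_pos; [lra|].
    apply Rlt_le, Rinv_0_lt_compat, HM. apply Rlt_le, weight_pos, HM.
  - eapply Rle_trans. apply H. pose proof (maj_nonneg _ _ _ HM H) as Hc.
    replace (4 * c / M * weight M (S k)) with (c * (4 / M * weight M (S k))) by (field; lra).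
    apply Rmult_le_compat_l; auto. unfold weight. rewrite S_INR.
    pose proof (pos_INR k) as Hk. set (a := INR k) in *.
    replace (4 / M * (M ^ S k / (a + 1 + 1) ^ 2)) with (M ^ k * (4 / (a + 1 + 1) ^ 2)).
    2:{ simpl. field. lra. }
    unfold Rdiv at 1. apply Rmult_le_compat_l. apply Rlt_le, pow_lt, HM.
    apply Rmult_le_reg_r with ((a + 1) ^ 2 * (a + 1 + 1) ^ 2).
    apply Rmult_lt_0_compat; apply pow_lt; lra.
    replace (/ (a + 1) ^ 2 * ((a + 1) ^ 2 * (a + 1 + 1) ^ 2)) with ((a + 1 + 1) ^ 2) by (field; lra).
    replace (4 / (a + 1 + 1) ^ 2 * ((a + 1) ^ 2 * (a + 1 + 1) ^ 2)) with (4 * (a + 1) ^ 2) by (field; lra).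
    nra.
Qed.

Lemma maj_mult M c d x y :
  0 < M -> maj M c x -> maj M d y -> maj M (8 * c * d) (PS_mult x y).
Proof.
  intros HM Hx Hy n. unfold PS_mult.
  pose proof (maj_nonneg _ _ _ HM Hx) as Hc. pose proof (maj_nonneg _ _ _ HM Hy) as Hd.
  eapply Rle_trans. apply Rsum_abs.
  eapply Rle_trans with (sum_f_R0 (fun j => (weight M j * weight M (n - j)) * (c * d)) n).
  - apply sum_Rle. intros j _. rewrite Rabs_mult.
    specialize (Hx j). specialize (Hy (n - j)%nat).
    replace (weight M j * weight M (n - j) * (c * d)) with ((c * weight M j) * (d * weight M (n -
        j))) by ring.
    apply Rmult_le_compat; auto using Rabs_pos.
  - rewrite <- scal_sum. pose proof (conv_weight M n HM).
    assert (0 <= c * d) by now apply Rmult_le_pos. nra.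
Qed.

Lemma maj_radius M c x r : 0 < M -> maj M c x -> Rabs r < / M ->
  Rbar_lt (Rabs r) (CV_radius x).
Proof.
  intros HM H Hr. apply Rbar_lt_le_trans with (/ M). exact Hr.
  destruct (CV_radius_bounded x) as [H1 _]. apply (H1 (/ M)).
  exists c. intros n. pose proof (maj_nonneg _ _ _ HM H) as Hc.
  rewrite Rabs_mult, <- RPow_abs, (Rabs_pos_eq (/ M)).
  2:{ apply Rlt_le, Rinv_0_lt_compat, HM. }
  apply Rle_trans with (c * weight M n * (/ M) ^ n).
  apply Rmult_le_compat_r. apply pow_le, Rlt_le, Rinv_0_lt_compat, HM. apply H.
  unfold weight. rewrite pow_inv. assert (0 < M ^ n) by now apply pow_lt.
  pose proof (pos_INR n) as Hn.
  replace (c * (M ^ n / (INR n + 1) ^ 2) * / M ^ n) with (c * / (INR n + 1) ^ 2).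
  2:{ field. split; lra. }
  rewrite <- (Rmult_1_r c) at 2. apply Rmult_le_compat_l; auto.
  rewrite <- Rinv_1. apply Rinv_le_contravar. lra. nra.
Qed.

Lemma maj_ex M c x r : 0 < M -> maj M c x -> Rabs r < / M -> ex_pseries x r.
Proof.
  intros HM H Hr. apply CV_disk_correct. apply CV_disk_inside.
  eapply maj_radius; eauto.
Qed.

(** On half the disc the majorant is geometric of ratio 1/2. *)
Lemma maj_value M c x r : 0 < M -> maj M c x -> Rabs r <= / (2 * M) -> Rabs (PSeries x r) <= 2 * c.
Proof.
  intros HM H Hr. pose proof (maj_nonneg _ _ _ HM H) as Hc.
  assert (Hb : forall n, Rabs (x n * r ^ n) <= c * (/ 2) ^ n).
  { intros n. rewrite Rabs_mult, <- RPow_abs.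
    apply Rle_trans with (c * M ^ n * (/ (2 * M)) ^ n).
    - apply Rmult_le_compat. apply Rabs_pos. apply pow_le, Rabs_pos.
      eapply Rle_trans. apply H. apply Rmult_le_compat_l; auto.
      unfold weight. pose proof (pos_INR n). assert (0 < M ^ n) by now apply pow_lt.
      rewrite <- (Rmult_1_r (M ^ n)) at 2. unfold Rdiv. apply Rmult_le_compat_l. lra.
      rewrite <- Rinv_1. apply Rinv_le_contravar. lra. nra.
      apply pow_incr. split. apply Rabs_pos. exact Hr.
    - rewrite Rinv_mult, Rpow_mult_distr, (pow_inv M).
      assert (0 < M ^ n) by now apply pow_lt.
      right. field. lra. }
  assert (Hs : ex_series (fun n => c * (/ 2) ^ n)).
  { apply (ex_series_scal_l c (fun n => (/ 2) ^ n)). apply ex_series_geom. rewrite Rabs_pos_eq; lra. }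
  unfold PSeries. eapply Rle_trans. apply Series_Rabs.
  apply (ex_series_le (fun n => Rabs (x n * r ^ n)) (fun n => c * (/ 2) ^ n)); auto.
  { intros n. unfold norm; simpl. unfold abs; simpl. rewrite Rabs_Rabsolu. apply Hb. }
  eapply Rle_trans. apply (Series_le _ (fun n => c * (/ 2) ^ n)); auto.
  intros n. split. apply Rabs_pos. apply Hb.
  rewrite Series_scal_l. rewrite Series_geom. lra. rewrite Rabs_pos_eq; lra.
Qed.

(** * The half-return involution as a convergent power series *)

(** Large enough for [maj_step]: every term of the recursion that carries a factor of
    the variable must be small in the majorant norm when [|s|] and [|t|] are at most
    10. *)
Definition rate : R := 1000000.

(** [1 + r (x (+) y) = (1 + r x) (1 + r y)], [r] being the variable. *)
Definition oplus (x y : nat -> R) : nat -> R := ser_add (ser_add x y) (shift (PS_mult x y)).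

(** The unknown of the recursion is [eta = 3 nu + r nu'], where
    [sigma(r) = - r + r^2 nu(r)] is the involution; [eta] bounds both [nu] and [r nu']
    without loss of derivatives. *)
Definition nu (eta : nat -> R) (k : nat) : R := eta k / (INR k + 3).

(** The series of [r nu']. *)
Definition theta_nu (eta : nat -> R) (k : nat) : R := INR k * nu eta k.

(** The series of [sigma(r) / r]. *)
Definition quot_ser (eta : nat -> R) : nat -> R := ser_add (const_ser (-1)) (shift (nu eta)).

(** [1 + r Aser = (1 + s sigma) (1 + 3 r) (1 + 4 r) (1 + t r)], where [m] is the series
    of [sigma(r) / r]. *)
Definition Aser (s t : R) (m : nat -> R) : nat -> R :=
  oplus (oplus (oplus (ser_scal s m) (const_ser 3)) (const_ser 4)) (const_ser t).

(** [1 + r Bser = (1 + s r) (1 + 3 sigma) (1 + 4 sigma) (1 + t sigma)]. *)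
Definition Bser (s t : R) (m : nat -> R) : nat -> R :=
  oplus (oplus (oplus (const_ser s) (ser_scal 3 m)) (ser_scal 4 m)) (ser_scal t m).
Definition Qser (A n : nat -> R) : nat -> R := ser_add n (shift (PS_mult A n)).
Definition Rser (A n d : nat -> R) : nat -> R :=
  ser_sub (ser_add (PS_mult (ser_sub (Qser A n) A) d) (ser_scal 2 (PS_mult (Qser A n) n)))
       (ser_scal 3 (PS_mult A n)).

(** With [m = sigma / r], the equation [sigma' w(sigma) = w(r)] reads
    [sigma' m (1 + r A) = 1 + r B], and [sigma' m = 1 - r eta + r^2 nu (2 nu + r nu')].
    Dividing by [r] isolates [eta = A - B + r (...)], where the coefficient of degree
    [k] on the right depends on lower coefficients of [eta] only. *)
Definition step (s t : R) (eta : nat -> R) : nat -> R :=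
  let A := Aser s t (quot_ser eta) in
  ser_add (ser_sub A (Bser s t (quot_ser eta))) (shift (Rser A (nu eta) (theta_nu eta))).

(** Truncation is used to see that [step] is causal; the fixed point then exists as the
    sequence of stable coefficients of the iterates from 0. *)
Definition agree (n : nat) (x y : nat -> R) : Prop := forall k, (k < n)%nat -> x k = y k.

Lemma agree_ser_add n x x' y y' : agree n x x' -> agree n y y' -> agree n (ser_add x y) (ser_add x' y').
Proof. intros H H' k Hk. unfold ser_add. now rewrite H, H'. Qed.

Lemma agree_ser_sub n x x' y y' : agree n x x' -> agree n y y' -> agree n (ser_sub x y) (ser_sub x' y').
Proof. intros H H' k Hk. unfold ser_sub. now rewrite H, H'. Qed.

Lemma agree_ser_scal n c x x' : agree n x x' -> agree n (ser_scal c x) (ser_scal c x').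
Proof. intros H k Hk. unfold ser_scal. now rewrite H. Qed.

Lemma agree_shift n x x' : agree n x x' -> agree (S n) (shift x) (shift x').
Proof. intros H [|k] Hk; unfold shift; auto. apply H. lia. Qed.

Lemma agree_le n p x x' : agree n x x' -> (p <= n)%nat -> agree p x x'.
Proof. intros H Hp k Hk. apply H. lia. Qed.

Lemma agree_mult n x x' y y' :
  agree n x x' -> agree n y y' -> agree n (PS_mult x y) (PS_mult x' y').
Proof.
  intros H H' k Hk. unfold PS_mult. apply sum_eq. intros i Hi.
  rewrite H, H' by lia. reflexivity.
Qed.

Lemma agree_refl n x : agree n x x.
Proof. intros k _. reflexivity. Qed.

Lemma agree_oplus n x x' y y' :
  agree n x x' -> agree n y y' -> agree n (oplus x y) (oplus x' y').
Proof.
  intros H H'. unfold oplus. apply agree_ser_add. now apply agree_ser_add.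
  apply agree_le with (S n); [|lia]. apply agree_shift. now apply agree_mult.
Qed.

Lemma agree_nu n x x' : agree n x x' -> agree n (nu x) (nu x').
Proof. intros H k Hk. unfold nu. now rewrite H. Qed.

Lemma agree_theta_nu n x x' : agree n x x' -> agree n (theta_nu x) (theta_nu x').
Proof. intros H k Hk. unfold theta_nu, nu. now rewrite H. Qed.

Lemma agree_step n s t x x' : agree n x x' -> agree (S n) (step s t x) (step s t x').
Proof.
  intros H.
  assert (Hm : agree (S n) (quot_ser x) (quot_ser x')).
  { apply agree_ser_add. apply agree_refl. apply agree_shift, agree_nu, H. }
  assert (HA : agree (S n) (Aser s t (quot_ser x)) (Aser s t (quot_ser x'))).
  { unfold Aser. repeat apply agree_oplus; try apply agree_refl. now apply agree_ser_scal. }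
  assert (HB : agree (S n) (Bser s t (quot_ser x)) (Bser s t (quot_ser x'))).
  { unfold Bser. repeat apply agree_oplus; try apply agree_refl; now apply agree_ser_scal. }
  unfold step. apply agree_ser_add. now apply agree_ser_sub. apply agree_shift.
  assert (HA' := agree_le _ n _ _ HA (Nat.le_succ_diag_r n)).
  assert (Hn := agree_nu _ _ _ H). assert (Hd := agree_theta_nu _ _ _ H).
  unfold Rser, Qser.
  repeat first [assumption | apply agree_ser_sub | apply agree_ser_add | apply agree_ser_scal
               | apply agree_mult | apply agree_le with (S n); [apply agree_shift | lia]].
Qed.

Fixpoint iter_step (s t : R) (n : nat) : nat -> R :=
  match n with O => fun _ => 0 | S p => step s t (iter_step s t p) end.

Definition etaser (s t : R) (k : nat) : R := iter_step s t (S k) k.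

Lemma agree_iter s t n : agree n (iter_step s t n) (iter_step s t (S n)).
Proof.
  induction n as [|n IH]. intros k Hk; lia.
  apply (agree_step n s t) in IH. exact IH.
Qed.

Lemma agree_iter_le s t n p : (n <= p)%nat -> agree n (iter_step s t n) (iter_step s t p).
Proof.
  induction 1 as [|p Hp IH]. apply agree_refl.
  intros k Hk. rewrite IH by auto. apply agree_iter. lia.
Qed.

Lemma agree_eta s t n : agree n (etaser s t) (iter_step s t n).
Proof. intros k Hk. unfold etaser. apply agree_iter_le; lia. Qed.

Lemma eta_fix s t k : etaser s t k = step s t (etaser s t) k.
Proof.
  rewrite (agree_step k s t _ _ (agree_eta s t k)) by lia. reflexivity.
Qed.

Lemma maj_oplus c d e x y : maj rate c x -> maj rate d y -> c + d + 32 * c * d / rate <= e ->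
  maj rate e (oplus x y).
Proof.
  intros Hx Hy He. assert (HM : 0 < rate) by (unfold rate; lra).
  eapply maj_le; [exact HM| |exact He].
  unfold oplus. apply maj_add. now apply maj_add.
  replace (32 * c * d / rate) with (4 * (8 * c * d) / rate) by (unfold Rdiv; ring).
  apply maj_shift; auto. now apply maj_mult.
Qed.

Lemma maj_nu c x : maj rate c x -> maj rate c (nu x).
Proof.
  intros H k. eapply Rle_trans; [|apply H]. unfold nu, Rdiv. rewrite Rabs_mult.
  rewrite <- (Rmult_1_r (Rabs (x k))) at 2. apply Rmult_le_compat_l. apply Rabs_pos.
  pose proof (pos_INR k). rewrite Rabs_inv, Rabs_pos_eq by lra.
  rewrite <- Rinv_1. apply Rinv_le_contravar; lra.
Qed.

Lemma maj_theta_nu c x : maj rate c x -> maj rate c (theta_nu x).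
Proof.
  intros H k. eapply Rle_trans; [|apply H]. unfold theta_nu, nu, Rdiv.
  pose proof (pos_INR k).
  replace (INR k * (x k * / (INR k + 3))) with (x k * (INR k / (INR k + 3))) by (field; lra).
  rewrite Rabs_mult.
  rewrite <- (Rmult_1_r (Rabs (x k))) at 2. apply Rmult_le_compat_l. apply Rabs_pos.
  rewrite Rabs_pos_eq. apply Rmult_le_reg_r with (INR k + 3). lra. field_simplify; lra.
  apply Rdiv_le_0_compat; lra.
Qed.

Lemma maj_quot_ser x : maj rate 100 x -> maj rate 2 (quot_ser x).
Proof.
  intros H. assert (HM : 0 < rate) by (unfold rate; lra).
  apply maj_le with (Rabs (-1) + 4 * 100 / rate); auto.
  apply maj_add. now apply maj_const_ser. apply maj_shift; auto. now apply maj_nu.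
  rewrite Rabs_left by lra. unfold rate. lra.
Qed.

Lemma maj_c a c : Rabs a <= c -> maj rate c (const_ser a).
Proof.
  intros H. assert (HM : 0 < rate) by (unfold rate; lra).
  apply maj_le with (Rabs a); auto. now apply maj_const_ser.
Qed.

Lemma maj_s a c m : maj rate 2 m -> Rabs a <= c -> maj rate (2 * c) (ser_scal a m).
Proof.
  intros Hm H. assert (HM : 0 < rate) by (unfold rate; lra).
  apply maj_le with (Rabs a * 2); auto. now apply maj_scl. lra.
Qed.

Ltac abs_num := rewrite ?Rabs_pos_eq by lra; lra.

Lemma maj_A s t m : Rabs s <= 10 -> Rabs t <= 10 -> maj rate 2 m -> maj rate 40 (Aser s t m).
Proof.
  intros Hs Ht Hm. unfold Aser.
  apply maj_oplus with 29 10; [|now apply maj_c|unfold rate; lra].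
  apply maj_oplus with 24 4; [|apply maj_c; abs_num|unfold rate; lra].
  apply maj_oplus with (2 * 10) 3; [now apply maj_s|apply maj_c; abs_num|unfold rate; lra].
Qed.

Lemma maj_B s t m : Rabs s <= 10 -> Rabs t <= 10 -> maj rate 2 m -> maj rate 47 (Bser s t m).
Proof.
  intros Hs Ht Hm. unfold Bser.
  apply maj_oplus with 26 (2 * 10); [|now apply maj_s|unfold rate; lra].
  apply maj_oplus with 17 (2 * 4); [|apply maj_s; auto; abs_num|unfold rate; lra].
  apply maj_oplus with 10 (2 * 3); [now apply maj_c|apply maj_s; auto; abs_num|unfold rate; lra].
Qed.

Lemma maj_Q A n : maj rate 40 A -> maj rate 100 n -> maj rate 101 (Qser A n).
Proof.
  intros HA Hn. assert (HM : 0 < rate) by (unfold rate; lra).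
  apply maj_le with (100 + 4 * (8 * 40 * 100) / rate); auto; [|unfold rate; lra].
  apply maj_add; auto. apply maj_shift; auto. now apply maj_mult.
Qed.

Lemma maj_R A n d : maj rate 40 A -> maj rate 100 n -> maj rate 100 d -> maj rate 370400 (Rser A n d).
Proof.
  intros HA Hn Hd. assert (HM : 0 < rate) by (unfold rate; lra).
  pose proof (maj_Q A n HA Hn) as HQ.
  apply maj_le with (8 * (101 + 40) * 100 + Rabs 2 * (8 * 101 * 100) + Rabs 3 * (8 * 40 * 100)); auto.
  2:{ rewrite !Rabs_pos_eq by lra. lra. }
  unfold Rser. apply maj_sub. apply maj_add.
  apply maj_mult; auto. now apply maj_sub.
  apply maj_scl, maj_mult; auto. apply maj_scl, maj_mult; auto.
Qed.

(** The ball of radius 100 is invariant: [A] and [B] contribute at most 40 and 47, and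
    the remaining terms carry a factor [4 / rate]. *)
Lemma maj_step s t x : Rabs s <= 10 -> Rabs t <= 10 -> maj rate 100 x -> maj rate 100 (step s t x).
Proof.
  intros Hs Ht Hx. assert (HM : 0 < rate) by (unfold rate; lra).
  pose proof (maj_quot_ser x Hx) as Hm.
  pose proof (maj_A s t _ Hs Ht Hm) as HA.
  apply maj_le with (40 + 47 + 4 * 370400 / rate); auto; [|unfold rate; lra].
  unfold step. apply maj_add. apply maj_sub; auto. now apply maj_B.
  apply maj_shift; auto. apply maj_R; auto. now apply maj_nu. now apply maj_theta_nu.
Qed.

Lemma maj_eta s t : Rabs s <= 10 -> Rabs t <= 10 -> maj rate 100 (etaser s t).
Proof.
  intros Hs Ht k. unfold etaser. revert k.
  assert (H : forall n, maj rate 100 (iter_step s t n)).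
  { induction n. intros k. simpl. rewrite Rabs_R0. apply Rmult_le_pos. lra.
    apply Rlt_le, weight_pos. unfold rate; lra. apply maj_step; auto. }
  intros k. apply H.
Qed.

(** Evaluation is only used together with a majorant, which gives the convergence needed
    by the rules for sums and products. *)
Definition ev (x : nat -> R) (r v : R) : Prop := (exists c, maj rate c x) /\ PSeries x r = v.

Lemma rate_pos : 0 < rate. Proof. unfold rate; lra. Qed.

Lemma ev_shift x r v : ev x r v -> ev (shift x) r (r * v).
Proof.
  intros [[c Hc] <-]. split. eexists. apply maj_shift; eauto using rate_pos.
  rewrite <- PSeries_incr_1. apply PSeries_ext. now intros [|n].
Qed.

Lemma ev_const_ser c r : Rabs r < / rate -> ev (const_ser c) r c.
Proof.
  intros Hr. split. eexists. apply maj_const_ser, rate_pos.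
  rewrite PSeries_decr_1.
  rewrite (PSeries_ext (PS_decr_1 (const_ser c)) (fun _ => 0)) by reflexivity.
  rewrite PSeries_const_0. simpl. ring.
  eapply maj_ex; eauto using rate_pos. apply maj_const_ser, rate_pos.
Qed.

Lemma ev_add x y r v w : Rabs r < / rate -> ev x r v -> ev y r w -> ev (ser_add x y) r (v + w).
Proof.
  intros Hr [[c Hc] <-] [[d Hd] <-]. split. eexists. eapply maj_add; eauto.
  apply PSeries_plus; eapply maj_ex; eauto using rate_pos.
Qed.

Lemma ev_sub x y r v w : Rabs r < / rate -> ev x r v -> ev y r w -> ev (ser_sub x y) r (v - w).
Proof.
  intros Hr [[c Hc] <-] [[d Hd] <-]. split. eexists. eapply maj_sub; eauto.
  apply PSeries_minus; eapply maj_ex; eauto using rate_pos.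
Qed.

Lemma ev_scl x r a v : ev x r v -> ev (ser_scal a x) r (a * v).
Proof.
  intros [[c Hc] <-]. split. eexists. eapply maj_scl; eauto.
  apply PSeries_scal.
Qed.

Lemma ev_mult x y r v w : Rabs r < / rate -> ev x r v -> ev y r w -> ev (PS_mult x y) r (v * w).
Proof.
  intros Hr [[c Hc] <-] [[d Hd] <-]. split. eexists. eapply maj_mult; eauto using rate_pos.
  apply PSeries_mult; eapply maj_radius; eauto using rate_pos.
Qed.

Lemma ev_oplus x y r v w : Rabs r < / rate -> ev x r v -> ev y r w ->
  ev (oplus x y) r (v + w + r * (v * w)).
Proof.
  intros Hr Hx Hy. unfold oplus. apply ev_add; auto. now apply ev_add.
  apply ev_shift. now apply ev_mult.
Qed.

Lemma ev_fun x r v w : ev x r v -> ev x r w -> v = w.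
Proof. intros [_ <-] [_ <-]. reflexivity. Qed.

Definition inv_n (s t r : R) : R := PSeries (nu (etaser s t)) r.
Definition inv_n' (s t r : R) : R := PSeries (PS_derive (nu (etaser s t))) r.
Definition invol (s t r : R) : R := - r + r ^ 2 * inv_n s t r.
Definition invol' (s t r : R) : R := -1 + 2 * r * inv_n s t r + r ^ 2 * inv_n' s t r.

(** The fixed point equation of [step], multiplied by the variable, is the differential
    equation of the involution. *)
Lemma invol_equation s t r : Rabs s <= 10 -> Rabs t <= 10 -> Rabs r < / rate ->
  let z := invol s t r in
  invol' s t r * (z * (1 + s * z)) * ((1 + 3 * r) * (1 + 4 * r) * (1 + t * r))
  = r * (1 + s * r) * ((1 + 3 * z) * (1 + 4 * z) * (1 + t * z)).
Proof.
  intros Hs Ht Hr z.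
  pose proof (maj_eta s t Hs Ht) as He.
  assert (En : ev (nu (etaser s t)) r (inv_n s t r)).
  { split; [|reflexivity]. eexists. now apply maj_nu. }
  assert (Ed : ev (theta_nu (etaser s t)) r (r * inv_n' s t r)).
  { split. eexists. now apply maj_theta_nu. unfold inv_n'. rewrite <- PSeries_incr_1.
    apply PSeries_ext. intros [|k]; unfold theta_nu, PS_incr_1, PS_derive.
    simpl. apply Rmult_0_l. reflexivity. }
  assert (Em : ev (quot_ser (etaser s t)) r (-1 + r * inv_n s t r)).
  { apply ev_add; auto. now apply ev_const_ser. now apply ev_shift. }
  set (n := inv_n s t r) in *. set (m := -1 + r * n) in *.
  assert (EA : exists a, ev (Aser s t (quot_ser (etaser s t))) r a /\
     1 + r * a = (1 + r * (s * m)) * (1 + r * 3) * (1 + r * 4) * (1 + r * t)).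
  { eexists. split. unfold Aser.
    repeat (apply ev_oplus; [assumption| |try (apply ev_const_ser; assumption)]).
    apply ev_scl, Em. ring. }
  assert (EB : exists a, ev (Bser s t (quot_ser (etaser s t))) r a /\
     1 + r * a = (1 + r * s) * (1 + r * (3 * m)) * (1 + r * (4 * m)) * (1 + r * (t * m))).
  { eexists. split. unfold Bser.
    repeat (apply ev_oplus; [assumption| |try (apply ev_scl; exact Em)]).
    now apply ev_const_ser. ring. }
  destruct EA as (a & EA & Ha). destruct EB as (b & EB & Hb).
  set (d := r * inv_n' s t r) in *.
  assert (EQ : ev (Qser (Aser s t (quot_ser (etaser s t))) (nu (etaser s t))) r (n + r * (a * n))).
  { apply ev_add; auto. apply ev_shift. now apply ev_mult. }
  assert (E1 : ev (etaser s t) r (a - b + r * ((n + r * (a * n) - a) * d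
                + 2 * ((n + r * (a * n)) * n) - 3 * (a * n)))).
  { split. now eexists. rewrite (PSeries_ext _ _ _ (eta_fix s t)).
    assert (Es : ev (step s t (etaser s t)) r (a - b + r * ((n + r * (a * n) - a) * d
                + 2 * ((n + r * (a * n)) * n) - 3 * (a * n)))); [|apply Es].
    apply ev_add; auto. now apply ev_sub. apply ev_shift. unfold Rser.
    apply ev_sub; auto. apply ev_add; auto. apply ev_mult; auto. now apply ev_sub.
    apply ev_scl. now apply ev_mult. apply ev_scl. now apply ev_mult. }
  assert (E2 : ev (etaser s t) r (3 * n + d)).
  { split. now eexists. rewrite (PSeries_ext _ (ser_add (ser_scal 3 (nu (etaser s t))) (theta_nu
      (etaser s t)))).
    assert (Es : ev (ser_add (ser_scal 3 (nu (etaser s t))) (theta_nu (etaser s t))) r (3 * n +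
        d)); [|apply Es].
    apply ev_add; auto. now apply ev_scl.
    intros k. unfold ser_add, ser_scal, theta_nu, nu. pose proof (pos_INR k). field. lra. }
  pose proof (ev_fun _ _ _ _ E1 E2) as Heq.
  assert (Hz : z = r * m) by (unfold z, invol, m; fold n; ring).
  assert (Hz' : invol' s t r = -1 + 2 * r * n + r * d) by (unfold invol', d; fold n; ring).
  assert (Hkey : (-1 + 2 * r * n + r * d) * m * (1 + r * a) = 1 + r * b).
  { unfold m. apply Rminus_diag_uniq.
    transitivity (r * ((a - b + r * ((n + r * (a * n) - a) * d
                + 2 * ((n + r * (a * n)) * n) - 3 * (a * n))) - (3 * n + d))).
    ring. rewrite Heq. ring. }
  rewrite Hz, Hz'. rewrite Ha, Hb in Hkey.
  transitivity (r * ((-1 + 2 * r * n + r * d) * m * ((1 + r * (s * m)) * (1 + r * 3) * (1 + r * 4)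
      * (1 + r * t)))).
  ring. rewrite Hkey. ring.
Qed.

Lemma invol_derive s t r : Rabs s <= 10 -> Rabs t <= 10 -> Rabs r < / rate ->
  is_derive (invol s t) r (invol' s t r).
Proof.
  intros Hs Ht Hr. unfold invol, invol', inv_n, inv_n'.
  assert (Hd : is_derive (PSeries (nu (etaser s t))) r (PSeries (PS_derive (nu (etaser s t))) r)).
  { apply is_derive_PSeries. eapply maj_radius; eauto using rate_pos. apply maj_nu, maj_eta; auto. }
  auto_derive. eexists; apply Hd. erewrite (is_derive_unique (fun x => PSeries _ x)) by exact Hd. ring.
Qed.

Lemma inv_n_bound s t r : Rabs s <= 10 -> Rabs t <= 10 -> Rabs r <= / (2 * rate) ->
  Rabs (inv_n s t r) <= 200.
Proof.
  intros Hs Ht Hr. unfold inv_n. replace 200 with (2 * 100) by lra.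
  eapply maj_value; eauto using rate_pos. apply maj_nu, maj_eta; auto.
Qed.

(** * The sum of a point and its image as a function of their product *)

(** [kappa1], [kappa2], [kappa3] are the coefficients of [S = r + sigma] as a power
    series in [P = r sigma]. They are found by solving the equation of the involution to
    order 6; that only three unknowns occur up to this order reflects that [sigma] is an
    involution. *)
Definition kappa1 (s t : R) : R :=
  (2 * s - 2 * t - 14) / 3.
Definition kappa2 (s t : R) : R :=
  (- 40 * s ^ 3 + 30 * s ^ 2 * t + 210 * s ^ 2 + 6 * s * t ^ 2 - 168 * s * t - 138 * s +
   4 * t ^ 3 - 42 * t ^ 2 + 138 * t - 140) / 135.
Definition kappa3 (s t : R) : R :=
  (2240 * s ^ 5 - 2380 * s ^ 4 * t - 16660 * s ^ 4 + 350 * s ^ 3 * t ^ 2 + 13720 * s ^ 3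
   * t + 32270 * s ^ 3 - 98 * s ^ 2 * t ^ 3 + 588 * s ^ 2 * t ^ 2 - 14028 * s ^ 2 * t -
   1862 * s ^ 2 - 104 * s * t ^ 4 + 1624 * s * t ^ 3 - 12108 * s * t ^ 2 - 11144 * s * t
   - 8648 * s - 8 * t ^ 5 + 728 * t ^ 4 - 6134 * t ^ 3 + 13006 * t ^ 2 + 8648 * t -
   31640) / 8505.

(** [nu0, ..., nu4] are the first coefficients of [nu] in terms of the [kappa_i]: with
    [P = - r^2 (1 - r nu)] the relation [r^2 nu = kappa1 P + kappa2 P^2 + ...]
    determines [nu] recursively. *)
Definition nu0 s t := - kappa1 s t.
Definition nu1 s t := - nu0 s t ^ 2.
Definition nu2 s t := kappa1 s t * nu1 s t + kappa2 s t.
Definition nu3 s t := kappa1 s t * nu2 s t - 2 * kappa2 s t * nu0 s t.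
Definition nu4 s t := kappa1 s t * nu3 s t + kappa2 s t * (nu0 s t ^ 2 - 2 * nu1 s t) - kappa3 s t.

Ltac unroll := rewrite eta_fix; unfold step, Rser, Qser, Aser, Bser, oplus, ser_add, ser_sub,
    ser_scal, quot_ser, shift, theta_nu, nu, PS_mult; simpl.

Lemma eta0 s t : etaser s t 0 = 3 * nu0 s t.
Proof. unroll. unfold ser_add, ser_scal, shift, const_ser, PS_mult, nu0, kappa1; simpl. field. Qed.

Lemma eta1 s t : etaser s t 1 = 4 * nu1 s t.
Proof. unroll. unfold ser_add, ser_scal, shift, const_ser, PS_mult, nu; simpl. rewrite eta0.
unfold nu1, nu0, kappa1. field. Qed.

Ltac unroll2 := unroll; unfold ser_add, ser_scal, shift, const_ser, PS_mult, nu; simpl.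
Lemma eta2 s t : etaser s t 2 = 5 * nu2 s t.
Proof. unroll2. rewrite ?eta0, ?eta1. unfold nu2, nu1, nu0, kappa1, kappa2. field. Qed.

Lemma eta3 s t : etaser s t 3 = 6 * nu3 s t.
Proof. unroll2. rewrite ?eta0, ?eta1, ?eta2. unfold nu3, nu2, nu1, nu0, kappa1, kappa2. field. Qed.

Lemma eta4 s t : etaser s t 4 = 7 * nu4 s t.
Proof. unroll2. rewrite ?eta0, ?eta1, ?eta2, ?eta3.
unfold nu4, nu3, nu2, nu1, nu0, kappa1, kappa2, kappa3. field. Qed.

Lemma maj_decr M c x n : 0 < M -> maj M c x -> maj M (c * M ^ n) (PS_decr_n x n).
Proof.
  intros HM H k. unfold PS_decr_n. eapply Rle_trans. apply H.
  pose proof (maj_nonneg _ _ _ HM H). rewrite Rmult_assoc. apply Rmult_le_compat_l; auto.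
  unfold weight. rewrite pow_add, plus_INR. pose proof (pos_INR n). pose proof (pos_INR k).
  assert (0 < M ^ n) by now apply pow_lt. assert (0 < M ^ k) by now apply pow_lt.
  unfold Rdiv. rewrite Rmult_assoc. apply Rmult_le_compat_l. lra.
  apply Rmult_le_compat_l. lra. apply Rinv_le_contravar. apply pow_lt; lra.
  apply pow_incr; lra.
Qed.

Lemma Rabs_le_mult a b A B : Rabs a <= A -> Rabs b <= B -> Rabs (a * b) <= A * B.
Proof. intros Ha Hb. rewrite Rabs_mult. apply Rmult_le_compat; auto using Rabs_pos. Qed.

Lemma Rabs_le_plus a b A B : Rabs a <= A -> Rabs b <= B -> Rabs (a + b) <= A + B.
Proof. intros Ha Hb. eapply Rle_trans. apply Rabs_triang. lra. Qed.

Lemma Rabs_le_minus a b A B : Rabs a <= A -> Rabs b <= B -> Rabs (a - b) <= A + B.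
Proof. intros Ha Hb. unfold Rminus. apply Rabs_le_plus; auto. now rewrite Rabs_Ropp. Qed.

Lemma Rabs_le_pow a A n : Rabs a <= A -> Rabs (a ^ n) <= A ^ n.
Proof. intros Ha. rewrite <- RPow_abs. apply pow_incr. split; auto using Rabs_pos. Qed.

Lemma Rabs_le_opp a A : Rabs a <= A -> Rabs (- a) <= A.
Proof. now rewrite Rabs_Ropp. Qed.

Lemma Rabs_le_self c : Rabs c <= Rabs c. Proof. lra. Qed.

(** Bounds an absolute value from bounds on the atoms; the bound itself is found by
    unification, which spares writing large explicit constants. *)
Ltac bound_abs :=
  repeat first [ eassumption | apply Rabs_le_mult | apply Rabs_le_plus | apply Rabs_le_minus
               | apply Rabs_le_pow | apply Rabs_le_opp | apply Rabs_le_self ].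

(** Both sides are polynomials in the first coefficients of [nu] and in its remainders;
    the terms of degree at most 6 cancel by [eta0], ..., [eta4], and what is left is
    [r^7] times a polynomial in bounded quantities. *)
Lemma invol_symmetric_expansion : exists C, 0 < C /\ forall s t r,
  Rabs s <= 10 -> Rabs t <= 10 -> Rabs r <= / (2 * rate) ->
  let S := r + invol s t r in let P := r * invol s t r in
  Rabs (S - kappa1 s t * P - kappa2 s t * P ^ 2 - kappa3 s t * P ^ 3) <= C * Rabs r ^ 7.
Proof.
  set (B1 := 200 * rate ^ 5).
  evar (C : R). exists (1 + Rabs C). split. pose proof (Rabs_pos C); lra.
  intros s t r Hs Ht Hr. cbv zeta.
  pose proof (maj_nu _ _ (maj_eta s t Hs Ht)) as Hm.
  set (x := nu (etaser s t)) in *.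
  assert (HM := rate_pos).
  assert (Hr' : Rabs r < / rate).
  { eapply Rle_lt_trans. exact Hr. apply Rinv_lt_contravar; nra. }
  set (a := fun k => PSeries (PS_decr_n x k) r).
  assert (Ha : forall k, (k <= 5)%nat -> Rabs (a k) <= B1).
  { intros k Hk. apply Rle_trans with (2 * (100 * rate ^ k)).
    apply (maj_value rate); auto. now apply maj_decr.
    unfold B1. assert (rate ^ k <= rate ^ 5). apply Rle_pow; auto. unfold rate; lra. lra. }
  assert (Hrec : forall k, a k = x k + r * a (S k)).
  { intros k. unfold a. rewrite PSeries_decr_1.
    unfold PS_decr_n at 1. rewrite Nat.add_0_r. f_equal. f_equal. apply PSeries_ext.
    intros n. unfold PS_decr_1, PS_decr_n. f_equal. lia.
    eapply maj_ex; eauto. now apply maj_decr. }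
  assert (Hx : forall k, (k <= 5)%nat -> Rabs (x k) <= B1).
  { intros k Hk. eapply Rle_trans. apply Hm. unfold weight, B1.
    pose proof (pos_INR k). assert (0 < rate ^ k) by now apply pow_lt.
    assert (rate ^ k <= rate ^ 5). apply Rle_pow; auto. unfold rate; lra.
    assert (rate ^ k / (INR k + 1) ^ 2 <= rate ^ k).
    { rewrite <- (Rmult_1_r (rate ^ k)) at 2. unfold Rdiv. apply Rmult_le_compat_l. lra.
      rewrite <- Rinv_1. apply Rinv_le_contravar. lra. nra. }
    lra. }
  assert (X0 : x 0%nat = nu0 s t) by (unfold x, nu; rewrite eta0; simpl; field).
  assert (X1 : x 1%nat = nu1 s t) by (unfold x, nu; rewrite eta1; simpl; field).
  assert (X2 : x 2%nat = nu2 s t) by (unfold x, nu; rewrite eta2; simpl; field).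
  assert (X3 : x 3%nat = nu3 s t) by (unfold x, nu; rewrite eta3; simpl; field).
  assert (X4 : x 4%nat = nu4 s t) by (unfold x, nu; rewrite eta4; simpl; field).
  pose proof (Hx 0%nat ltac:(lia)) as HX0. pose proof (Hx 1%nat ltac:(lia)) as HX1.
  pose proof (Hx 2%nat ltac:(lia)) as HX2. pose proof (Hx 3%nat ltac:(lia)) as HX3.
  pose proof (Hx 4%nat ltac:(lia)) as HX4.
  pose proof (Ha 0%nat ltac:(lia)) as A0. pose proof (Ha 1%nat ltac:(lia)) as A1.
  pose proof (Ha 2%nat ltac:(lia)) as A2. pose proof (Ha 4%nat ltac:(lia)) as A4.
  pose proof (Ha 5%nat ltac:(lia)) as A5.
  assert (K1 : kappa1 s t = - x 0%nat) by (rewrite X0; unfold nu0; ring).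
  assert (K2 : kappa2 s t = x 2%nat - - x 0%nat * x 1%nat)
    by (rewrite X2, X1, X0; unfold nu2, nu0; ring).
  assert (K3 : kappa3 s t = - x 0%nat * x 3%nat + kappa2 s t * (x 0%nat ^ 2 - 2 * x 1%nat) - x 4%nat)
    by (rewrite X4, X3, X1, X0; unfold nu4, nu0; ring).
  assert (N1 : x 1%nat = - x 0%nat ^ 2) by (rewrite X1, X0; reflexivity).
  assert (N3 : x 3%nat = - x 0%nat * x 2%nat - 2 * kappa2 s t * x 0%nat)
    by (rewrite X3, X2, X0; unfold nu3, nu0; ring).
  assert (Hr1 : Rabs r <= 1).
  { eapply Rle_trans. apply Hr. unfold rate. lra. }
  (* the quotient of the remainder by [r^7], found by eliminating the first
     coefficients of [nu] *)
  set (q := a 5%nat - kappa1 s t * a 4%nat + 2 * kappa2 s t * a 2%nat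
            - kappa2 s t * (a 0%nat + x 0%nat) * a 1%nat
            + kappa3 s t * (r * 3 * a 0%nat ^ 2 - 3 * a 0%nat - r ^ 2 * a 0%nat ^ 3)).
  replace (r + invol s t r - kappa1 s t * (r * invol s t r)
           - kappa2 s t * (r * invol s t r) ^ 2 - kappa3 s t * (r * invol s t r) ^ 3)
    with (q * r ^ 7).
  - apply Rle_trans with (C * Rabs r ^ 7).
    + rewrite Rabs_mult, <- (RPow_abs r). apply Rmult_le_compat_r. apply pow_le, Rabs_pos.
      unfold q. rewrite K3, K1, K2. subst C. bound_abs.
    + apply Rmult_le_compat_r. apply pow_le, Rabs_pos. pose proof (Rle_abs C). lra.
  - unfold invol. replace (inv_n s t r) with (a 0%nat) by reflexivity.
    unfold q. rewrite (Hrec 0%nat), (Hrec 1%nat), (Hrec 2%nat), (Hrec 3%nat), (Hrec 4%nat).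
    rewrite K3, K1, N3, K2, N1. ring.
Qed.

(** * The derivative of the displacement function *)

(** The derivative on the line of the normalised first integral of a zone. *)
Definition slope (s t x : R) : R := x * (1 + s * x) / ((1 + 3 * x) * (1 + 4 * x) * (1 + t * x)).

(** Below this radius the denominators in [disp_derivative_estimate] are at least
    1/2. *)
Definition rmax : R := / 1000000000.

(** The estimates below only need that a product of factors [1 + O(r)] is again of this
    form, with an explicit constant. *)
Definition near1 (C r x : R) : Prop := Rabs (x - 1) <= C * r.

Lemma near1_mult C D r x y : 0 <= r <= 1 -> 0 <= C -> 0 <= D ->
  near1 C r x -> near1 D r y -> near1 ((1 + C) * (1 + D) - 1) r (x * y).
Proof.
  unfold near1. intros Hr HC HD Hx Hy.
  replace (x * y - 1) with ((x - 1) * (y - 1) + (x - 1) + (y - 1)) by ring.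
  eapply Rle_trans. apply Rabs_le_plus. apply Rabs_le_plus. apply Rabs_le_mult; eassumption.
  eassumption. eassumption.
  assert (0 <= C * D) by now apply Rmult_le_pos.
  assert (C * D * (r * r) <= C * D * r) by (apply Rmult_le_compat_l; nra). lra.
Qed.

Lemma near1_inv C r x : C * r <= / 2 -> near1 C r x -> near1 (2 * C) r (/ x).
Proof.
  unfold near1. intros HC Hx.
  assert (/ 2 <= x). { apply Rabs_le_between in Hx. lra. }
  replace (/ x - 1) with (- (x - 1) * / x) by (field; lra).
  replace (2 * C * r) with ((C * r) * 2) by ring.
  apply Rabs_le_mult. now apply Rabs_le_opp. rewrite Rabs_pos_eq.
  replace 2 with (/ / 2) by field. apply Rinv_le_contravar; lra.
  apply Rlt_le, Rinv_0_lt_compat; lra.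
Qed.

Lemma near1_lin C a r x : Rabs a <= C -> Rabs x <= r -> near1 C r (1 + a * x).
Proof.
  intros Ha Hx. unfold near1. replace (1 + a * x - 1) with (a * x) by ring.
  now apply Rabs_le_mult.
Qed.

Lemma near1_le C D r x : 0 <= r -> C <= D -> near1 C r x -> near1 D r x.
Proof. unfold near1. intros Hr H Hx. nra. Qed.

Lemma near1_pos C r x : C * r <= / 2 -> near1 C r x -> / 2 <= x.
Proof. unfold near1. intros HC H. apply Rabs_le_between in H. lra. Qed.

Lemma invol_bounds s t r : Rabs s <= 10 -> Rabs t <= 10 -> 0 < r <= rmax ->
  - (2 * r) <= invol s t r <= - (r / 2) /\ Rabs (inv_n s t r) <= 200.
Proof.
  intros Hs Ht Hr. unfold rmax in Hr.
  assert (Hn : Rabs (inv_n s t r) <= 200).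
  { apply inv_n_bound; auto. rewrite Rabs_pos_eq by lra. unfold rate. lra. }
  split; auto. unfold invol. apply Rabs_le_between in Hn.
  set (n := inv_n s t r) in *. nra.
Qed.

Lemma small_in_disc r : 0 < r <= rmax -> Rabs r <= / (2 * rate) /\ Rabs r < / rate.
Proof. unfold rmax, rate. intros H. rewrite Rabs_pos_eq by lra. lra. Qed.

Lemma invol_slope s t r : Rabs s <= 10 -> Rabs t <= 10 -> 0 < r <= rmax ->
  invol' s t r * slope s t (invol s t r) = slope s t r.
Proof.
  intros Hs Ht Hr. pose proof (invol_bounds s t r Hs Ht Hr) as [Hz _].
  pose proof (invol_equation s t r Hs Ht (proj2 (small_in_disc r Hr))) as H. cbv zeta in H.
  set (z := invol s t r) in *. unfold slope. unfold rmax in Hr.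
  apply Rabs_le_between in Hs. apply Rabs_le_between in Ht.
  assert (0 < 1 + t * r) by nra. assert (0 < 1 + t * z) by nra.
  field_simplify_eq. lra. repeat split; lra.
Qed.

(** If [G] is the integral of one zone on the line and [(s, t)] belongs to the other
    zone, the zeros of [disp] are the points where a half turn through the second zone
    ends on the level of [G] on which it started. *)
Definition disp (s t : R) (G : R -> R) (r : R) : R := G (invol s t r) - G r.

Definition level_of (s t : R) (G : R -> R) : Prop :=
  forall x, Rabs x <= / 100 -> is_derive G x (slope s t x).

Lemma disp_derive s1 t1 s2 t2 G r :
  Rabs s1 <= 10 -> Rabs t1 <= 10 -> 0 <= r <= rmax -> level_of s2 t2 G ->
  is_derive (disp s1 t1 G) r (invol' s1 t1 r * slope s2 t2 (invol s1 t1 r) - slope s2 t2 r).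
Proof.
  intros Hs Ht Hr HG. unfold disp.
  assert (Hz : - (2 * r) <= invol s1 t1 r <= 0).
  { destruct (Req_dec r 0) as [->|Hr0]. unfold invol. lra.
    pose proof (invol_bounds s1 t1 r Hs Ht ltac:(lra)) as [Hz _]. lra. }
  assert (Hr' : Rabs r < / rate) by (unfold rmax, rate in *; rewrite Rabs_pos_eq by lra; lra).
  unfold rmax in Hr.
  apply (is_derive_minus (fun r => G (invol s1 t1 r)) G r).
  - apply (is_derive_comp G (invol s1 t1)).
    apply HG. apply Rabs_le. lra.
    now apply invol_derive.
  - apply HG. apply Rabs_le. lra.
Qed.

(** It vanishes when the two zones have the same pair [(s, t)]. *)
Definition cross (s1 t1 s2 t2 : R) : R := s2 * t1 - s1 * t2.

(** The quotient [(1 + s2 x) (1 + t1 x) / ((1 + s1 x) (1 + t2 x))] of the slopes of the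
    two zones has degree 2, so its difference at two points is the difference of the
    points times a symmetric polynomial of degree one in each of them. *)
Lemma ratio_identity s1 t1 s2 t2 m0 m1 x y :
  s2 * (1 - m0 * t1) = - (t1 + m1) -> t2 * (1 - m0 * s1) = - (s1 + m1) ->
  (1 + s2 * y) * (1 + t1 * y) * ((1 + s1 * x) * (1 + t2 * x))
  - (1 + s2 * x) * (1 + t1 * x) * ((1 + s1 * y) * (1 + t2 * y))
  = (y - x) * (cross s1 t1 s2 t2 * (m0 + (x + y) - m1 * (x * y))).
Proof.
  intros E1 E2. unfold cross.
  assert (H1 : s2 + t1 - (s1 + t2) = m0 * (s2 * t1 - s1 * t2)) by lra.
  assert (H2 : s2 * t1 * (s1 + t2) - (s2 + t1) * (s1 * t2) = - m1 * (s2 * t1 - s1 * t2)).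
  { apply Rminus_diag_uniq.
    transitivity (s2 * t1 * (s1 + m1) - s1 * t2 * (t1 + m1) + s2 * t2 * (t1 - s1)). ring.
    replace (s1 + m1) with (- (t2 * (1 - m0 * s1))) by lra.
    replace (t1 + m1) with (- (s2 * (1 - m0 * t1))) by lra. ring. }
  transitivity ((y - x) * ((s2 + t1 - (s1 + t2)) + (s2 * t1 - s1 * t2) * (x + y)
     + (s2 * t1 * (s1 + t2) - (s2 + t1) * (s1 * t2)) * (x * y))). ring.
  rewrite H1, H2. ring.
Qed.

(** By [ratio_identity] the derivative is exactly [- 2 r^2 U b (m0 + S - m1 P)] with
    [U = 1 + O(r)], and [P = - r^2 (1 + O(r))]; [invol_symmetric_expansion] is
    substituted for [S]. The error is relative to each coefficient separately, because
    they will be of different orders of magnitude, and keeps the factor [b], which may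
    be small. *)
Lemma disp_derivative_estimate : exists C, 0 < C /\
  forall s1 t1 s2 t2 m0 m1 r,
  Rabs s1 <= 10 -> Rabs t1 <= 10 -> Rabs s2 <= 10 -> Rabs t2 <= 10 -> 0 < r <= rmax ->
  s2 * (1 - m0 * t1) = - (t1 + m1) -> t2 * (1 - m0 * s1) = - (s1 + m1) ->
  let b := cross s1 t1 s2 t2 in
  let e1 := kappa1 s1 t1 - m1 in let e2 := kappa2 s1 t1 in let e3 := kappa3 s1 t1 in
  Rabs (invol' s1 t1 r * slope s2 t2 (invol s1 t1 r) - slope s2 t2 r
        + 2 * b * r ^ 2 * (m0 - e1 * r ^ 2 + e2 * r ^ 4 - e3 * r ^ 6))
  <= C * (Rabs b * (r ^ 3 * (Rabs m0 + Rabs e1 * r ^ 2 + Rabs e2 * r ^ 4 + (1 + Rabs e3) * r ^ 6))).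
Proof.
  destruct invol_symmetric_expansion as (CS & HCS & HS).
  (* a common constant for the factors [U0], [U0 V], [U0 V^2], [U0 V^3] that multiply
     the four coefficients *)
  set (U := 100000000000000000).
  exists (2 * (U + 2 * CS)). split. unfold U; lra.
  intros s1 t1 s2 t2 m0 m1 r Hs1 Ht1 Hs2 Ht2 Hr E1 E2 b e1 e2 e3.
  pose proof (invol_bounds s1 t1 r Hs1 Ht1 Hr) as [Hz Hn].
  pose proof (invol_slope s1 t1 r Hs1 Ht1 Hr) as Hom.
  specialize (HS s1 t1 r Hs1 Ht1 (proj1 (small_in_disc r Hr))). cbv zeta in HS.
  fold e2 e3 in HS.
  assert (Hzn : invol s1 t1 r = - r + r ^ 2 * inv_n s1 t1 r) by reflexivity.
  set (z := invol s1 t1 r) in *. set (n := inv_n s1 t1 r) in *. set (d := invol' s1 t1 r) in *.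
  unfold rmax in Hr. rewrite (Rabs_pos_eq r) in HS by lra.
  assert (Hr01 : 0 <= r <= 1) by lra.
  assert (Rr : Rabs r <= r) by (rewrite Rabs_pos_eq; lra).
  assert (Rz : Rabs z <= 2 * r) by (apply Rabs_le; lra).
  assert (lin2 : forall a, Rabs a <= 10 -> near1 20 r (1 + a * z)).
  { intros a Ha. unfold near1. replace (1 + a * z - 1) with (a * z) by ring.
    replace (20 * r) with (10 * (2 * r)) by ring. now apply Rabs_le_mult. }
  set (Den := (1 + 3 * r) * ((1 + 4 * r) * ((1 + t1 * r) * ((1 + s1 * z) * ((1 + t2 * z) * (1 + t2 * r)))))).
  assert (HDen : near1 2000000 r Den).
  { unfold Den.
    eapply near1_le; [lra| |apply near1_mult; [lra| | |apply (near1_lin 3); auto; rewrite Rabs_pos_eq; lra|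
      apply near1_mult; [lra| | |apply (near1_lin 4); auto; rewrite Rabs_pos_eq; lra|
      apply near1_mult; [lra| | |apply (near1_lin 10); auto|
      apply near1_mult; [lra| | |apply lin2; auto|
      apply near1_mult; [lra| | |apply lin2; auto|apply (near1_lin 10); auto]]]]]]; lra. }
  assert (HD0 : / 2 <= Den) by (eapply near1_pos; [|exact HDen]; lra).
  set (V := 1 - r * n).
  assert (HV : near1 200 r V).
  { unfold near1, V. replace (1 - r * n - 1) with (- n * r) by ring. apply Rabs_le_mult; auto.
  now apply Rabs_le_opp. }
  set (U0 := (1 - / 2 * (r * n)) * / Den).
  assert (HU0 : near1 500000000 r U0).
  { apply near1_le with ((1 + 100) * (1 + 2 * 2000000) - 1); [lra|lra|]. apply near1_mult; [lra|lra|lra| |].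
    unfold near1. replace (1 - / 2 * (r * n) - 1) with (- (/ 2 * n) * r) by field.
    apply Rabs_le_mult; auto. apply Rabs_le_opp. rewrite Rabs_mult, Rabs_pos_eq by lra. lra.
    apply near1_inv; [lra|exact HDen]. }
  assert (HU0' : Rabs U0 <= 2).
  {    assert (Hw := HU0). unfold near1 in Hw. replace U0 with (U0 - 1 + 1) by ring.
    eapply Rle_trans. apply Rabs_triang. rewrite Rabs_R1. lra. }
  assert (HU1 : near1 200000000000 r (U0 * V)).
  { eapply near1_le; [lra| |apply near1_mult; [lra| | |exact HU0|exact HV]]; lra. }
  assert (HU2 : near1 50000000000000 r (U0 * V * V)).
  { eapply near1_le; [lra| |apply near1_mult; [lra| | |exact HU1|exact HV]]; lra. }
  assert (HU3 : near1 U r (U0 * V * V * V)).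
  { unfold U. eapply near1_le; [lra| |apply near1_mult; [lra| | |exact HU2|exact HV]]; lra. }
  apply (near1_le _ U) in HU0; [|lra|unfold U; lra].
  apply (near1_le _ U) in HU1; [|lra|unfold U; lra].
  apply (near1_le _ U) in HU2; [|lra|unfold U; lra].
  set (err := r + z - kappa1 s1 t1 * (r * z) - e2 * (r * z) ^ 2 - e3 * (r * z) ^ 3) in *.
  assert (Hd : d * slope s2 t2 z - slope s2 t2 r = - 2 * r ^ 2 * U0 * (b * (m0 + (r + z) - m1 * (r * z)))).
  { apply Rabs_le_between in Hs1. apply Rabs_le_between in Ht1.
    apply Rabs_le_between in Hs2. apply Rabs_le_between in Ht2.
    assert (Q : - 2 * r ^ 2 * (1 - / 2 * (r * n)) = r * (z - r)) by (rewrite Hzn; field).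
    replace (- 2 * r ^ 2 * U0 * (b * (m0 + (r + z) - m1 * (r * z)))) with
      ((- 2 * r ^ 2 * (1 - / 2 * (r * n))) * (b * (m0 + (r + z) - m1 * (r * z))) * / Den)
      by (unfold U0; ring).
    rewrite Q, (Rmult_assoc r (z - r)).
    unfold b. rewrite <- (ratio_identity s1 t1 s2 t2 m0 m1 r z E1 E2).
    assert (P0 : 0 < 1 + t1 * r) by nra. assert (P1 : 0 < 1 + t1 * z) by nra.
    assert (P2 : 0 < 1 + t2 * r) by nra. assert (P3 : 0 < 1 + t2 * z) by nra.
    assert (P4 : 0 < 1 + s1 * r) by nra. assert (P5 : 0 < 1 + s1 * z) by nra.
    assert (Hd : d = slope s1 t1 r / slope s1 t1 z).
    { rewrite <- Hom. field. unfold slope. apply Rmult_integral_contrapositive_currified.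
      apply Rmult_integral_contrapositive_currified; lra.
      apply Rinv_neq_0_compat. apply Rgt_not_eq. repeat apply Rmult_lt_0_compat; lra. }
    rewrite Hd. unfold slope, Den. field. repeat split; lra. }
  rewrite Hd.
  assert (HP : r * z = - r ^ 2 * V) by (rewrite Hzn; unfold V; ring).
  assert (HSm : m0 + (r + z) - m1 * (r * z) = m0 + e1 * (r * z) + e2 * (r * z) ^ 2 + e3 * (r * z) ^ 3 + err)
    by (unfold err, e1; ring).
  rewrite HSm, HP.
  replace (-2 * r ^ 2 * U0 * (b * (m0 + e1 * (- r ^ 2 * V) + e2 * (- r ^ 2 * V) ^ 2 + e3 * (- r ^ 2
      * V) ^ 3 + err))
     + 2 * b * r ^ 2 * (m0 - e1 * r ^ 2 + e2 * r ^ 4 - e3 * r ^ 6))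
    with (- (2 * (b * (r ^ 2 * (m0 * (U0 - 1) - e1 * (r ^ 2 * (U0 * V - 1)) + e2 * (r ^ 4 * (U0 * V * V - 1))
            - e3 * (r ^ 6 * (U0 * V * V * V - 1)) + U0 * err))))) by ring.
  unfold near1 in *.
  assert (R2 : forall k, Rabs (r ^ k) <= r ^ k).
  { intros k. rewrite Rabs_pos_eq. lra. apply pow_le; lra. }
  rewrite Rabs_Ropp, Rabs_mult, (Rabs_pos_eq 2) by lra. rewrite Rabs_mult.
  replace (2 * (U + 2 * CS) * (Rabs b * (r ^ 3 * (Rabs m0 + Rabs e1 * r ^ 2 + Rabs e2 * r ^ 4 + (1
      + Rabs e3) * r ^ 6))))
    with (2 * (Rabs b * (r ^ 2 * ((U + 2 * CS) * r * (Rabs m0 + Rabs e1 * r ^ 2 + Rabs e2 * r ^ 4 +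
        (1 + Rabs e3) * r ^ 6))))) by ring.
  apply Rmult_le_compat_l. lra. apply Rmult_le_compat_l. apply Rabs_pos.
  rewrite Rabs_mult. rewrite (Rabs_pos_eq (r ^ 2)) by (apply pow_le; lra).
  apply Rmult_le_compat_l. apply pow_le; lra.
  eapply Rle_trans.
  { apply Rabs_le_plus; [apply Rabs_le_minus; [apply Rabs_le_plus; [apply Rabs_le_minus|]|]|].
    apply Rabs_le_mult; [apply Rle_refl|exact HU0].
    apply Rabs_le_mult; [apply Rle_refl|apply Rabs_le_mult; [apply R2|exact HU1]].
    apply Rabs_le_mult; [apply Rle_refl|apply Rabs_le_mult; [apply R2|exact HU2]].
    apply Rabs_le_mult; [apply Rle_refl|apply Rabs_le_mult; [apply R2|exact HU3]].
    apply Rabs_le_mult; [exact HU0'|exact HS]. }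
  assert (Hpos : 0 <= CS * r * (Rabs m0 + Rabs e1 * r ^ 2 + Rabs e2 * r ^ 4 + Rabs e3 * r ^ 6)).
  { apply Rmult_le_pos. nra.
    repeat apply Rplus_le_le_0_compat; repeat apply Rmult_le_pos; try apply Rabs_pos; try lra. }
  assert (0 <= U * r ^ 7). { apply Rmult_le_pos. unfold U; lra. apply pow_le; lra. }
  nra.
Qed.

Lemma derive_continuity f x l : is_derive f x l -> continuity_pt f x.
Proof.
  intros H. apply continuity_pt_filterlim. apply (ex_derive_continuous f x). now exists l.
Qed.

(** The estimate of the derivative, integrated from 0. *)
Lemma disp_estimate : exists C, 0 < C /\
  forall s1 t1 s2 t2 m0 m1 G r,
  Rabs s1 <= 10 -> Rabs t1 <= 10 -> Rabs s2 <= 10 -> Rabs t2 <= 10 -> 0 < r <= rmax ->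
  s2 * (1 - m0 * t1) = - (t1 + m1) -> t2 * (1 - m0 * s1) = - (s1 + m1) ->
  level_of s2 t2 G ->
  let b := cross s1 t1 s2 t2 in
  let e1 := kappa1 s1 t1 - m1 in let e2 := kappa2 s1 t1 in let e3 := kappa3 s1 t1 in
  let err := C * (Rabs b * (r ^ 3 * (Rabs m0 + Rabs e1 * r ^ 2 + Rabs e2 * r ^ 4 + (1 + Rabs e3) * r ^ 6))) in
  (exists l, is_derive (disp s1 t1 G) r l /\
     Rabs (l + 2 * b * r ^ 2 * (m0 - e1 * r ^ 2 + e2 * r ^ 4 - e3 * r ^ 6)) <= err) /\
  Rabs (disp s1 t1 G r + 2 * b * r ^ 3 * (m0 / 3 - e1 * r ^ 2 / 5 + e2 * r ^ 4 / 7 - e3 * r ^ 6 / 9))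
    <= err * r.
Proof.
  destruct disp_derivative_estimate as (C & HC & H). exists C. split; auto.
  intros s1 t1 s2 t2 m0 m1 G r Hs1 Ht1 Hs2 Ht2 Hr E1 E2 HG b e1 e2 e3 err.
  split.
  { eexists. split. apply disp_derive; eauto. lra. apply (H s1 t1 s2 t2 m0 m1 r); auto. }
  set (poly := fun x => 2 * b * x ^ 3 * (m0 / 3 - e1 * x ^ 2 / 5 + e2 * x ^ 4 / 7 - e3 * x ^ 6 / 9)).
  set (dpoly := fun x => 2 * b * x ^ 2 * (m0 - e1 * x ^ 2 + e2 * x ^ 4 - e3 * x ^ 6)).
  assert (Hp : forall x, is_derive poly x (dpoly x)).
  { intros x. unfold poly, dpoly. auto_derive. auto. field. }
  set (df := fun x => invol' s1 t1 x * slope s2 t2 (invol s1 t1 x) - slope s2 t2 x + dpoly x).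
  assert (Hf : forall x, 0 <= x <= r -> is_derive (fun x => disp s1 t1 G x + poly x) x (df x)).
  { intros x Hx. apply (is_derive_plus (disp s1 t1 G) poly). apply disp_derive; auto. lra. apply Hp. }
  destruct (MVT_gen (fun x => disp s1 t1 G x + poly x) 0 r df) as (c & Hc & Heq).
  - rewrite Rmin_left, Rmax_right by lra. intros x Hx. apply Hf. lra.
  - rewrite Rmin_left, Rmax_right by lra. intros x Hx. eapply derive_continuity, Hf. lra.
  - rewrite Rmin_left, Rmax_right in Hc by lra.
    assert (D0 : disp s1 t1 G 0 + poly 0 = 0).
    { unfold disp, poly, invol. replace (- 0 + 0 ^ 2 * inv_n s1 t1 0) with 0 by ring. ring. }
    rewrite D0, !Rminus_0_r in Heq. unfold poly at 1 in Heq. rewrite Heq.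
    rewrite Rabs_mult, (Rabs_pos_eq r) by lra. apply Rmult_le_compat_r. lra.
    destruct (Req_dec c 0) as [->|Hc0].
    + unfold df, dpoly, slope, invol. rewrite Rabs_left1.
      2:{ unfold Rdiv. right. ring. }
      unfold err. apply Rle_trans with 0. right. unfold Rdiv. ring.
      assert (Hpw : forall k, 0 <= r ^ k) by (intros k; apply pow_le; lra).
      pose proof (Rabs_pos e3).
      apply Rmult_le_pos; [lra|]. apply Rmult_le_pos; [apply Rabs_pos|].
      apply Rmult_le_pos; [apply Hpw|].
      repeat apply Rplus_le_le_0_compat; try apply Rmult_le_pos; try apply Rabs_pos; try apply Hpw; lra.
    + eapply Rle_trans. apply (H s1 t1 s2 t2 m0 m1 c); auto. lra.
      fold b e1 e2 e3. unfold err. apply Rmult_le_compat_l. lra. apply Rmult_le_compat_l. apply Rabs_pos.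
      assert (Hpw : forall k, 0 <= c ^ k <= r ^ k) by (intros k; split; [apply pow_le;
          lra|apply pow_incr; lra]).
      pose proof (Hpw 2%nat) as P2. pose proof (Hpw 3%nat) as P3. pose proof (Hpw 4%nat) as P4.
      pose proof (Hpw 6%nat) as P6.
      pose proof (Rabs_pos m0); pose proof (Rabs_pos e1);pose proof (Rabs_pos e2);pose proof (Rabs_pos e3).
      apply Rmult_le_compat; try lra.
      repeat apply Rplus_le_le_0_compat; try apply Rmult_le_pos; lra.
      repeat apply Rplus_le_compat; try apply Rmult_le_compat_l; lra.
Qed.

(** * Three simple zeros of the displacement function *)

Lemma simple_zero f a b : a < b ->
  (forall x, a <= x <= b -> exists l, is_derive f x l /\ l <> 0) -> f a * f b < 0 ->
  exists z, a < z < b /\ f z = 0 /\ forall x, a <= x <= b -> f x = 0 -> x = z.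
Proof.
  intros Hab Hd Hs.
  assert (Hc : forall x, a <= x <= b -> continuity_pt f x).
  { intros x Hx. destruct (Hd x Hx) as (l & Hl & _). eapply derive_continuity, Hl. }
  assert (Hex : exists z, a <= z <= b /\ f z = 0).
  { destruct (Rlt_dec (f a) 0) as [Ha|Ha].
    - destruct (Ranalysis5.IVT_interv f a b Hc Hab Ha) as (z & Hz & Hz0). nra. now exists z.
    - assert (Ha0 : f a <> 0) by (intros E; rewrite E in Hs; lra).
      assert (0 < f a) by lra. assert (f b < 0) by nra.
      destruct (Ranalysis5.IVT_interv (fun x => - f x) a b) as (z & Hz & Hz0); try lra.
      intros x Hx. now apply continuity_pt_opp, Hc. exists z. split; auto. lra. }
  destruct Hex as (z & Hz & Hz0). exists z.
  assert (Hza : z <> a) by (intros ->; nra). assert (Hzb : z <> b) by (intros ->; nra).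
  repeat split; try lra; auto.
  assert (Hno : forall u v, a <= u -> u < v -> v <= b -> f u = 0 -> f v = 0 -> False).
  { intros u v Hu Huv Hv Fu Fv.
    destruct (MVT_gen f u v (Derive f)) as (c & Hcc & Heq).
    - rewrite Rmin_left, Rmax_right by lra. intros x Hx.
      destruct (Hd x) as (l & Hl & _); [lra|]. apply Derive_correct. now exists l.
    - rewrite Rmin_left, Rmax_right by lra. intros x Hx. apply Hc. lra.
    - rewrite Rmin_left, Rmax_right in Hcc by lra.
      destruct (Hd c) as (l & Hl & Hl0); [lra|]. rewrite (is_derive_unique _ _ _ Hl) in Heq.
      rewrite Fu, Fv in Heq. apply Hl0. nra. }
  intros x Hx Hx0. destruct (Rtotal_order x z) as [?|[?|?]]; auto; exfalso.
  apply (Hno x z); lra. apply (Hno z x); lra.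
Qed.

Lemma neg_pos x y : x < 0 -> 0 < y -> x * y < 0.
Proof. intros. nra. Qed.

(** Used with [u] the displacement and [v] the model: an error of size [|A| w] does not
    change the sign where the model exceeds 1 in absolute value. *)
Lemma sign_transfer A w u v : 0 < w -> A <> 0 -> Rabs (u - A * w * v) <= Rabs A * w ->
  (1 < v -> 0 < A * u) /\ (v < -1 -> A * u < 0).
Proof.
  intros Hw HA H.
  assert (H2 : Rabs (A * u - A * A * w * v) <= A * A * w).
  { replace (A * u - A * A * w * v) with (A * (u - A * w * v)) by ring.
    rewrite Rabs_mult. replace (A * A * w) with (Rabs A * (Rabs A * w)).
    apply Rmult_le_compat_l; auto using Rabs_pos.
    rewrite <- Rmult_assoc, <- Rabs_mult. rewrite Rabs_pos_eq; auto. apply Rle_0_sqr. }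
  assert (Hp : 0 < A * A * w) by (apply Rmult_lt_0_compat; auto; now apply Rlt_0_sqr).
  set (p := A * A * w) in *. apply Rabs_le_between in H2. clear H.
  split; intros Hv; nra.
Qed.

(** The rescaled limit of the displacement function. Its zeros 1, 2, 3 are a convenient
    choice: any three distinct positive zeros would do, and they fix the coefficients
    12, 245/9 and 98/9 of [disp_three_zeros]. *)
Definition model (z : R) : R := z ^ 3 * ((z ^ 2 - 1) * (z ^ 2 - 4) * (z ^ 2 - 9)).
Definition dmodel (z : R) : R := z ^ 2 * (9 * z ^ 6 - 98 * z ^ 4 + 245 * z ^ 2 - 108).

Lemma dmodel_large z :
  9 / 10 <= z <= 11 / 10 \/ 19 / 10 <= z <= 21 / 10 \/ 29 / 10 <= z <= 31 / 10 ->
  1 < Rabs (dmodel z).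
Proof.
  intros H. unfold dmodel. rewrite Rabs_mult, (Rabs_pos_eq (z ^ 2)) by apply pow2_ge_0.
  replace (9 * z ^ 6 - 98 * z ^ 4 + 245 * z ^ 2 - 108) with
   (9 * (z ^ 2) ^ 3 - 98 * (z ^ 2) ^ 2 + 245 * z ^ 2 - 108) by ring.
  assert (Hw : 81 / 100 <= z ^ 2 <= 121 / 100 \/ 361 / 100 <= z ^ 2 <= 441 / 100 \/ 841 / 100 <= z
      ^ 2 <= 961 / 100).
  { destruct H as [H|[H|H]]; [left|right; left|right; right]; nra. }
  set (w := z ^ 2) in *.
  assert (Hp : 2 < Rabs (9 * w ^ 3 - 98 * w ^ 2 + 245 * w - 108)).
  { destruct Hw as [Hw|[Hw|Hw]].
    - apply Rlt_le_trans with (9 * w ^ 3 - 98 * w ^ 2 + 245 * w - 108); [|apply Rle_abs].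
      assert (0 <= (w - 81 / 100) * (121 / 100 - w)) by (apply Rmult_le_pos; lra).
      assert (0 <= w * ((w - 81 / 100) * (w - 81/100))) by (apply Rmult_le_pos; nra).
      nra.
    - rewrite Rabs_left1.
      assert (0 <= (w - 361 / 100) * (441 / 100 - w)) by (apply Rmult_le_pos; lra).
      assert (0 <= w * ((w - 361 / 100) * (441 / 100 - w))) by (apply Rmult_le_pos; nra).
      nra. assert (0 <= (w - 361 / 100) * (441 / 100 - w)) by (apply Rmult_le_pos; lra).
      assert (0 <= w * ((w - 361 / 100) * (441 / 100 - w))) by (apply Rmult_le_pos; nra). nra.
    - apply Rlt_le_trans with (9 * w ^ 3 - 98 * w ^ 2 + 245 * w - 108); [|apply Rle_abs].
      assert (0 <= w * ((w - 841 / 100) * (w - 841/100))) by (apply Rmult_le_pos; nra).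
      nra. }
  assert (81 / 100 <= w) by lra. nra.
Qed.

(** With these coefficients every term of [disp_estimate] at [r = eps z] has order
    [eps^9] (and [eps^8] for the derivative), and their sum is
    [(2/9) b kappa3 eps^9 model z]. At distance 1/10 from its three positive zeros the
    model exceeds 1 in absolute value, and so does its derivative up to that distance,
    which absorbs the error. *)
Lemma disp_three_zeros k : 0 < k -> exists eps0, 0 < eps0 /\
  forall eps s1 t1 s2 t2 m0 m1 G,
  0 < eps < eps0 ->
  Rabs s1 <= 10 -> Rabs t1 <= 10 -> Rabs s2 <= 10 -> Rabs t2 <= 10 ->
  k <= Rabs (kappa3 s1 t1) ->
  kappa2 s1 t1 = 98 / 9 * kappa3 s1 t1 * eps ^ 2 ->
  m0 = 12 * kappa3 s1 t1 * eps ^ 6 ->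
  m1 = kappa1 s1 t1 - 245 / 9 * kappa3 s1 t1 * eps ^ 4 ->
  s2 * (1 - m0 * t1) = - (t1 + m1) -> t2 * (1 - m0 * s1) = - (s1 + m1) ->
  cross s1 t1 s2 t2 <> 0 ->
  level_of s2 t2 G ->
  4 * eps <= rmax /\
  forall i, i = 1 \/ i = 2 \/ i = 3 ->
    exists r, eps * (i - / 10) < r < eps * (i + / 10) /\ disp s1 t1 G r = 0 /\
      forall x, eps * (i - / 10) <= x <= eps * (i + / 10) -> disp s1 t1 G x = 0 -> x = r.
Proof.
  intros Hk. destruct disp_estimate as (C & HC & H).
  (* on [z <= 4] the bracket of [disp_estimate] is at most [8000 |kappa3| + 4096],
     and [4096 <= (4096 / k) |kappa3|]; 288 is [64 * 9 / 2] *)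
  set (D := C * 288 * (8000 + 4096 / k)).
  assert (Hk' : 0 < 4096 / k) by (apply Rdiv_lt_0_compat; lra).
  assert (HD : 0 < D) by (unfold D; nra).
  exists (Rmin (/ (4 * D)) (rmax / 4)). split.
  { apply Rmin_glb_lt. apply Rinv_0_lt_compat. lra. unfold rmax; lra. }
  intros eps s1 t1 s2 t2 m0 m1 G He Hs1 Ht1 Hs2 Ht2 Hk3 Hk2 Hm0 Hm1 E1 E2 Hb HG.
  assert (He1 : eps * (4 * D) <= 1).
  { assert (eps < / (4 * D)) by (eapply Rlt_le_trans; [apply He|apply Rmin_l]).
    apply Rmult_le_reg_r with (/ (4 * D)). apply Rinv_0_lt_compat; lra.
    rewrite Rmult_assoc, Rinv_r by lra. lra. }
  assert (He2 : 4 * eps <= rmax).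
  { assert (eps < rmax / 4) by (eapply Rlt_le_trans; [apply He|apply Rmin_r]). lra. }
  destruct He as [He _]. split; auto.
  set (b := cross s1 t1 s2 t2) in *. set (k3 := kappa3 s1 t1) in *.
  set (A := 2 * b * k3 / 9).
  assert (Hk3' : k3 <> 0). { intros E. rewrite E, Rabs_R0 in Hk3. lra. }
  assert (HA : 0 < Rabs A).
  { apply Rabs_pos_lt. unfold A, Rdiv. apply Rmult_integral_contrapositive_currified; [|lra].
    repeat (apply Rmult_integral_contrapositive_currified; [|assumption]); try assumption; lra. }
  assert (Hest : forall z, 1 / 2 <= z <= 4 ->
     (exists l, is_derive (disp s1 t1 G) (eps * z) l /\
        Rabs (l - A * eps ^ 8 * dmodel z) <= Rabs A * eps ^ 8) /\
     Rabs (disp s1 t1 G (eps * z) - A * eps ^ 9 * model z) <= Rabs A * eps ^ 9).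
  { intros z Hz.
    assert (Hr : 0 < eps * z <= rmax). { split; [apply Rmult_lt_0_compat; lra|].
      apply Rle_trans with (4 * eps); auto. rewrite Rmult_comm. apply Rmult_le_compat_r; lra. }
    pose proof (H s1 t1 s2 t2 m0 m1 G (eps * z) Hs1 Ht1 Hs2 Ht2 Hr E1 E2 HG) as HH.
    cbv zeta in HH. fold b k3 in HH.
    replace (kappa1 s1 t1 - m1) with (245 / 9 * k3 * eps ^ 4) in HH by (rewrite Hm1; ring).
    rewrite Hk2, Hm0 in HH.
    set (err := C * (Rabs b * ((eps * z) ^ 3 *
        (Rabs (12 * k3 * eps ^ 6) + Rabs (245 / 9 * k3 * eps ^ 4) * (eps * z) ^ 2 +
         Rabs (98 / 9 * k3 * eps ^ 2) * (eps * z) ^ 4 + (1 + Rabs k3) * (eps * z) ^ 6)))) in HH.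
    assert (Herr : err <= Rabs A * eps ^ 8 * (eps * D)).
    { assert (Hep : forall j, 0 <= eps ^ j) by (intros j; apply pow_le; lra).
      unfold err. rewrite !Rabs_mult, !(Rabs_pos_eq (eps ^ _)) by apply Hep.
      rewrite (Rabs_pos_eq 12), (Rabs_pos_eq (245 / 9)), (Rabs_pos_eq (98 / 9)) by lra.
      unfold A, Rdiv. rewrite !Rabs_mult, (Rabs_pos_eq 2), (Rabs_pos_eq (/ 9)) by lra.
      assert (Hz2 : 0 <= z ^ 2 <= 4 ^ 2) by (split; [apply pow_le; lra|apply pow_incr; lra]).
      assert (Hz3 : 0 <= z ^ 3 <= 4 ^ 3) by (split; [apply pow_le; lra|apply pow_incr; lra]).
      assert (Hz4 : 0 <= z ^ 4 <= 4 ^ 4) by (split; [apply pow_le; lra|apply pow_incr; lra]).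
      assert (Hz6 : 0 <= z ^ 6 <= 4 ^ 6) by (split; [apply pow_le; lra|apply pow_incr; lra]).
      pose proof (Rabs_pos k3) as K0. pose proof (Rabs_pos b) as B0.
      apply Rle_trans with (C * (Rabs b * (eps ^ 9 * (z ^ 3 * (12 * Rabs k3 + 245 / 9 * Rabs k3 * z ^ 2
         + 98 / 9 * Rabs k3 * z ^ 4 + (1 + Rabs k3) * z ^ 6))))).
      right. unfold Rdiv. ring.
      apply Rle_trans with (C * (Rabs b * (eps ^ 9 * (64 * ((8000 + 4096 / k) * Rabs k3))))).
      2:{ right. unfold D, Rdiv. field. lra. }
      apply Rmult_le_compat_l; [lra|]. apply Rmult_le_compat_l; [lra|]. apply Rmult_le_compat_l; [apply Hep|].
      assert (4096 <= 4096 / k * Rabs k3).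
      { replace 4096 with (4096 / k * k) at 1 by (field; lra). apply Rmult_le_compat_l; lra. }
      apply Rmult_le_compat; try lra.
      repeat apply Rplus_le_le_0_compat; repeat apply Rmult_le_pos; lra. nra. }
    assert (Hae : 0 <= Rabs A * eps ^ 8) by (apply Rmult_le_pos; [lra|apply pow_le; lra]).
    destruct HH as [(l & Hl & Hle) Hd]. split.
    - exists l. split; auto.
      replace (l - A * eps ^ 8 * dmodel z) with
        (l + 2 * b * (eps * z) ^ 2 * (12 * k3 * eps ^ 6 - 245 / 9 * k3 * eps ^ 4 * (eps * z) ^ 2 +
              98 / 9 * k3 * eps ^ 2 * (eps * z) ^ 4 - k3 * (eps * z) ^ 6))
        by (unfold A, dmodel; field).
      eapply Rle_trans. apply Hle. eapply Rle_trans. apply Herr. nra.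
    - replace (disp s1 t1 G (eps * z) - A * eps ^ 9 * model z) with
       (disp s1 t1 G (eps * z) + 2 * b * (eps * z) ^ 3 *
        (12 * k3 * eps ^ 6 / 3 - 245 / 9 * k3 * eps ^ 4 * (eps * z) ^ 2 / 5 +
         98 / 9 * k3 * eps ^ 2 * (eps * z) ^ 4 / 7 - k3 * (eps * z) ^ 6 / 9))
        by (unfold A, model; field).
      eapply Rle_trans. apply Hd. apply Rle_trans with (Rabs A * eps ^ 8 * (eps * D) * (eps * z)).
      apply Rmult_le_compat_r; lra.
      replace (Rabs A * eps ^ 8 * (eps * D) * (eps * z)) with (Rabs A * eps ^ 9 * (eps * (z * D))) by ring.
      rewrite <- (Rmult_1_r (Rabs A * eps ^ 9)) at 2. apply Rmult_le_compat_l.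
      apply Rmult_le_pos; [lra|apply pow_le; lra].
      apply Rle_trans with (eps * (4 * D)); auto. apply Rmult_le_compat_l; [lra|].
      apply Rmult_le_compat_r; lra. }
  intros i Hi.
  apply simple_zero.
  - apply Rmult_lt_compat_l; lra.
  - intros x Hx. set (z := x / eps).
    assert (Exz : x = eps * z) by (unfold z; field; lra).
    assert (Hz : i - / 10 <= z <= i + / 10).
    { rewrite Exz in Hx. split; apply Rmult_le_reg_l with eps; lra. }
    destruct (Hest z) as [(l & Hl & Hle) _]. lra.
    exists l. split. now rewrite Exz. intros El. rewrite El in Hle.
    assert (Hm : 1 < Rabs (dmodel z)) by (apply dmodel_large; lra).
    replace (0 - A * eps ^ 8 * dmodel z) with (- (A * eps ^ 8 * dmodel z)) in Hle by ring.
    rewrite Rabs_Ropp, !Rabs_mult, (Rabs_pos_eq (eps ^ 8)) in Hle by (apply pow_le; lra).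
    assert (Hp : 0 < Rabs A * eps ^ 8) by (apply Rmult_lt_0_compat; [lra|apply pow_lt; lra]).
    pose proof (Rmult_lt_compat_l _ _ _ Hp Hm). lra.
  - assert (HA0 : A <> 0) by (intros E; rewrite E, Rabs_R0 in HA; lra).
    assert (He9 : 0 < eps ^ 9) by (apply pow_lt; lra).
    destruct (Hest (i - / 10)) as [_ Ha]; [lra|]. destruct (Hest (i + / 10)) as [_ Hbb]; [lra|].
    apply sign_transfer in Ha; auto. apply sign_transfer in Hbb; auto. destruct Ha as [Ha1 Ha2].
    destruct Hbb as [Hb1 Hb2].
    set (u := disp s1 t1 G (eps * (i - / 10))) in *. set (v := disp s1 t1 G (eps * (i + / 10))) in *.
    assert (HAA : 0 < A * A). { apply Rlt_0_sqr. intros E. rewrite E, Rabs_R0 in HA. lra. }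
    assert (A * u * (A * v) < 0).
    { destruct Hi as [->|[->| ->]].
      + assert (A * u < 0) by (apply Ha2; unfold model; lra).
      assert (0 < A * v) by (apply Hb1; unfold model; lra). now apply neg_pos.
      + assert (0 < A * u) by (apply Ha1; unfold model; lra).
      assert (A * v < 0) by (apply Hb2; unfold model; lra). rewrite Rmult_comm. now apply neg_pos.
      + assert (A * u < 0) by (apply Ha2; unfold model; lra).
      assert (0 < A * v) by (apply Hb1; unfold model; lra). now apply neg_pos. }
    apply Rnot_le_lt. intros Huv. assert (0 <= A * A * (u * v)) by (apply Rmult_le_pos; lra).
    replace (A * A * (u * v)) with (A * u * (A * v)) in * by ring. lra.
Qed.

(** * The order of vanishing of the difference of two half-return maps *)

Lemma radius_decr_n (W : nat -> R) n : CV_radius (PS_decr_n W n) = CV_radius W.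
Proof.
  induction n as [|n IH]. apply CV_radius_ext. reflexivity.
  rewrite <- IH, <- (CV_radius_decr_1 (PS_decr_n W n)). apply CV_radius_ext.
  intros k. unfold PS_decr_n, PS_decr_1. f_equal. lia.
Qed.

Lemma pseries_near_0 (W : nat -> R) : Rbar_lt 0 (CV_radius W) -> forall e, 0 < e ->
  exists d, 0 < d /\ forall r, 0 < r < d -> Rabs (PSeries W r - W 0%nat) < e.
Proof.
  intros HW e He.
  assert (Hc : continuity_pt (PSeries W) 0) by (apply PSeries_continuity; now rewrite Rabs_R0).
  destruct (Hc e He) as (d & Hd & H). exists d. split; auto. intros r Hr.
  specialize (H r). simpl in H. unfold Rdist in H. rewrite PSeries_0 in H.
  apply H. split. unfold D_x, no_cond. split; auto. lra. rewrite Rminus_0_r, Rabs_pos_eq; lra.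
Qed.

(** The Taylor coefficients are read off from the size of the sum on the right of 0. *)
Lemma pseries_order (W : nat -> R) n m K d : Rbar_lt 0 (CV_radius W) -> 0 < m -> 0 < d ->
  (forall r, 0 < r < d -> m * r ^ n <= Rabs (PSeries W r) <= K * r ^ n) ->
  (forall j, (j < n)%nat -> W j = 0) /\ W n <> 0.
Proof.
  intros HW Hm Hd H.
  assert (H0 : forall j, (j <= n)%nat -> forall k, (k < j)%nat -> W k = 0).
  { induction j as [|j IH]; intros Hj k Hk. lia.
    destruct (Nat.eq_dec k j) as [->|Hkj]. 2:{ apply IH; lia. }
    destruct (Req_dec (W j) 0) as [E|E]; auto. exfalso.
    assert (Hp : 0 < Rabs (W j)) by now apply Rabs_pos_lt.
    destruct (pseries_near_0 (PS_decr_n W j)) with (e := Rabs (W j) / 2) as (d' & Hd' & Hn).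
    now rewrite radius_decr_n. lra.
    assert (HK : 0 < K).
    { specialize (H (d / 2) ltac:(lra)). assert (0 < (d / 2) ^ n) by (apply pow_lt; lra). nra. }
    set (r := Rmin (Rmin (d / 2) (d' / 2)) (Rmin (/ 2) (Rabs (W j) / (4 * K)))).
    assert (0 < Rabs (W j) / (4 * K)) by (apply Rdiv_lt_0_compat; lra).
    assert (Hr0 : 0 < r) by (unfold r; repeat apply Rmin_glb_lt; lra).
    assert (Hr1 : r <= d / 2) by (unfold r; eapply Rle_trans; apply Rmin_l).
    assert (Hr2 : r <= d' / 2) by (unfold r; eapply Rle_trans; [apply Rmin_l|apply Rmin_r]).
    assert (Hr3 : r <= / 2) by (unfold r; eapply Rle_trans; [apply Rmin_r|apply Rmin_l]).
    assert (Hr4 : r <= Rabs (W j) / (4 * K)) by (unfold r; eapply Rle_trans; [apply Rmin_r|apply Rmin_r]).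
    specialize (Hn r ltac:(lra)). destruct (H r ltac:(lra)) as [_ Hu].
    rewrite (PSeries_decr_n_aux W j) in Hu by (intros; apply IH; lia).
    set (p := PSeries (PS_decr_n W j) r) in *.
    unfold PS_decr_n in Hn. rewrite Nat.add_0_r in Hn.
    replace n with (j + (1 + (n - j - 1)))%nat in Hu by lia.
    rewrite !pow_add, pow_1, Rabs_mult, Rabs_pos_eq in Hu by (apply pow_le; lra).
    assert (Hrj : 0 < r ^ j) by now apply pow_lt.
    assert (Hrk : r ^ (n - j - 1) <= 1) by (rewrite <- (pow1 (n - j - 1)); apply pow_incr; lra).
    assert (Hu' : Rabs p <= K * (r * r ^ (n - j - 1))) by (apply Rmult_le_reg_l with (r ^ j); lra).
    assert (Hu2 : Rabs p <= K * r).
    { eapply Rle_trans. apply Hu'. apply Rmult_le_compat_l. lra.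
      pose proof (Rmult_le_compat_l r _ 1 (Rlt_le _ _ Hr0) Hrk). lra. }
    assert (Hu3 : K * r <= Rabs (W j) / 4).
    { apply Rle_trans with (K * (Rabs (W j) / (4 * K))). apply Rmult_le_compat_l; lra.
      right. field. lra. }
    pose proof (Rabs_triang_inv (W j) p) as Ht. rewrite Rabs_minus_sym in Ht. lra. }
  split. intros j Hj. now apply (H0 n).
  intros E.
  destruct (pseries_near_0 (PS_decr_n W n)) with (e := m) as (d' & Hd' & Hn); auto.
  now rewrite radius_decr_n.
  set (r := Rmin (d / 2) (d' / 2)).
  assert (Hr0 : 0 < r) by (unfold r; repeat apply Rmin_glb_lt; lra).
  assert (Hr1 : r <= d / 2) by apply Rmin_l. assert (Hr2 : r <= d' / 2) by apply Rmin_r.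
  specialize (Hn r ltac:(lra)). destruct (H r ltac:(lra)) as [Hl _].
  rewrite (PSeries_decr_n_aux W n) in Hl by (intros; now apply (H0 n)).
  unfold PS_decr_n in Hn at 2. rewrite Nat.add_0_r, E, Rminus_0_r in Hn.
  rewrite Rabs_mult, (Rabs_pos_eq (r ^ n)) in Hl by (apply pow_le; lra).
  assert (Hrn : 0 < r ^ n) by now apply pow_lt. nra.
Qed.

(** [G o sigma - G] has derivative [sigma' w(sigma) - w = 0] and vanishes at 0. *)
Lemma level_invariant s t G r : Rabs s <= 10 -> Rabs t <= 10 -> level_of s t G ->
  0 <= r <= rmax -> G (invol s t r) = G r.
Proof.
  intros Hs Ht HG Hr.
  assert (H : forall x, 0 <= x <= r -> is_derive (disp s t G) x
     (invol' s t x * slope s t (invol s t x) - slope s t x)).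
  { intros x Hx. apply disp_derive; auto. lra. }
  destruct (MVT_gen (disp s t G) 0 r (fun x => invol' s t x * slope s t (invol s t x) - slope s t x))
    as (c & Hc & Heq).
  - rewrite Rmin_left, Rmax_right by lra. intros x Hx. apply H. lra.
  - rewrite Rmin_left, Rmax_right by lra. intros x Hx. eapply derive_continuity, H. lra.
  - rewrite Rmin_left, Rmax_right in Hc by lra.
    assert (E0 : disp s t G 0 = 0).
    { unfold disp, invol. replace (- 0 + 0 ^ 2 * inv_n s t 0) with 0 by ring. ring. }
    assert (Ec : invol' s t c * slope s t (invol s t c) - slope s t c = 0).
    { destruct (Req_dec c 0) as [->|Hc0].
      - unfold slope, invol, Rdiv. ring.
      - rewrite invol_slope; auto. ring. lra. }
    rewrite E0, Ec in Heq. unfold disp in Heq. lra.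
Qed.

(** The slope is comparable with its argument, so a zero of the displacement is one
    order higher than that of the difference map. *)
Lemma slope_size s t x : Rabs s <= 10 -> Rabs t <= 10 -> Rabs x <= / 1000 ->
  Rabs x / 2 <= Rabs (slope s t x) <= 2 * Rabs x.
Proof.
  intros Hs Ht Hx. unfold slope, Rdiv. rewrite Rmult_assoc, Rabs_mult.
  assert (H : / 2 <= (1 + s * x) * / ((1 + 3 * x) * (1 + 4 * x) * (1 + t * x)) <= 2).
  { assert (Hsx : Rabs (s * x) <= / 100) by (replace (/ 100) with (10 * / 1000) by lra;
      now apply Rabs_le_mult).
    assert (Htx : Rabs (t * x) <= / 100) by (replace (/ 100) with (10 * / 1000) by lra;
        now apply Rabs_le_mult).
    apply Rabs_le_between in Hx. apply Rabs_le_between in Hsx. apply Rabs_le_between in Htx.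
    set (a := s * x) in *. set (c := t * x) in *.
    assert (H34 : 9 / 10 <= (1 + 3 * x) * (1 + 4 * x) <= 11 / 10) by nra.
    set (p := (1 + 3 * x) * (1 + 4 * x)) in *.
    assert (Hpc : 8 / 10 <= p * (1 + c) <= 12 / 10) by nra.
    set (q := p * (1 + c)) in *.
    assert (/ (12 / 10) <= / q <= / (8 / 10)) by (split; apply Rinv_le_contravar; lra).
    assert (E1 : / (12 / 10) = 10 / 12) by field. assert (E2 : / (8 / 10) = 10 / 8) by field.
    rewrite E1, E2 in *. nra. }
  rewrite (Rabs_pos_eq (_ * / _)) by lra. pose proof (Rabs_pos x). nra.
Qed.

(** The difference of the half-return maps of the two zones, as a power series. *)
Definition diff_ser (s1 t1 s2 t2 : R) : nat -> R :=
  shift (shift (ser_sub (nu (etaser s2 t2)) (nu (etaser s1 t1)))).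

Lemma diff_ser_correct s1 t1 s2 t2 r : Rabs s1 <= 10 -> Rabs t1 <= 10 -> Rabs s2 <= 10 -> Rabs t2 <= 10 ->
  Rabs r < / rate -> PSeries (diff_ser s1 t1 s2 t2) r = invol s2 t2 r - invol s1 t1 r.
Proof.
  intros Hs1 Ht1 Hs2 Ht2 Hr.
  assert (E : ev (diff_ser s1 t1 s2 t2) r (r * (r * (inv_n s2 t2 r - inv_n s1 t1 r)))).
  { repeat apply ev_shift. apply ev_sub; auto.
    split; [|reflexivity]. eexists. now apply maj_nu, maj_eta.
    split; [|reflexivity]. eexists. now apply maj_nu, maj_eta. }
  destruct E as [_ ->]. unfold invol. ring.
Qed.

Lemma diff_ser_radius s1 t1 s2 t2 : Rabs s1 <= 10 -> Rabs t1 <= 10 -> Rabs s2 <= 10 -> Rabs t2 <= 10 ->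
  Rbar_lt 0 (CV_radius (diff_ser s1 t1 s2 t2)).
Proof.
  intros Hs1 Ht1 Hs2 Ht2. rewrite <- Rabs_R0.
  assert (H := rate_pos). eapply (maj_radius rate); auto.
  - unfold diff_ser. apply maj_shift; auto. apply maj_shift; auto. apply maj_sub; apply maj_nu, maj_eta; auto.
  - rewrite Rabs_R0. now apply Rinv_0_lt_compat.
Qed.

(** Here [disp] is [A r^9] up to a factor 2. It is also [G (sigma1 r) - G (sigma2 r)]
    because [G] is invariant under [sigma2]; the mean value theorem divides it by a
    slope of size [r], which leaves [r^8]. *)
Lemma order_eight s1 t1 s2 t2 G :
  Rabs s1 <= 10 -> Rabs t1 <= 10 -> Rabs s2 <= 10 -> Rabs t2 <= 10 ->
  kappa2 s1 t1 = 0 -> kappa3 s1 t1 <> 0 ->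
  s2 = - (t1 + kappa1 s1 t1) -> t2 = - (s1 + kappa1 s1 t1) -> cross s1 t1 s2 t2 <> 0 ->
  level_of s2 t2 G ->
  (forall j, (j < 8)%nat -> diff_ser s1 t1 s2 t2 j = 0) /\ diff_ser s1 t1 s2 t2 8 <> 0.
Proof.
  intros Hs1 Ht1 Hs2 Ht2 K2 K3 E1 E2 Hb HG.
  destruct disp_estimate as (C & HC & H).
  set (b := cross s1 t1 s2 t2) in *. set (k3 := kappa3 s1 t1) in *.
  set (A := Rabs (2 * b * k3 / 9)).
  assert (HA : 0 < A).
  { apply Rabs_pos_lt. apply Rmult_integral_contrapositive_currified; [|lra].
    repeat (apply Rmult_integral_contrapositive_currified; [|assumption]). lra. }
  set (D := C * (Rabs b * (1 + Rabs k3))).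
  assert (HD : 0 < D).
  { unfold D. pose proof (Rabs_pos k3). assert (0 < Rabs b) by now apply Rabs_pos_lt.
    repeat apply Rmult_lt_0_compat; lra. }
  assert (HAD : 0 < A / (2 * D)) by (apply Rdiv_lt_0_compat; lra).
  apply pseries_order with (m := A / 8) (K := 8 * A) (d := Rmin rmax (A / (2 * D))).
  - now apply diff_ser_radius.
  - lra.
  - apply Rmin_glb_lt; auto. unfold rmax. lra.
  - intros r Hr.
    assert (Hr1 : r < rmax) by (eapply Rlt_le_trans; [apply Hr|apply Rmin_l]).
    assert (Hr2 : r < A / (2 * D)) by (eapply Rlt_le_trans; [apply Hr|apply Rmin_r]).
    destruct Hr as [Hr _].
    rewrite diff_ser_correct; auto. 2:{ apply small_in_disc. lra. }
    destruct (H s1 t1 s2 t2 0 (kappa1 s1 t1) G r) as [_ Hd]; auto; try lra. cbv zeta in Hd. fold b k3 in Hd.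
    rewrite K2, Rminus_diag, Rabs_R0 in Hd by reflexivity.
    replace (disp s1 t1 G r + 2 * b * r ^ 3 * (0 / 3 - 0 * r ^ 2 / 5 + 0 * r ^ 4 / 7 - k3 * r ^ 6 / 9))
      with (disp s1 t1 G r - 2 * b * k3 / 9 * r ^ 9) in Hd by field.
    replace (C * (Rabs b * (r ^ 3 * (0 + 0 * r ^ 2 + 0 * r ^ 4 + (1 + Rabs k3) * r ^ 6))) * r)
      with (r ^ 9 * (D * r)) in Hd by (unfold D; ring).
    assert (HDr : D * r <= A / 2).
    { apply Rle_trans with (D * (A / (2 * D))). apply Rmult_le_compat_l; lra. right. field. lra. }
    assert (Hr9 : 0 < r ^ 9) by now apply pow_lt.
    assert (Hdisp : A / 2 * r ^ 9 <= Rabs (disp s1 t1 G r) <= 2 * A * r ^ 9).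
    { assert (HE : Rabs (2 * b * k3 / 9 * r ^ 9) = A * r ^ 9).
      { rewrite Rabs_mult, (Rabs_pos_eq (r ^ 9)) by lra. reflexivity. }
      assert (r ^ 9 * (D * r) <= r ^ 9 * (A / 2)) by (apply Rmult_le_compat_l; lra).
      pose proof (Rabs_triang_inv (2 * b * k3 / 9 * r ^ 9) (disp s1 t1 G r)) as T1.
      rewrite Rabs_minus_sym in T1.
      pose proof (Rabs_triang_inv (disp s1 t1 G r) (2 * b * k3 / 9 * r ^ 9)) as T2.
      rewrite HE in *. split; lra. }
    pose proof (invol_bounds s1 t1 r Hs1 Ht1 ltac:(lra)) as [Z1 _].
    pose proof (invol_bounds s2 t2 r Hs2 Ht2 ltac:(lra)) as [Z2 _].
    set (z1 := invol s1 t1 r) in *. set (z2 := invol s2 t2 r) in *.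
    assert (Hdz : disp s1 t1 G r = G z1 - G z2).
    { unfold disp. fold z1. unfold z2. rewrite level_invariant; auto. lra. }
    destruct (MVT_gen G z2 z1 (slope s2 t2)) as (c & Hc & Heq).
    { intros x Hx. apply HG. unfold rmax in Hr1. apply Rabs_le.
      unfold Rmin, Rmax in Hx. destruct (Rle_dec z2 z1); lra. }
    { intros x Hx. eapply derive_continuity, HG. unfold rmax in Hr1. apply Rabs_le.
      unfold Rmin, Rmax in Hx. destruct (Rle_dec z2 z1); lra. }
    assert (Hcr : - (2 * r) <= c <= - (r / 2)).
    { unfold Rmin, Rmax in Hc. destruct (Rle_dec z2 z1); lra. }
    rewrite Hdz, Heq, Rabs_mult in Hdisp.
    pose proof (slope_size s2 t2 c Hs2 Ht2) as Ho. unfold rmax in Hr1.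
    rewrite Rabs_left in Ho by lra. specialize (Ho ltac:(lra)).
    rewrite (Rabs_minus_sym z2 z1).
    set (p := Rabs (slope s2 t2 c)) in *. set (q := Rabs (z1 - z2)) in *.
    assert (Hq : 0 <= q) by apply Rabs_pos.
    assert (Hp : r / 4 <= p <= 4 * r) by lra.
    replace (r ^ 9) with (r * r ^ 8) in Hdisp by ring.
    assert (0 < r ^ 8) by now apply pow_lt. set (R8 := r ^ 8) in *.
    split.
    + assert (p * q <= 4 * r * q) by (apply Rmult_le_compat_r; lra).
      apply Rmult_le_reg_l with r; auto. lra.
    + assert (r / 4 * q <= p * q) by (apply Rmult_le_compat_r; lra).
      apply Rmult_le_reg_l with r; auto. lra.
Qed.

(** * Rotating planar fields with a first integral *)

(** The field [(f, g)] turns counterclockwise with angular speed between 1/2 and 2 in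
    the disc of radius [R0], and [K] is a first integral with gradient [M (g, - f)]. The
    field of each zone has this form in coordinates for which the zone is the upper
    half-plane. The derivative of [K] is required along curves, which is the form in
    which it is used. *)
Record rotor (f g K M : R -> R -> R) (R0 : R) : Prop := {
  rot_R : 0 < R0;
  rot_ang : forall x y, x ^ 2 + y ^ 2 < R0 ^ 2 ->
    (x ^ 2 + y ^ 2) / 2 <= g x y * x - f x y * y <= 2 * (x ^ 2 + y ^ 2);
  rot_M : forall x y, x ^ 2 + y ^ 2 < R0 ^ 2 -> / 2 <= M x y <= 2;
  rot_K0 : K 0 0 = 0;
  rot_dK : forall X Y t X' Y', is_derive X t X' -> is_derive Y t Y' ->
    X t ^ 2 + Y t ^ 2 < R0 ^ 2 ->
    is_derive (fun t => K (X t) (Y t)) t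
      (M (X t) (Y t) * (g (X t) (Y t) * X' - f (X t) (Y t) * Y'));
  rot_cf : forall p : R * R, fst p ^ 2 + snd p ^ 2 < R0 ^ 2 -> continuous (fun p => f (fst p) (snd p)) p;
  rot_cg : forall p : R * R, fst p ^ 2 + snd p ^ 2 < R0 ^ 2 -> continuous (fun p => g (fst p) (snd p)) p;
  rot_cM : forall p : R * R, fst p ^ 2 + snd p ^ 2 < R0 ^ 2 -> continuous (fun p => M (fst p) (snd p)) p;
  rot_cK : forall p : R * R, fst p ^ 2 + snd p ^ 2 < R0 ^ 2 -> continuous (fun p => K (fst p) (snd p)) p
}.
Arguments rot_R {f g K M R0}.
Arguments rot_ang {f g K M R0}.
Arguments rot_M {f g K M R0}.
Arguments rot_K0 {f g K M R0}.
Arguments rot_dK {f g K M R0}.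
Arguments rot_cf {f g K M R0}.
Arguments rot_cg {f g K M R0}.
Arguments rot_cM {f g K M R0}.
Arguments rot_cK {f g K M R0}.

Lemma mvt F dF a b : a < b -> (forall x, a <= x <= b -> is_derive F x (dF x)) ->
  exists c, a < c < b /\ F b - F a = dF c * (b - a).
Proof.
  intros Hab Hd. destruct (MVT_cor2 F dF a b Hab) as (c & Heq & Hc).
  intros x Hx. apply is_derive_Reals. now apply Hd. now exists c.
Qed.

Lemma ray_derive f g K M R0 c s r : rotor f g K M R0 -> c ^ 2 + s ^ 2 = 1 -> 0 <= r < R0 ->
  is_derive (fun r => K (r * c) (r * s)) r
    (M (r * c) (r * s) * (g (r * c) (r * s) * c - f (r * c) (r * s) * s)).
Proof.
  intros H Hcs Hr. apply (rot_dK H (fun r => r * c) (fun r => r * s)).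
  auto_derive; auto; ring. auto_derive; auto; ring.
  replace ((r * c) ^ 2 + (r * s) ^ 2) with (r ^ 2 * (c ^ 2 + s ^ 2)) by ring. rewrite Hcs. nra.
Qed.

Lemma ray_speed f g K M R0 c s r : rotor f g K M R0 -> c ^ 2 + s ^ 2 = 1 -> 0 < r < R0 ->
  r / 2 <= g (r * c) (r * s) * c - f (r * c) (r * s) * s <= 2 * r /\
  r / 4 <= M (r * c) (r * s) * (g (r * c) (r * s) * c - f (r * c) (r * s) * s) <= 4 * r.
Proof.
  intros H Hcs Hr.
  assert (E : (r * c) ^ 2 + (r * s) ^ 2 = r ^ 2).
  { replace ((r * c) ^ 2 + (r * s) ^ 2) with (r ^ 2 * (c ^ 2 + s ^ 2)) by ring. rewrite Hcs. ring. }
  assert (Hin : (r * c) ^ 2 + (r * s) ^ 2 < R0 ^ 2) by nra.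
  pose proof (rot_ang H _ _ Hin) as Ha. rewrite E in Ha.
  pose proof (rot_M H _ _ Hin) as Hm.
  set (w := g (r * c) (r * s) * c - f (r * c) (r * s) * s).
  replace (g (r * c) (r * s) * (r * c) - f (r * c) (r * s) * (r * s)) with (r * w) in Ha
    by (unfold w; ring).
  assert (Hw : r / 2 <= w <= 2 * r) by (split; apply Rmult_le_reg_l with r; lra).
  split; auto. nra.
Qed.

(** On a ray the derivative of [K] is [M] times the angular momentum, which is positive.
    So the levels of [K] are star-shaped curves around 0. *)
Lemma ray_increasing f g K M R0 c s a b : rotor f g K M R0 -> c ^ 2 + s ^ 2 = 1 ->
  0 <= a -> a < b -> b < R0 -> K (a * c) (a * s) < K (b * c) (b * s).
Proof.
  intros H Hcs Ha Hab Hb.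
  destruct (mvt (fun r => K (r * c) (r * s)) _ a b Hab
    (fun r Hr => ray_derive f g K M R0 c s r H Hcs ltac:(lra))) as (r & Hr & Heq).
  destruct (ray_speed f g K M R0 c s r H Hcs) as [_ Hs]. lra.
  assert (0 < b - a) by lra. simpl in Heq. nra.
Qed.

Lemma ray_bounds f g K M R0 c s r : rotor f g K M R0 -> c ^ 2 + s ^ 2 = 1 -> 0 <= r < R0 ->
  r ^ 2 / 8 <= K (r * c) (r * s) <= 2 * r ^ 2.
Proof.
  intros H Hcs Hr.
  destruct (Req_dec r 0) as [->|Hr0]. rewrite !Rmult_0_l, (rot_K0 H). lra.
  assert (HK0 : K (0 * c) (0 * s) = 0) by (rewrite !Rmult_0_l; apply H).
  split.
  - destruct (mvt (fun r => K (r * c) (r * s) - r ^ 2 / 8)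
      (fun r => M (r * c) (r * s) * (g (r * c) (r * s) * c - f (r * c) (r * s) * s) - r / 4) 0 r)
          as (x & Hx & Heq).
    lra. intros x Hx. apply (is_derive_minus (fun r => K (r * c) (r * s))).
    apply (ray_derive f g K M R0); auto. lra. auto_derive; auto. field.
    destruct (ray_speed f g K M R0 c s x H Hcs) as [_ Hs]. lra. rewrite HK0 in Heq. nra.
  - destruct (mvt (fun r => 2 * r ^ 2 - K (r * c) (r * s))
      (fun r => 4 * r - M (r * c) (r * s) * (g (r * c) (r * s) * c - f (r * c) (r * s) * s)) 0 r)
          as (x & Hx & Heq).
    lra. intros x Hx. apply (is_derive_minus (fun r => 2 * r ^ 2)). auto_derive; auto; ring.
    apply (ray_derive f g K M R0); auto. lra.
    destruct (ray_speed f g K M R0 c s x H Hcs) as [_ Hs]. lra. rewrite HK0 in Heq. nra.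
Qed.

Lemma cos_sin_1 th : cos th ^ 2 + sin th ^ 2 = 1.
Proof. pose proof (sin2_cos2 th) as H. unfold Rsqr in H. lra. Qed.

Lemma level_radius_exists f g K M R0 c th : rotor f g K M R0 ->
  (exists r1, 0 < r1 < R0 /\ c < r1 ^ 2 / 8) -> 0 < c ->
  exists r, 0 < r < R0 /\ K (r * cos th) (r * sin th) = c.
Proof.
  intros H (r1 & Hr1 & Hc1) Hc. pose proof (cos_sin_1 th) as Hcs.
  destruct (Ranalysis5.IVT_interv (fun r => K (r * cos th) (r * sin th) - c) 0 r1) as (r & Hr & Hr0).
  - intros a Ha. apply continuity_pt_minus.
    eapply derive_continuity, (ray_derive f g K M R0); auto. lra.
    apply continuity_pt_const. now intros ? ?.
  - lra.
  - rewrite !Rmult_0_l, (rot_K0 H). lra.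
  - destruct (ray_bounds f g K M R0 (cos th) (sin th) r1 H Hcs); lra.
  - exists r. split; [|lra]. split; [|lra].
    destruct (Req_dec r 0) as [->|]; [|lra]. exfalso.
    rewrite !Rmult_0_l, (rot_K0 H) in Hr0. lra.
Qed.

Lemma ray_injective f g K M R0 c s a b : rotor f g K M R0 -> c ^ 2 + s ^ 2 = 1 ->
  0 <= a < R0 -> 0 <= b < R0 -> K (a * c) (a * s) = K (b * c) (b * s) -> a = b.
Proof.
  intros H Hcs Ha Hb E. destruct (Rtotal_order a b) as [Hl|[Hl|Hl]]; auto; exfalso.
  pose proof (ray_increasing f g K M R0 c s a b H Hcs). lra.
  pose proof (ray_increasing f g K M R0 c s b a H Hcs). lra.
Qed.

Definition cont2 (F : R -> R -> R) (a b : R) : Prop :=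
  continuous (fun p : R * R => F (fst p) (snd p)) (a, b).

Lemma cont2_eps F a b : cont2 F a b -> forall e, 0 < e -> exists d, 0 < d /\
  forall u v, Rabs (u - a) < d -> Rabs (v - b) < d -> Rabs (F u v - F a b) < e.
Proof.
  intros H e He.
  destruct (H (fun y => Rabs (y - F a b) < e)) as (d & Hd).
  { exists (mkposreal e He). intros y Hy. exact Hy. }
  exists d. split. apply cond_pos. intros u v Hu Hv.
  apply (Hd (u, v)). split; assumption.
Qed.

Lemma cont1_eps (F : R -> R) a : continuous F a -> forall e, 0 < e -> exists d, 0 < d /\
  forall u, Rabs (u - a) < d -> Rabs (F u - F a) < e.
Proof.
  intros H e He.
  destruct (H (fun y => Rabs (y - F a) < e)) as (d & Hd).
  { exists (mkposreal e He). intros y Hy. exact Hy. }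
  exists d. split. apply cond_pos. intros u Hu. now apply Hd.
Qed.

Lemma eps_cont1 (F : R -> R) a : (forall e, 0 < e -> exists d, 0 < d /\
  forall u, Rabs (u - a) < d -> Rabs (F u - F a) < e) -> continuous F a.
Proof.
  intros H P (e & HP). destruct (H e (cond_pos e)) as (d & Hd & Hc).
  exists (mkposreal d Hd). intros u Hu. apply HP. apply Hc. exact Hu.
Qed.

Lemma quotient_close p0 q0 e : 0 < q0 -> 0 < e -> exists d, 0 < d /\
  forall p q, Rabs (p - p0) < d -> Rabs (q - q0) < d -> 0 < q /\ Rabs (p / q - p0 / q0) < e.
Proof.
  intros Hq He.
  assert (H : cont2 (fun p q => p / q) p0 q0).
  { unfold cont2. apply (continuous_mult (K := R_AbsRing) (fun p => fst p) (fun p => / snd p)).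
    apply continuous_fst. apply (continuous_comp snd Rinv). apply continuous_snd.
    apply continuous_Rinv. simpl. lra. }
  destruct (cont2_eps _ _ _ H e He) as (d & Hd & Hc).
  exists (Rmin d q0). split. now apply Rmin_glb_lt.
  intros p q Hp Hq'. split.
  - assert (H1 : Rabs (q - q0) < q0) by (eapply Rlt_le_trans; [apply Hq'|apply Rmin_r]).
    apply Rabs_lt_between in H1. lra.
  - apply Hc; eapply Rlt_le_trans; try eassumption; apply Rmin_l.
Qed.

Lemma mvt_gen F dF a b : (forall x, Rmin a b <= x <= Rmax a b -> is_derive F x (dF x)) ->
  exists c, Rmin a b <= c <= Rmax a b /\ F b - F a = dF c * (b - a).
Proof.
  intros H. apply MVT_gen. intros x Hx. apply H. lra. intros x Hx. eapply derive_continuity, H, Hx.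
Qed.

(** The implicit function theorem in the plane, when the implicit function is already
    known to be continuous. *)
Lemma implicit_derive (F Ft Fr : R -> R -> R) (rad : R -> R) (lo hi c th0 : R) :
  (forall th r, lo < r < hi -> is_derive (fun th => F th r) th (Ft th r)) ->
  (forall th r, lo < r < hi -> is_derive (fun r => F th r) r (Fr th r)) ->
  (forall th, lo < rad th < hi) -> (forall th, F th (rad th) = c) ->
  continuous rad th0 -> cont2 Ft th0 (rad th0) -> cont2 Fr th0 (rad th0) ->
  0 < Fr th0 (rad th0) ->
  is_derive rad th0 (- Ft th0 (rad th0) / Fr th0 (rad th0)).
Proof.
  intros Ht Hr Hrad Hc Hcr Hct Hcr2 Hpos. apply is_derive_Reals. intros e He.
  destruct (quotient_close (- Ft th0 (rad th0)) _ e Hpos He) as (d & Hd & Hq).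
  destruct (cont2_eps _ _ _ Hct d Hd) as (d1 & Hd1 & H1).
  destruct (cont2_eps _ _ _ Hcr2 d Hd) as (d2 & Hd2 & H2).
  destruct (cont1_eps _ _ Hcr d2 Hd2) as (d3 & Hd3 & H3).
  assert (Hm : 0 < Rmin d1 (Rmin d2 d3)) by (repeat apply Rmin_glb_lt; auto).
  exists (mkposreal _ Hm). intros h Hh Hhd. simpl in Hhd.
  assert (Hh1 : Rabs h < d1) by (eapply Rlt_le_trans; [apply Hhd|apply Rmin_l]).
  assert (Hh2 : Rabs h < d2) by (eapply Rlt_le_trans; [apply Hhd|eapply Rle_trans;
      [apply Rmin_r|apply Rmin_l]]).
  assert (Hh3 : Rabs h < d3) by (eapply Rlt_le_trans; [apply Hhd|eapply Rle_trans;
      [apply Rmin_r|apply Rmin_r]]).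
  set (th := th0 + h). set (r0 := rad th0) in *. set (r1 := rad th).
  assert (Hr0 : lo < r0 < hi) by apply Hrad. assert (Hr1 : lo < r1 < hi) by apply Hrad.
  destruct (mvt_gen (fun t => F t r0) (fun t => Ft t r0) th0 th) as (a & Ha & Ea).
  { intros x _. now apply Ht. }
  destruct (mvt_gen (fun r => F th r) (fun r => Fr th r) r0 r1) as (b & Hb & Eb).
  { intros x Hx. apply Hr. unfold Rmin, Rmax in Hx. destruct (Rle_dec r0 r1); lra. }
  assert (Hth : th - th0 = h) by (unfold th; ring).
  assert (Hab : Rabs (a - th0) <= Rabs h).
  { rewrite <- Hth. unfold Rmin, Rmax in Ha. destruct (Rle_dec th0 th).
    rewrite !Rabs_pos_eq; lra. rewrite !Rabs_left1; lra. }
  assert (Hbb : Rabs (b - r0) <= Rabs (r1 - r0)).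
  { unfold Rmin, Rmax in Hb. destruct (Rle_dec r0 r1).
    rewrite !Rabs_pos_eq; lra. rewrite !Rabs_left1; lra. }
  assert (Hr10 : Rabs (r1 - r0) < d2). { apply H3. now rewrite Hth. }
  specialize (H1 a r0). rewrite Rminus_diag, Rabs_R0 in H1 by reflexivity.
  specialize (H1 ltac:(lra) Hd1). specialize (H2 th b ltac:(now rewrite Hth) ltac:(lra)).
  destruct (Hq (- Ft a r0) (Fr th b)) as [Hp Hfin]; auto.
  { replace (- Ft a r0 - - Ft th0 r0) with (- (Ft a r0 - Ft th0 r0)) by ring. now rewrite Rabs_Ropp. }
  change (Rabs ((r1 - r0) / h - - Ft th0 r0 / Fr th0 r0) < e).
  replace ((r1 - r0) / h) with (- Ft a r0 / Fr th b); auto.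
  assert (F1 : F th r1 = c) by apply Hc. assert (F0 : F th0 r0 = c) by apply Hc.
  rewrite F1 in Eb. rewrite F0, Hth in Ea.
  apply Rmult_eq_reg_l with (Fr th b * h). field_simplify; try lra.
  apply Rmult_integral_contrapositive_currified; lra.
Qed.

Definition is_level (K : R -> R -> R) (R0 c : R) (rad : R -> R) : Prop :=
  forall th, 0 < rad th < R0 /\ K (rad th * cos th) (rad th * sin th) = c.

Lemma polar_in r th R0 : 0 < r < R0 -> (r * cos th) ^ 2 + (r * sin th) ^ 2 < R0 ^ 2.
Proof.
  intros Hr. replace ((r * cos th) ^ 2 + (r * sin th) ^ 2) with (r ^ 2 * (cos th ^ 2 + sin th ^ 2)) by ring.
  rewrite cos_sin_1. nra.
Qed.

(** [K] is strictly below the level at radius [r0 - e] and strictly above it at [r0 + e]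
    for all directions close to [th0]. *)
Lemma level_continuous f g K M R0 c rad th0 : rotor f g K M R0 -> is_level K R0 c rad ->
  continuous rad th0.
Proof.
  intros H HL. apply eps_cont1. intros e0 He0.
  destruct (HL th0) as [Hr Hc]. set (r0 := rad th0) in *.
  set (e := Rmin e0 (Rmin (r0 / 2) ((R0 - r0) / 2))).
  assert (He : 0 < e) by (unfold e; repeat apply Rmin_glb_lt; lra).
  assert (He1 : e <= e0) by apply Rmin_l.
  assert (He2 : e <= r0 / 2) by (eapply Rle_trans; [apply Rmin_r|apply Rmin_l]).
  assert (He3 : e <= (R0 - r0) / 2) by (eapply Rle_trans; [apply Rmin_r|apply Rmin_r]).
  assert (Hk : forall r, 0 < r < R0 -> continuous (fun th => K (r * cos th) (r * sin th)) th0).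
  { intros r Hr'. apply (ex_derive_continuous (fun th => K (r * cos th) (r * sin th))).
    eexists. apply (rot_dK H (fun th => r * cos th) (fun th => r * sin th)).
    auto_derive; auto; reflexivity. auto_derive; auto; reflexivity. now apply polar_in. }
  pose proof (ray_increasing f g K M R0 (cos th0) (sin th0) (r0 - e) r0 H (cos_sin_1 _) ltac:(lra)
      ltac:(lra) ltac:(lra)) as Hlo.
  pose proof (ray_increasing f g K M R0 (cos th0) (sin th0) r0 (r0 + e) H (cos_sin_1 _) ltac:(lra)
      ltac:(lra) ltac:(lra)) as Hhi.
  rewrite Hc in Hlo, Hhi.
  destruct (cont1_eps _ _ (Hk (r0 - e) ltac:(lra)) (c - K ((r0 - e) * cos th0) ((r0 - e) * sin
      th0))) as (d1 & Hd1 & H1). lra.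
  destruct (cont1_eps _ _ (Hk (r0 + e) ltac:(lra)) (K ((r0 + e) * cos th0) ((r0 + e) * sin th0) -
      c)) as (d2 & Hd2 & H2). lra.
  exists (Rmin d1 d2). split. now apply Rmin_glb_lt.
  intros th Hth. specialize (H1 th (Rlt_le_trans _ _ _ Hth (Rmin_l _ _))).
  specialize (H2 th (Rlt_le_trans _ _ _ Hth (Rmin_r _ _))).
  apply Rabs_lt_between in H1. apply Rabs_lt_between in H2.
  destruct (HL th) as [Hrt Hct].
  apply Rabs_lt_between. split.
  - destruct (Rlt_le_dec (r0 - e) (rad th)) as [Hl|Hl]; [lra|]. exfalso.
    destruct (Req_dec (rad th) (r0 - e)) as [E|E]. rewrite E in Hct. lra.
    pose proof (ray_increasing f g K M R0 (cos th) (sin th) (rad th) (r0 - e) H (cos_sin_1 _)). lra.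
  - destruct (Rlt_le_dec (rad th) (r0 + e)) as [Hl|Hl]; [lra|]. exfalso.
    destruct (Req_dec (rad th) (r0 + e)) as [E|E]. rewrite E in Hct. lra.
    pose proof (ray_increasing f g K M R0 (cos th) (sin th) (r0 + e) (rad th) H (cos_sin_1 _)). lra.
Qed.

Lemma cont2_polar (F : R -> R -> R) th r : continuous (fun p => F (fst p) (snd p)) (r * cos th, r * sin th) ->
  cont2 (fun th r => F (r * cos th) (r * sin th)) th r.
Proof.
  intros H. unfold cont2.
  apply (continuous_comp_2 (fun p => snd p * cos (fst p)) (fun p => snd p * sin (fst p)) F); auto.
  - apply (continuous_mult (K := R_AbsRing) (fun p => snd p) (fun p => cos (fst p))).
    apply continuous_snd. apply (continuous_comp fst cos). apply continuous_fst. apply continuous_cos.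
  - apply (continuous_mult (K := R_AbsRing) (fun p => snd p) (fun p => sin (fst p))).
    apply continuous_snd. apply (continuous_comp fst sin). apply continuous_fst. apply continuous_sin.
Qed.

Lemma cont2_mult F G a b : cont2 F a b -> cont2 G a b -> cont2 (fun x y => F x y * G x y) a b.
Proof. intros HF HG. now apply (continuous_mult (K := R_AbsRing) (fun p => F (fst p) (snd p)) (fun
    p => G (fst p) (snd p))). Qed.

Lemma cont2_minus F G a b : cont2 F a b -> cont2 G a b -> cont2 (fun x y => F x y - G x y) a b.
Proof. intros HF HG. now apply (continuous_minus (K := R_AbsRing) (fun p => F (fst p) (snd p)) (fun
    p => G (fst p) (snd p))). Qed.

Lemma cont2_cos a b : cont2 (fun x _ => cos x) a b.
Proof. apply (continuous_comp fst cos). apply continuous_fst. apply continuous_cos. Qed.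

Lemma cont2_sin a b : cont2 (fun x _ => sin x) a b.
Proof. apply (continuous_comp fst sin). apply continuous_fst. apply continuous_sin. Qed.

Lemma cont2_snd a b : cont2 (fun _ y => y) a b.
Proof. apply continuous_snd. Qed.

Lemma cont2_opp F a b : cont2 F a b -> cont2 (fun x y => - F x y) a b.
Proof. intros HF. now apply (continuous_opp (K := R_AbsRing) (fun p => F (fst p) (snd p))). Qed.

(** The polar form of the equation of the trajectories: the level curve has the
    direction of the field at each of its points. *)
Lemma level_derive f g K M R0 c rad th : rotor f g K M R0 -> is_level K R0 c rad ->
  let r := rad th in let x := r * cos th in let y := r * sin th in
  is_derive rad th (r * (f x y * cos th + g x y * sin th) / (g x y * cos th - f x y * sin th)).
Proof.
  intros H HL r x y.
  destruct (HL th) as [Hr Hc]. fold r in Hr.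
  assert (Hin := polar_in r th R0 Hr). fold x y in Hin.
  destruct (ray_speed f g K M R0 (cos th) (sin th) r H (cos_sin_1 _) Hr) as [Hs1 Hs2].
  fold x y in Hs1, Hs2.
  assert (cf : cont2 (fun th r => f (r * cos th) (r * sin th)) th r) by (apply cont2_polar, (rot_cf H), Hin).
  assert (cg : cont2 (fun th r => g (r * cos th) (r * sin th)) th r) by (apply cont2_polar, (rot_cg H), Hin).
  assert (cM : cont2 (fun th r => M (r * cos th) (r * sin th)) th r) by (apply cont2_polar, (rot_cM H), Hin).
  replace (r * (f x y * cos th + g x y * sin th) / (g x y * cos th - f x y * sin th)) with
   (- (M x y * (g x y * (r * - sin th) - f x y * (r * cos th))) / (M x y * (g x y * cos th - f x y
       * sin th))).
  2:{ pose proof (rot_M H _ _ Hin). field. split; lra. }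
  apply (implicit_derive (fun th r => K (r * cos th) (r * sin th))
     (fun th r => M (r * cos th) (r * sin th) * (g (r * cos th) (r * sin th) * (r * - sin th) - f
         (r * cos th) (r * sin th) * (r * cos th)))
     (fun th r => M (r * cos th) (r * sin th) * (g (r * cos th) (r * sin th) * cos th - f (r * cos
         th) (r * sin th) * sin th)) rad 0 R0 c th).
  - intros th' r' Hr'. apply (rot_dK H (fun th => r' * cos th) (fun th => r' * sin th)).
    auto_derive; auto; ring. auto_derive; auto; ring. now apply polar_in.
  - intros th' r' Hr'. apply (ray_derive f g K M R0); auto using cos_sin_1. lra.
  - intros th'. apply HL.
  - intros th'. apply HL.
  - eapply level_continuous; eauto.
  - fold r. apply cont2_mult; auto. apply cont2_minus; apply cont2_mult; auto; apply cont2_mult;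
      auto using cont2_snd, cont2_cos. apply cont2_opp, cont2_sin.
  - fold r. apply cont2_mult; auto. apply cont2_minus; apply cont2_mult; auto using cont2_cos, cont2_sin.
  - fold r x y. lra.
Qed.

Lemma is_derive_eq (F : R -> R) (x l l' : R) : is_derive F x l -> l = l' -> is_derive F x l'.
Proof. now intros H <-. Qed.

(** Separation of variables: the time [tau] is the integral of [1 / w], and [th] is its
    inverse function. *)
Lemma scalar_flow (w : R -> R) : (forall x, continuous w x) -> (forall x, / 2 <= w x <= 2) ->
  exists th tau : R -> R, (forall t, is_derive th t (w (th t))) /\ th 0 = 0 /\
    (forall x, th (tau x) = x) /\ (forall t, tau (th t) = t) /\
    (forall x y, x < y -> tau x < tau y).
Proof.
  intros Hc Hw.
  assert (Hci : forall x, continuous (fun x => / w x) x).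
  { intros x. apply (continuous_comp w Rinv). apply Hc. apply continuous_Rinv. specialize (Hw x). lra. }
  assert (Hinv : forall x, / 2 <= / w x <= 2).
  { intros x. specialize (Hw x). split. apply Rinv_le_contravar; lra.
    replace 2 with (/ / 2) by field. apply Rinv_le_contravar; lra. }
  set (tau := fun x => RInt (fun y => / w y) 0 x).
  assert (Hd : forall x, is_derive tau x (/ w x)).
  { intros x. apply (is_derive_RInt (fun y => / w y) tau 0 x); auto.
    exists (mkposreal 1 Rlt_0_1). intros y _. unfold tau. apply (RInt_correct (V := R_CompleteNormedModule)).
    apply (ex_RInt_continuous (V := R_CompleteNormedModule)). intros z _. apply Hci. }
  assert (Hinc : forall x y, x < y -> (y - x) / 2 <= tau y - tau x).
  { intros x y Hxy. destruct (mvt tau _ x y Hxy (fun z _ => Hd z)) as (c & Hcc & ->).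
    specialize (Hinv c). nra. }
  assert (H0 : tau 0 = 0) by (unfold tau; now rewrite (RInt_point (V := R_CompleteNormedModule))).
  assert (Hinj : forall x y, tau x = tau y -> x = y).
  { intros x y E. destruct (Rtotal_order x y) as [Hl|[Hl|Hl]]; auto; pose proof (Hinc _ _ Hl); lra. }
  assert (Hsur : forall t, exists x, tau x = t).
  { intros t. set (B := 2 * Rabs t + 1). assert (HB : 0 < B) by (unfold B; pose proof (Rabs_pos t); lra).
    destruct (Ranalysis5.IVT_interv (fun x => tau x - t) (- B) B) as (x & Hx & Hx0).
    - intros x _. apply continuity_pt_minus. eapply derive_continuity, Hd.
    apply continuity_pt_const. now intros ? ?.
    - lra.
    - assert (Hl : - B < 0) by lra. apply Hinc in Hl. rewrite H0 in Hl.
      pose proof (Rle_abs (- t)) as Ha. rewrite Rabs_Ropp in Ha.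
      assert (B / 2 = Rabs t + / 2) by (unfold B; field). lra.
    - apply Hinc in HB as Hl. rewrite H0 in Hl. pose proof (Rle_abs t).
      assert (B / 2 = Rabs t + / 2) by (unfold B; field). lra.
    - exists x. lra. }
  set (th := fun t => proj1_sig (constructive_indefinite_description _ (Hsur t))).
  assert (Hth : forall t, tau (th t) = t).
  { intros t. unfold th. now destruct (constructive_indefinite_description _ (Hsur t)). }
  exists th, tau. split; [|split; [|split; [|split; [exact Hth|]]]].
  - intros t. apply is_derive_Reals. intros e He.
    destruct (cont1_eps w (th t) (Hc (th t)) e He) as (d & Hd0 & H1).
    assert (Hd2 : 0 < d / 2) by lra.
    exists (mkposreal _ Hd2). intros h Hh Hhd. simpl in Hhd.
    destruct (mvt_gen tau (fun x => / w x) (th t) (th (t + h))) as (c & Hcc & Heq).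
    { intros x _. apply Hd. }
    rewrite !Hth in Heq.
    assert (Hwc := Hw c). set (k := th (t + h) - th t) in *.
    assert (Hk : k = h * w c). { replace (t + h - t) with h in Heq by ring. rewrite Heq. field. lra. }
    replace (k / h) with (w c) by (rewrite Hk; field; auto).
    apply H1. apply Rle_lt_trans with (Rabs k).
    + unfold k. unfold Rmin, Rmax in Hcc. destruct (Rle_dec (th t) (th (t + h))).
      rewrite !Rabs_pos_eq; lra. rewrite !Rabs_left1; lra.
    + rewrite Hk, Rabs_mult, (Rabs_pos_eq (w c)) by lra. pose proof (Rabs_pos h). nra.
  - apply Hinj. now rewrite Hth.
  - intros x. apply Hinj. now rewrite Hth.
  - intros x y Hxy. apply Hinc in Hxy as Hl. lra.
Qed.

Definition solves (f g : R -> R -> R) (X Y : R -> R) (t : R) : Prop :=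
  is_derive X t (f (X t) (Y t)) /\ is_derive Y t (g (X t) (Y t)).

(** The trajectory follows the level curve of [K] through the initial point. Its angle
    solves an autonomous scalar equation with positive bounded speed ([scalar_flow]), so
    the trajectory is defined for all times. *)
Lemma half_turn (f g K M : R -> R -> R) R0 x0 : rotor f g K M R0 -> 0 < x0 < R0 / 5 ->
  exists T X Y, 0 < T /\ X 0 = x0 /\ Y 0 = 0 /\ X T < 0 /\ Y T = 0 /\
    (forall t, solves f g X Y t) /\
    (forall t, 0 < t < T -> 0 < Y t) /\
    (forall t, x0 / 4 <= sqrt (X t ^ 2 + Y t ^ 2) <= 5 * x0 /\ 0 < X t ^ 2 + Y t ^ 2 < R0 ^ 2 /\
        X t ^ 2 + Y t ^ 2 <= 25 * x0 ^ 2) /\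
    (forall t, K (X t) (Y t) = K x0 0).
Proof.
  intros H Hx0. pose proof (rot_R H) as HR.
  destruct (ray_bounds f g K M R0 1 0 x0 H) as [Kl Ku]. ring. lra.
  rewrite Rmult_1_r, Rmult_0_r in Kl, Ku. set (c := K x0 0) in *.
  assert (Hc0 : 0 < c) by nra.
  assert (Hex : forall th, exists r, 0 < r < R0 /\ K (r * cos th) (r * sin th) = c).
  { intros th. apply (level_radius_exists f g K M); auto. exists (4.5 * x0). split; nra. }
  set (rad := fun th => proj1_sig (constructive_indefinite_description _ (Hex th))).
  assert (HL : is_level K R0 c rad).
  { intros th. unfold rad. now destruct (constructive_indefinite_description _ (Hex th)). }
  assert (Hrad : forall th, x0 / 4 <= rad th <= 5 * x0).
  { intros th. destruct (HL th) as [Hr Hk].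
    destruct (ray_bounds f g K M R0 (cos th) (sin th) (rad th) H (cos_sin_1 _)) as [B1 B2]. lra.
    rewrite Hk in B1, B2. split; nra. }
  set (gx := fun th => g (rad th * cos th) (rad th * sin th)).
  set (fx := fun th => f (rad th * cos th) (rad th * sin th)).
  set (w := fun th => (gx th * cos th - fx th * sin th) / rad th).
  assert (Hrc : forall th, continuous rad th) by (intros th; eapply level_continuous; eauto).
  assert (Hcomp : forall (F : R -> R -> R) th, (forall p : R * R, fst p ^ 2 + snd p ^ 2 < R0 ^ 2 ->
     continuous (fun p => F (fst p) (snd p)) p) ->
         continuous (fun th => F (rad th * cos th) (rad th * sin th)) th).
  { intros F th HF. apply (continuous_comp_2 (fun th => rad th * cos th) (fun th => rad th * sin th) F).
    apply (continuous_mult (K := R_AbsRing) rad cos); auto using continuous_cos.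
    apply (continuous_mult (K := R_AbsRing) rad sin); auto using continuous_sin.
    apply HF. simpl. apply polar_in, HL. }
  assert (Hwc : forall th, continuous w th).
  { intros th. apply (continuous_mult (K := R_AbsRing) (fun th => gx th * cos th - fx th * sin th)
      (fun th => / rad th)).
    apply (continuous_minus (K := R_AbsRing) (fun th => gx th * cos th) (fun th => fx th * sin th)).
    apply (continuous_mult (K := R_AbsRing) gx cos). apply Hcomp, H. apply continuous_cos.
    apply (continuous_mult (K := R_AbsRing) fx sin). apply Hcomp, H. apply continuous_sin.
    apply (continuous_comp rad Rinv); auto. apply continuous_Rinv. specialize (HL th). lra. }
  assert (Hwb : forall th, / 2 <= w th <= 2).
  { intros th. destruct (HL th) as [Hr _].
    destruct (ray_speed f g K M R0 (cos th) (sin th) (rad th) H (cos_sin_1 _) Hr) as [Hs _].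
    fold (gx th) (fx th) in Hs. unfold w. set (v := gx th * cos th - fx th * sin th) in *.
    split; apply Rmult_le_reg_r with (rad th); try lra; unfold Rdiv; rewrite Rmult_assoc, Rinv_l; lra. }
  destruct (scalar_flow w Hwc Hwb) as (th & tau & Hth & Hth0 & Hinv1 & Hinv2 & Hinc).
  set (X := fun t => rad (th t) * cos (th t)). set (Y := fun t => rad (th t) * sin (th t)).
  assert (Htau0 : tau 0 = 0) by (rewrite <- Hth0 at 1; apply Hinv2).
  assert (Hr0 : rad 0 = x0).
  { destruct (HL 0) as [Hr Hk].
    apply (ray_injective f g K M R0 (cos 0) (sin 0)); auto using cos_sin_1; try lra.
    rewrite Hk, cos_0, sin_0, Rmult_1_r, Rmult_0_r. reflexivity. }
  assert (Hsq : forall t, X t ^ 2 + Y t ^ 2 = rad (th t) ^ 2).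
  { intros t. unfold X, Y. transitivity (rad (th t) ^ 2 * (cos (th t) ^ 2 + sin (th t) ^ 2)). ring.
    rewrite cos_sin_1. ring. }
  exists (tau PI), X, Y.
  assert (HT : 0 < tau PI) by (rewrite <- Htau0; apply Hinc, PI_RGT_0).
  split; auto. split. { unfold X. rewrite Hth0, Hr0, cos_0. ring. }
  split. { unfold Y. rewrite Hth0, sin_0. ring. }
  split. { unfold X. rewrite Hinv1, cos_PI. destruct (HL PI). lra. }
  split. { unfold Y. rewrite Hinv1, sin_PI. ring. }
  split.
  { intros t. destruct (HL (th t)) as [Hr _].
    destruct (ray_speed f g K M R0 (cos (th t)) (sin (th t)) (rad (th t)) H (cos_sin_1 _) Hr) as [Hs _].
    pose proof (level_derive f g K M R0 c rad (th t) H HL) as Hd. cbv zeta in Hd.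
    pose proof (is_derive_comp rad th t _ _ Hd (Hth t)) as Hdr.
    assert (Hw : w (th t) = (g (X t) (Y t) * cos (th t) - f (X t) (Y t) * sin (th t)) / rad (th t))
        by reflexivity.
    fold (X t) (Y t) in Hdr, Hs. rewrite Hw in Hdr.
    assert (Hth' := Hth t). rewrite Hw in Hth'.
    pose proof (cos_sin_1 (th t)) as Hcs.
    set (u := g (X t) (Y t)) in *. set (v := f (X t) (Y t)) in *.
    set (a := cos (th t)) in *. set (b := sin (th t)) in *. set (r := rad (th t)) in *.
    set (l := (u * a - v * b) / r) in *.
    assert (Hdr' : is_derive (fun t => rad (th t)) t (v * a + u * b)).
    { replace (v * a + u * b) with (scal l (r * (v * a + u * b) / (u * a - v * b))). exact Hdr.
      unfold scal; simpl; unfold mult; simpl. unfold l. field. lra. }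
    split.
    - apply is_derive_eq with ((v * a + u * b) * cos (th t) + rad (th t) * (l * - sin (th t))).
      2:{ fold a b r. change (f (X t) (Y t)) with v. assert (Hrr : r <> 0) by lra.
      apply Rminus_diag_uniq. replace ((v * a + u * b) * a + r * (l * - b) - v) with (v * (a ^ 2 +
          b ^ 2) - v) by (unfold l; field; exact Hrr). rewrite Hcs. ring. }
      apply (is_derive_mult (fun t => rad (th t)) (fun t => cos (th t)) t _ _ Hdr').
      apply (is_derive_comp cos th t); auto. apply is_derive_cos. intros; apply Rmult_comm.
    - apply is_derive_eq with ((v * a + u * b) * sin (th t) + rad (th t) * (l * cos (th t))).
      2:{ fold a b r. change (g (X t) (Y t)) with u. assert (Hrr : r <> 0) by lra.
      apply Rminus_diag_uniq. replace ((v * a + u * b) * b + r * (l * a) - u) with (u * (a ^ 2 + b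
          ^ 2) - u) by (unfold l; field; exact Hrr). rewrite Hcs. ring. }
      apply (is_derive_mult (fun t => rad (th t)) (fun t => sin (th t)) t _ _ Hdr').
      apply (is_derive_comp sin th t); auto. apply is_derive_sin. intros; apply Rmult_comm. }
  split.
  { intros t Ht. unfold Y. apply Rmult_lt_0_compat. apply HL.
    apply sin_gt_0.
    - apply Rnot_le_lt. intros Hle. destruct Hle as [Hlt|E].
      apply Hinc in Hlt. rewrite Hinv2, Htau0 in Hlt. lra.
      rewrite <- (Hinv2 t), E, Htau0 in Ht. lra.
    - apply Rnot_le_lt. intros Hle. destruct Hle as [Hlt|E].
      apply Hinc in Hlt. rewrite Hinv2 in Hlt. lra.
      rewrite E, Hinv2 in Ht. lra. }
  split.
  { intros t. rewrite Hsq. specialize (Hrad (th t)). destruct (HL (th t)) as [Hr _].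
    rewrite sqrt_pow2 by lra. split; auto. split; nra. }
  intros t. apply HL.
Qed.

Lemma continuous_neg_near (F : R -> R) a : continuous F a -> F a < 0 ->
  exists d, 0 < d /\ forall u, Rabs (u - a) < d -> F u < 0.
Proof.
  intros Hc Hn. destruct (cont1_eps F a Hc (- F a)) as (d & Hd & H). lra.
  exists d. split; auto. intros u Hu. specialize (H u Hu). apply Rabs_lt_between in H. lra.
Qed.

Lemma continuous_minus_scal (X Y : R -> R) q t : continuous X t -> continuous Y t ->
  continuous (fun t => X t - q * Y t) t.
Proof.
  intros HX HY. apply (continuous_minus (K := R_AbsRing) X (fun t => q * Y t)); auto.
  apply (continuous_scal_r (K := R_AbsRing) q Y); auto.
Qed.

(** [X / Y] is the cotangent of the polar angle, and the field turns
    counterclockwise. *)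
Lemma quotient_decreasing f g K M R0 (X Y : R -> R) a b : rotor f g K M R0 -> a < b ->
  (forall t, a <= t <= b -> solves f g X Y t /\ 0 < Y t /\ X t ^ 2 + Y t ^ 2 < R0 ^ 2) ->
  X b / Y b < X a / Y a.
Proof.
  intros H Hab Hs.
  destruct (mvt (fun t => X t / Y t) (fun t => (f (X t) (Y t) * Y t - X t * g (X t) (Y t)) / Y t ^ 2) a b Hab)
    as (c & Hcc & Heq).
  - intros t Ht'. destruct (Hs t) as ([HX HY] & HYp & _). lra.
    apply (is_derive_div X Y); auto. lra.
  - destruct (Hs c) as (_ & HYp & Hin). lra.
    pose proof (rot_ang H (X c) (Y c) Hin) as Ha'.
    assert (HYc : 0 < Y c ^ 2) by now apply pow_lt.
    assert (Hneg : 0 < (g (X c) (Y c) * X c - f (X c) (Y c) * Y c) / Y c ^ 2).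
    { apply Rdiv_lt_0_compat; auto. pose proof (pow2_ge_0 (X c)). lra. }
    assert (0 < b - a) by lra.
    replace ((f (X c) (Y c) * Y c - X c * g (X c) (Y c)) / Y c ^ 2) with
       (- ((g (X c) (Y c) * X c - f (X c) (Y c) * Y c) / Y c ^ 2)) in Heq by (field; lra).
    set (q := (g (X c) (Y c) * X c - f (X c) (Y c) * Y c) / Y c ^ 2) in *.
    assert (0 < q * (b - a)) by now apply Rmult_lt_0_compat. lra.
Qed.

(** An arc that enters and leaves the upper half-plane through the axis starts on the
    positive half-axis and ends on the negative one, because [X / Y] decreases; it meets
    every ray in between, and on each ray there is only one point of its level. So the
    arc is the whole part of the level curve in the upper half-plane. *)
Lemma arc_properties f g K M R0 (X Y : R -> R) t0 t1 : rotor f g K M R0 -> t0 < t1 ->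
  (forall t, t0 <= t <= t1 -> continuous X t /\ continuous Y t /\ 0 < X t ^ 2 + Y t ^ 2 < R0 ^ 2) ->
  (forall t, t0 < t < t1 -> solves f g X Y t /\ 0 < Y t) ->
  Y t0 = 0 -> Y t1 = 0 ->
  0 < X t0 /\ X t1 < 0 /\ (forall t, t0 <= t <= t1 -> K (X t) (Y t) = K (X t0) 0) /\
  (forall x y, 0 < y -> x ^ 2 + y ^ 2 < R0 ^ 2 -> K x y = K (X t0) 0 ->
     exists t, t0 < t < t1 /\ X t = x /\ Y t = y).
Proof.
  intros H Ht Hc Hs Y0 Y1. pose proof (rot_R H) as HR.
  set (m := (t0 + t1) / 2). set (q := X m / Y m).
  assert (Hm : t0 < m < t1) by (unfold m; lra).
  assert (HYm : 0 < Y m) by now apply Hs.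
  assert (Hdec : forall a b, t0 < a -> a < b -> b < t1 -> X b / Y b < X a / Y a).
  { intros a b Ha Hab Hb. apply (quotient_decreasing f g K M R0); auto.
    intros t Ht'. destruct (Hs t) as [H1 H2]. lra. destruct (Hc t) as (_ & _ & H3). lra.
    repeat split; try apply H1; lra. }
  assert (HX0 : 0 < X t0).
  { destruct (Hc t0) as (cX & cY & Hin). lra. rewrite Y0 in Hin.
    apply Rnot_le_lt. intros Hle.
    assert (Hlt : X t0 < 0). { destruct Hle as [|E]; auto. rewrite E in Hin. lra. }
    destruct (continuous_neg_near (fun t => X t - q * Y t) t0) as (d & Hd & Hnear).
    now apply continuous_minus_scal. rewrite Y0. lra.
    set (u := Rmin (t0 + d / 2) ((t0 + m) / 2)).
    assert (Hu1 : u <= t0 + d / 2) by apply Rmin_l. assert (Hu2 : u <= (t0 + m) / 2) by apply Rmin_r.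
    assert (Hu0 : t0 < u) by (unfold u; apply Rmin_glb_lt; lra).
    specialize (Hnear u). rewrite Rabs_pos_eq in Hnear by lra. specialize (Hnear ltac:(lra)).
    assert (HYu : 0 < Y u) by (apply Hs; lra).
    pose proof (Hdec u m Hu0 ltac:(lra) ltac:(lra)) as Hd'. fold q in Hd'.
    apply (Rmult_lt_compat_r (Y u)) in Hd'; auto. unfold Rdiv in Hd'.
    rewrite Rmult_assoc, Rinv_l in Hd' by lra. lra. }
  assert (HX1 : X t1 < 0).
  { destruct (Hc t1) as (cX & cY & Hin). lra. rewrite Y1 in Hin.
    apply Rnot_le_lt. intros Hle.
    assert (Hlt : 0 < X t1). { destruct Hle as [|E]; auto. rewrite <- E in Hin. lra. }
    destruct (continuous_neg_near (fun t => - X t - (- q) * Y t) t1) as (d & Hd & Hnear).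
    apply continuous_minus_scal; auto. now apply (continuous_opp (K := R_AbsRing) X). rewrite Y1. lra.
    set (u := Rmax (t1 - d / 2) ((t1 + m) / 2)).
    assert (Hu1 : t1 - d / 2 <= u) by apply Rmax_l. assert (Hu2 : (t1 + m) / 2 <= u) by apply Rmax_r.
    assert (Hu0 : u < t1) by (unfold u; apply Rmax_lub_lt; lra).
    specialize (Hnear u). rewrite Rabs_left in Hnear by lra. specialize (Hnear ltac:(lra)).
    assert (HYu : 0 < Y u) by (apply Hs; lra).
    pose proof (Hdec m u ltac:(lra) ltac:(lra) Hu0) as Hd'. fold q in Hd'.
    apply (Rmult_lt_compat_r (Y u)) in Hd'; auto. unfold Rdiv in Hd'.
    rewrite Rmult_assoc, Rinv_l in Hd' by lra. lra. }
  assert (HK : forall t, t0 <= t <= t1 -> K (X t) (Y t) = K (X t0) 0).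
  { intros t Ht'. destruct (Req_dec t t0) as [->|Hne]. now rewrite Y0.
    destruct (MVT_gen (fun t => K (X t) (Y t)) t0 t (fun _ => 0)) as (c & _ & Heq).
    - rewrite Rmin_left, Rmax_right by lra. intros x Hx.
      destruct (Hs x) as [[HX HY] _]. lra.
      eapply is_derive_eq. apply (rot_dK H X Y x _ _ HX HY). apply Hc; lra. apply Rminus_diag_uniq. ring.
    - rewrite Rmin_left, Rmax_right by lra. intros x Hx.
      apply continuity_pt_filterlim. destruct (Hc x) as (cX & cY & Hin). lra.
      apply (continuous_comp_2 X Y K); auto. apply (rot_cK H). simpl. simpl in Hin. lra.
    - rewrite Y0 in Heq. lra. }
  repeat split; auto.
  intros x y Hy Hin Hk.
  destruct (Ranalysis5.IVT_interv (fun t => - X t - (- (x / y)) * Y t) t0 t1) as (t & Htt & Htz); auto.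
  - intros a Ha. apply continuity_pt_filterlim. destruct (Hc a Ha) as (cX & cY & _).
  apply (continuous_minus_scal (fun t => - X t) Y); auto.
    now apply (continuous_opp (K := R_AbsRing) X).
  - rewrite Y0. lra.
  - rewrite Y1. lra.
  - assert (Ht0 : t <> t0) by (intros ->; rewrite Y0 in Htz; lra).
    assert (Ht1 : t <> t1) by (intros ->; rewrite Y1 in Htz; lra).
    exists t. split. lra.
    destruct (Hs t) as [_ HYt]. lra. destruct (Hc t Htt) as (_ & _ & Hint).
    (* both points lie on the same ray and on the same level *)
    set (r := sqrt (x ^ 2 + y ^ 2)). assert (Hr2 : r ^ 2 = x ^ 2 + y ^ 2) by (unfold r;
        rewrite pow2_sqrt; nra).
    assert (Hr : 0 < r) by (unfold r; apply sqrt_lt_R0; nra).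
    assert (HXt : X t = x / y * Y t) by lra.
    assert (Hcs : (x / r) ^ 2 + (y / r) ^ 2 = 1).
    { replace ((x / r) ^ 2 + (y / r) ^ 2) with ((x ^ 2 + y ^ 2) / r ^ 2) by (field; lra).
      rewrite Hr2. field. nra. }
    set (rho := r / y * Y t).
    assert (Hrho : 0 < rho) by (unfold rho; apply Rmult_lt_0_compat; auto; apply Rdiv_lt_0_compat; auto).
    assert (EX : rho * (x / r) = X t) by (unfold rho; rewrite HXt; field; lra).
    assert (EY : rho * (y / r) = Y t) by (unfold rho; field; lra).
    assert (Hrho2 : rho ^ 2 = X t ^ 2 + Y t ^ 2).
    { rewrite <- EX, <- EY. transitivity (rho ^ 2 * ((x / r) ^ 2 + (y / r) ^ 2)). rewrite Hcs. ring. ring. }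
    assert (E : rho = r).
    { apply (ray_injective f g K M R0 (x / r) (y / r)); auto.
      split. lra. apply Rnot_le_lt. intros Hle. nra. split. lra. apply Rnot_le_lt. intros Hle. nra.
      rewrite EX, EY, HK by lra. rewrite <- Hk. f_equal; field; lra. }
    rewrite E in EX, EY. split. rewrite <- EX. field; lra. rewrite <- EY. field; lra.
Qed.

(** * The centers of the two zones *)

(** The linear part at [(1, 1)] is [((b, - k), (e, - b))], of trace 0 and determinant
    [k e - b^2 = 1]. *)
Definition k_of (b e : R) : R := (b ^ 2 + 1) / e.

(** Exponents of [x] and [y] in the first integral [x^A y^B (1 - A u - B v)]. *)
Definition A_of (b e : R) : R := b * (b - e).
Definition B_of (b e : R) : R := b * (b - k_of b e).

(** The coordinates [X], [Y] of a zone are taken in the basis formed by the direction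
    [(3, 4)] of the line and its image [(p, q)] under the linear part, both multiplied
    by a sign [ep]; in them the linear part is the rotation [(- Y, X)]. *)
Definition basis_det (b e : R) : R := 9 * e - 24 * b + 16 * k_of b e.

(** Together with [basis_det] the factor that normalises the first integral to
    [(X^2 + Y^2) / 2 + ...]. *)
Definition N_of (b e : R) : R := b * (1 + A_of b e) * (e - b) / e.
Definition p_of (b e : R) : R := 3 * b - 4 * k_of b e.
Definition q_of (b e : R) : R := 3 * e - 4 * b.

(** Compactness of the parameters, used for constants that are uniform along the
    unfolding, and the inequalities that make the first integral nondegenerate. *)
Definition good (m b e : R) : Prop :=
  Rabs b <= m /\ / m <= e <= m /\ b <> 0 /\ 1 + A_of b e <> 0 /\ e <> b.

(** The sign [ep] is 1 in zone 1 and -1 in zone 2, so that the zone is [Y > 0] and is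
    crossed from [X > 0] to [X < 0]. *)
Definition u_of (b e ep X Y : R) : R := ep * (3 * X + p_of b e * Y).
Definition v_of (b e ep X Y : R) : R := ep * (4 * X + q_of b e * Y).
Definition u_dot (b e u v : R) : R := (1 + u) * (b * u - k_of b e * v).
Definition v_dot (b e u v : R) : R := (1 + v) * (e * u - b * v).
Definition X_dot (b e ep X Y : R) : R :=
  let u := u_of b e ep X Y in let v := v_of b e ep X Y in
  ep * (q_of b e * u_dot b e u v - p_of b e * v_dot b e u v) / basis_det b e.
Definition Y_dot (b e ep X Y : R) : R :=
  let u := u_of b e ep X Y in let v := v_of b e ep X Y in
  ep * (3 * v_dot b e u v - 4 * u_dot b e u v) / basis_det b e.
Definition integral_uv (b e u v : R) : R :=
  (A_of b e * ln (1 + u) + B_of b e * ln (1 + v) + ln (1 - A_of b e * u - B_of b e * v)) / (N_of b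
      e * basis_det b e).
Definition integral_XY (b e ep X Y : R) : R := integral_uv b e (u_of b e ep X Y) (v_of b e ep X Y).

(** The integrating factor [1 / (x y (1 - A u - B v))]. *)
Definition multiplier (b e ep X Y : R) : R :=
  let u := u_of b e ep X Y in let v := v_of b e ep X Y in
  / ((1 + u) * (1 + v) * (1 - A_of b e * u - B_of b e * v)).

Lemma good_nonzero m b e : 1 <= m -> good m b e -> 0 < e /\ 0 < basis_det b e /\ N_of b e <> 0.
Proof.
  intros Hm (Hb & He & Hb0 & HA & Heb).
  assert (He0 : 0 < e). { assert (0 < / m) by (apply Rinv_0_lt_compat; lra). lra. }
  split; auto. split.
  - unfold basis_det, k_of. replace (9 * e - 24 * b + 16 * ((b ^ 2 + 1) / e)) with
      (((3 * e - 4 * b) ^ 2 + 16) / e) by (field; lra).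
    apply Rdiv_lt_0_compat; auto. pose proof (pow2_ge_0 (3 * e - 4 * b)). lra.
  - unfold N_of, Rdiv. repeat apply Rmult_integral_contrapositive_currified; auto.
    lra. apply Rinv_neq_0_compat. lra.
Qed.

(** The linear part is a rotation in these coordinates because it has trace 0 and
    determinant 1. *)
Lemma X_dot_expand m b e ep X Y : 1 <= m -> good m b e -> ep = 1 \/ ep = -1 ->
  let u := u_of b e ep X Y in let v := v_of b e ep X Y in
  X_dot b e ep X Y = - Y + ep * (q_of b e * (u * (b * u - k_of b e * v)) - p_of b e * (v * (e * u -
      b * v))) * / basis_det b e.
Proof.
  intros Hm Hg Hep u v. destruct (good_nonzero m b e Hm Hg) as (He & Ho & _).
  unfold X_dot. fold u v. unfold u_dot, v_dot. unfold u, v, u_of, v_of, basis_det, p_of, q_of, k_of in *.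
  assert (Hne : 9 * e - 24 * b + 16 * ((b ^ 2 + 1) / e) <> 0) by lra.
  assert (Hne2 : 9 * e ^ 2 - 24 * b * e + 16 * (b ^ 2 + 1) <> 0).
  { intros E. apply Hne. replace (9 * e - 24 * b + 16 * ((b ^ 2 + 1) / e)) with ((9 * e ^ 2 - 24 *
      b * e + 16 * (b ^ 2 + 1)) / e) by (field; lra). rewrite E. unfold Rdiv; ring. }
  destruct Hep as [-> | ->]; field; repeat split; try lra; intros E; apply Hne2; lra.
Qed.

Lemma Y_dot_expand m b e ep X Y : 1 <= m -> good m b e -> ep = 1 \/ ep = -1 ->
  let u := u_of b e ep X Y in let v := v_of b e ep X Y in
  Y_dot b e ep X Y = X + ep * (3 * (v * (e * u - b * v)) - 4 * (u * (b * u - k_of b e * v))) * /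
      basis_det b e.
Proof.
  intros Hm Hg Hep u v. destruct (good_nonzero m b e Hm Hg) as (He & Ho & _).
  unfold Y_dot. fold u v. unfold u_dot, v_dot. unfold u, v, u_of, v_of, basis_det, p_of, q_of, k_of in *.
  assert (Hne : 9 * e - 24 * b + 16 * ((b ^ 2 + 1) / e) <> 0) by lra.
  assert (Hne2 : 9 * e ^ 2 - 24 * b * e + 16 * (b ^ 2 + 1) <> 0).
  { intros E. apply Hne. replace (9 * e - 24 * b + 16 * ((b ^ 2 + 1) / e)) with ((9 * e ^ 2 - 24 *
      b * e + 16 * (b ^ 2 + 1)) / e) by (field; lra). rewrite E. unfold Rdiv; ring. }
  destruct Hep as [-> | ->]; field; repeat split; try lra; intros E; apply Hne2; lra.
Qed.

(** [basis_det] is bounded below: [e] times it equals [(3 e - 4 b)^2 + 16]. *)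
Lemma coefficient_bounds m : 1 <= m -> exists B, 1 <= B /\ forall b e, good m b e ->
  Rabs b <= B /\ Rabs e <= B /\ Rabs (k_of b e) <= B /\ Rabs (p_of b e) <= B /\ Rabs (q_of b e) <= B /\
  Rabs (/ basis_det b e) <= B /\ Rabs (A_of b e) <= B /\ Rabs (B_of b e) <= B.
Proof.
  intros Hm.
  set (k0 := (m ^ 2 + 1) * m).
  exists (1 + 10 * m + 10 * k0 + 10 * m * (m + k0)).
  assert (Hk0 : m <= k0) by (unfold k0; nra).
  split. nra.
  intros b e Hg. assert (Hg' := Hg). destruct Hg' as (Hb & He & _).
  destruct (good_nonzero m b e Hm Hg) as (He0 & Ho & _).
  assert (Hmi : 0 < / m) by (apply Rinv_0_lt_compat; lra).
  assert (Re : Rabs e <= m) by (rewrite Rabs_pos_eq; lra).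
  assert (Rei : Rabs (/ e) <= m).
  { rewrite Rabs_pos_eq by (apply Rlt_le, Rinv_0_lt_compat; lra).
    rewrite <- (Rinv_inv m). apply Rinv_le_contravar; lra. }
  assert (R1 : Rabs 1 <= 1) by (rewrite Rabs_R1; lra).
  assert (Rk : Rabs (k_of b e) <= k0) by (unfold k_of, k0, Rdiv; bound_abs).
  assert (R3 : Rabs 3 <= 3) by (rewrite Rabs_pos_eq; lra).
  assert (R4 : Rabs 4 <= 4) by (rewrite Rabs_pos_eq; lra).
  assert (Rp : Rabs (p_of b e) <= 3 * m + 4 * k0) by (unfold p_of; bound_abs).
  assert (Rq : Rabs (q_of b e) <= 3 * m + 4 * m) by (unfold q_of; bound_abs).
  assert (RA : Rabs (A_of b e) <= m * (m + m)) by (unfold A_of; bound_abs).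
  assert (RB : Rabs (B_of b e) <= m * (m + k0)) by (unfold B_of; bound_abs).
  assert (Rw : Rabs (/ basis_det b e) <= m).
  { rewrite Rabs_pos_eq by (apply Rlt_le, Rinv_0_lt_compat; lra).
    rewrite <- (Rinv_inv m). apply Rinv_le_contravar. lra.
    apply Rle_trans with (16 / e).
    - apply Rle_trans with (1 / e). unfold Rdiv. rewrite Rmult_1_l. apply Rinv_le_contravar; lra.
      unfold Rdiv. apply Rmult_le_compat_r. apply Rlt_le, Rinv_0_lt_compat; lra. lra.
    - unfold basis_det, k_of. replace (9 * e - 24 * b + 16 * ((b ^ 2 + 1) / e)) with
      (((3 * e - 4 * b) ^ 2 + 16) / e) by (field; lra).
      unfold Rdiv. apply Rmult_le_compat_r. apply Rlt_le, Rinv_0_lt_compat; lra.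
      pose proof (pow2_ge_0 (3 * e - 4 * b)). lra. }
  assert (m * m <= m * k0) by nra. repeat split; nra.
Qed.

Lemma cont2_plus F G a b : cont2 F a b -> cont2 G a b -> cont2 (fun x y => F x y + G x y) a b.
Proof. intros HF HG. now apply (continuous_plus (K := R_AbsRing) (fun p => F (fst p) (snd p)) (fun
    p => G (fst p) (snd p))). Qed.

Lemma cont2_fst a b : cont2 (fun x _ => x) a b.
Proof. apply continuous_fst. Qed.

Lemma cont2_const c a b : cont2 (fun _ _ => c) a b.
Proof. apply continuous_const. Qed.

Lemma cont2_inv F a b : F a b <> 0 -> cont2 F a b -> cont2 (fun x y => / F x y) a b.
Proof. intros H HF. apply (continuous_comp (fun p => F (fst p) (snd p)) Rinv). exact HF.
now apply continuous_Rinv. Qed.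

Lemma cont2_ln F a b : 0 < F a b -> cont2 F a b -> cont2 (fun x y => ln (F x y)) a b.
Proof.
  intros H HF. apply (continuous_comp (fun p => F (fst p) (snd p)) ln). exact HF.
  apply (ex_derive_continuous ln). exists (/ F a b). now apply is_derive_ln.
Qed.

Ltac solve_cont2 := lazymatch goal with
  | |- cont2 (fun x y => @?F x y + @?G x y) _ _ => apply (cont2_plus F G); solve_cont2
  | |- cont2 (fun x y => @?F x y - @?G x y) _ _ => apply (cont2_minus F G); solve_cont2
  | |- cont2 (fun x y => @?F x y * @?G x y) _ _ => apply (cont2_mult F G); solve_cont2
  | |- cont2 (fun x y => / @?F x y) _ _ => apply (cont2_inv F); [|solve_cont2]
  | |- cont2 (fun x y => ln (@?F x y)) _ _ => apply (cont2_ln F); [|solve_cont2]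
  | |- cont2 _ _ _ => first [apply cont2_const | apply cont2_fst | apply cont2_snd]
  end.

(** [1 - A u - B v = 0] is an invariant line. The identity says that the gradient of
    [A ln x + B ln y + ln (1 - A u - B v)] is orthogonal to the field, and gives the
    factor. *)
Lemma integral_identity b e u v ut vt : 0 < e -> N_of b e <> 0 ->
  0 < 1 + u -> 0 < 1 + v -> 0 < 1 - A_of b e * u - B_of b e * v ->
  A_of b e * (ut / (1 + u)) + B_of b e * (vt / (1 + v))
    + (- A_of b e * ut - B_of b e * vt) / (1 - A_of b e * u - B_of b e * v)
  = N_of b e * (v_dot b e u v * ut - u_dot b e u v * vt) / ((1 + u) * (1 + v) * (1 - A_of b e * u -
      B_of b e * v)).
Proof.
  intros He HN Hu Hv HL.
  assert (E : (A_of b e * (1 - A_of b e * u - B_of b e * v - (1 + u))) * (1 + v) = N_of b e * v_dot b e u v).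
  { unfold N_of, v_dot, A_of, B_of, k_of. field. lra. }
  assert (E2 : (B_of b e * (1 - A_of b e * u - B_of b e * v - (1 + v))) * (1 + u) = - (N_of b e *
      u_dot b e u v)).
  { unfold N_of, u_dot, A_of, B_of, k_of. field. lra. }
  replace (N_of b e * (v_dot b e u v * ut - u_dot b e u v * vt)) with
    (N_of b e * v_dot b e u v * ut + - (N_of b e * u_dot b e u v) * vt) by ring.
  rewrite <- E, <- E2. field. repeat split; lra.
Qed.

(** The radius is common to all parameters bounded by [m]. *)
Definition zone_radius (m R0 : R) : Prop := 0 < R0 /\ R0 <= 1 /\ forall b e ep, good m b e ->
    ep = 1 \/ ep = -1 ->
  rotor (X_dot b e ep) (Y_dot b e ep) (integral_XY b e ep) (multiplier b e ep) R0 /\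
  forall X Y, X ^ 2 + Y ^ 2 < R0 ^ 2 ->
    0 < 1 + u_of b e ep X Y /\ 0 < 1 + v_of b e ep X Y /\
        0 < 1 - A_of b e * u_of b e ep X Y - B_of b e * v_of b e ep X Y.

(** The field is the rotation [(- Y, X)] plus quadratic terms whose coefficients are
    bounded in terms of [m], so in a disc of small radius, uniform in the parameters,
    the angular speed is close to 1 and the multiplier close to 1. *)
Lemma zone_rotor m : 1 <= m -> exists R0, zone_radius m R0.
Proof.
  intros Hm. destruct (coefficient_bounds m Hm) as (B & HB & Hbd).
  set (U := 4 + B). set (C := B * (14 * B * U ^ 2 + 4 * B ^ 2 * U ^ 2)).
  assert (HU : 5 <= U) by (unfold U; lra).
  assert (HC : 0 < C).
  { unfold C. assert (0 < U ^ 2) by nra. assert (0 < B * U ^ 2) by nra. nra. }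
  (* [C r^3] bounds the nonlinear part of the angular momentum; in the disc of radius
     [1 / D] it is at most [r^2 / 2], and [|u|], [|v|] are at most 1/20 *)
  set (D := 2 * C + 20 * B * U).
  assert (HBU : 5 <= B * U) by nra.
  assert (HD : 0 < D /\ 1 <= D) by (unfold D; nra).
  exists (/ D). split; [|split].
  { apply Rinv_0_lt_compat. lra. }
  { rewrite <- Rinv_1. apply Rinv_le_contravar; lra. }
  intros b e ep Hg Hep.
  destruct (Hbd b e Hg) as (Rb & Re & Rk & Rp & Rq & Rw & RA & RB).
  destruct (good_nonzero m b e Hm Hg) as (He & Ho & HN).
  assert (Rep : Rabs ep <= 1) by (destruct Hep as [-> | ->]; [rewrite Rabs_R1|rewrite Rabs_left]; lra).
  assert (R3 : Rabs 3 <= 3) by (rewrite Rabs_pos_eq; lra).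
  assert (R4 : Rabs 4 <= 4) by (rewrite Rabs_pos_eq; lra).
  assert (Huv : forall X Y r, 0 <= r -> X ^ 2 + Y ^ 2 = r ^ 2 ->
     Rabs X <= r /\ Rabs Y <= r /\ Rabs (u_of b e ep X Y) <= U * r /\ Rabs (v_of b e ep X Y) <= U * r).
  { intros X Y r Hr E.
    assert (RX : Rabs X <= r) by (apply Rabs_le; clear - Hr E; nra).
    assert (RY : Rabs Y <= r) by (apply Rabs_le; clear - Hr E; nra).
    repeat split; auto.
    - apply Rle_trans with (1 * (3 * r + B * r)). unfold u_of. bound_abs. unfold U. nra.
    - apply Rle_trans with (1 * (4 * r + B * r)). unfold v_of. bound_abs. unfold U. nra. }
  assert (Hpolar : forall X Y, X ^ 2 + Y ^ 2 < (/ D) ^ 2 -> exists r, 0 <= r < / D /\ X ^ 2 + Y ^ 2 = r ^ 2).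
  { intros X Y Hin. exists (sqrt (X ^ 2 + Y ^ 2)). assert (0 <= X ^ 2 + Y ^ 2) by nra.
    rewrite pow2_sqrt by auto. split; auto. split. apply sqrt_pos.
    rewrite <- (sqrt_pow2 (/ D)). apply sqrt_lt_1; auto. nra. apply Rlt_le, Rinv_0_lt_compat; lra. }
  assert (Hsmall : forall X Y, X ^ 2 + Y ^ 2 < (/ D) ^ 2 ->
     Rabs (u_of b e ep X Y) <= / 20 /\ Rabs (v_of b e ep X Y) <= / 20 /\
     Rabs (A_of b e * u_of b e ep X Y + B_of b e * v_of b e ep X Y) <= / 10).
  { intros X Y Hin. destruct (Hpolar X Y Hin) as (r & Hr & E).
    destruct (Huv X Y r) as (_ & _ & Hu & Hv); try lra.
    assert (HDr : D * r <= 1). { replace 1 with (D * / D) by (field; lra). apply Rmult_le_compat_l; lra. }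
    assert (HUr : B * U * r <= / 20) by (unfold D in HDr; nra).
    assert (HUr0 : 0 <= U * r) by nra.
    assert (HUr1 : U * r <= B * U * r) by (rewrite Rmult_assoc, <- (Rmult_1_l (U * r)) at 1;
        apply Rmult_le_compat_r; lra).
    repeat split; try lra.
    apply Rle_trans with (B * (U * r) + B * (U * r)). bound_abs. nra. }
  assert (Hpos : forall X Y, X ^ 2 + Y ^ 2 < (/ D) ^ 2 ->
    0 < 1 + u_of b e ep X Y /\ 0 < 1 + v_of b e ep X Y /\
        0 < 1 - A_of b e * u_of b e ep X Y - B_of b e * v_of b e ep X Y).
  { intros X Y Hin. destruct (Hsmall X Y Hin) as (Hu & Hv & Hw).
    apply Rabs_le_between in Hu. apply Rabs_le_between in Hv. apply Rabs_le_between in Hw. lra. }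
  split; auto. split.
  - apply Rinv_0_lt_compat; lra.
  - intros X Y Hin. destruct (Hpolar X Y Hin) as (r & Hr & E).
    destruct (Huv X Y r) as (RX & RY & Hu & Hv); try lra.
    rewrite (X_dot_expand m), (Y_dot_expand m) by auto. rewrite E.
    set (u := u_of b e ep X Y) in *. set (v := v_of b e ep X Y) in *.
    set (T := ep * (3 * (v * (e * u - b * v)) - 4 * (u * (b * u - k_of b e * v))) * / basis_det b e * X
       - ep * (q_of b e * (u * (b * u - k_of b e * v)) - p_of b e * (v * (e * u - b * v))) * /
           basis_det b e * Y).
    assert (HT : Rabs T <= C * r ^ 3).
    { apply Rle_trans with (1 * (3 * (U * r * (B * (U * r) + B * (U * r))) + 4 * (U * r * (B * (U *
        r) + B * (U * r)))) * B * r
        + 1 * (B * (U * r * (B * (U * r) + B * (U * r))) + B * (U * r * (B * (U * r) + B * (U *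
            r)))) * B * r).
      unfold T. bound_abs. right. unfold C. ring. }
    assert (HCr : C * r ^ 3 <= r ^ 2 / 2).
    { assert (HDr : D * r <= 1). { replace 1 with (D * / D) by (field; lra). apply Rmult_le_compat_l; lra. }
      assert (C * r <= / 2). { unfold D in HDr. assert (0 <= B * U * r) by (apply Rmult_le_pos; lra). nra. }
      replace (C * r ^ 3) with (C * r * r ^ 2) by ring. assert (0 <= r ^ 2) by apply pow2_ge_0. nra. }
    match goal with |- _ <= ?Z <= _ => replace Z with (X ^ 2 + Y ^ 2 + T) by (unfold T; ring) end.
    apply Rabs_le_between in HT. assert (0 <= r ^ 2) by apply pow2_ge_0. lra.
  - intros X Y Hin. destruct (Hsmall X Y Hin) as (Hu & Hv & Hw). unfold multiplier. cbv zeta.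
    set (u := u_of b e ep X Y) in *. set (v := v_of b e ep X Y) in *.
    set (w := 1 - A_of b e * u - B_of b e * v).
    apply Rabs_le_between in Hu. apply Rabs_le_between in Hv. apply Rabs_le_between in Hw.
    assert (Hww : 9 / 10 <= w <= 11 / 10) by (unfold w; lra).
    assert (H1 : 9 / 10 * (9 / 10) <= (1 + u) * (1 + v) <= 11 / 10 * (11 / 10)) by (split;
        apply Rmult_le_compat; lra).
    assert (H2 : / 2 <= (1 + u) * (1 + v) * w <= 2) by (clear - Hww H1;
        set (p := (1 + u) * (1 + v)) in *; split; nra).
    split. apply Rinv_le_contravar; lra. replace 2 with (/ / 2) by field. apply Rinv_le_contravar; lra.
  - unfold integral_XY, integral_uv, u_of, v_of.
  rewrite !Rmult_0_r, !Rplus_0_r, !Rmult_0_r, !Rminus_0_r, !Rplus_0_r, ln_1. unfold Rdiv. ring.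
  - intros X Y t X' Y' HX HY Hin. destruct (Hpos _ _ Hin) as (P1 & P2 & P3).
    unfold integral_XY, integral_uv, u_of, v_of in *.
    set (A := A_of b e) in *. set (Bq := B_of b e) in *. set (N := N_of b e * basis_det b e).
    eapply is_derive_eq.
    { auto_derive. 2: reflexivity. repeat split; try (eexists; eassumption); try assumption; lra. }
    erewrite (is_derive_unique (fun x => X x)) by exact HX.
    erewrite (is_derive_unique (fun x => Y x)) by exact HY.
    set (ut := ep * (3 * X' + p_of b e * Y')). set (vt := ep * (4 * X' + q_of b e * Y')).
    pose proof (integral_identity b e _ _ ut vt He HN P1 P2 P3) as HI.
    apply Rminus_diag_uniq. unfold multiplier, u_of, v_of. cbv zeta.
    set (u := ep * (3 * X t + p_of b e * Y t)) in *. set (v := ep * (4 * X t + q_of b e * Y t)) in *.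
    fold A Bq in HI |- *.
    assert (HE : v_dot b e u v * ut - u_dot b e u v * vt = basis_det b e * (Y_dot b e ep (X t) (Y
        t) * X' - X_dot b e ep (X t) (Y t) * Y')).
    { unfold Y_dot, X_dot, u_of, v_of. cbv zeta. fold u v. unfold ut, vt. field. lra. }
    rewrite HE in HI.
    transitivity ((A * (ut / (1 + u)) + Bq * (vt / (1 + v)) + (- A * ut - Bq * vt) / (1 - A * u - Bq * v)) / N
      - / ((1 + u) * (1 + v) * (1 - A * u - Bq * v)) * (Y_dot b e ep (X t) (Y t) * X' - X_dot b e
          ep (X t) (Y t) * Y')).
    { unfold ut, vt. field. repeat split; try lra. unfold N.
    apply Rmult_integral_contrapositive_currified; lra. }
    rewrite HI. unfold N. field. repeat split; lra.
  - intros [a1 a2] Hin. change (cont2 (X_dot b e ep) a1 a2).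
  unfold X_dot, u_dot, v_dot, u_of, v_of, Rdiv. solve_cont2. lra.
  - intros [a1 a2] Hin. change (cont2 (Y_dot b e ep) a1 a2).
  unfold Y_dot, u_dot, v_dot, u_of, v_of, Rdiv. solve_cont2. lra.
  - intros [a1 a2] Hin. change (cont2 (multiplier b e ep) a1 a2). destruct (Hpos _ _ Hin) as (P1 & P2 & P3).
    simpl in P1, P2, P3. unfold multiplier, u_of, v_of in *. cbv zeta. solve_cont2.
    apply Rgt_not_eq. repeat apply Rmult_lt_0_compat; assumption.
  - intros [a1 a2] Hin. change (cont2 (integral_XY b e ep) a1 a2). destruct (Hpos _ _ Hin) as (P1 & P2 & P3).
    simpl in P1, P2, P3. unfold integral_XY, integral_uv, u_of, v_of, Rdiv in *. solve_cont2; try assumption.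
    apply Rmult_integral_contrapositive_currified; lra.
Qed.

(** * From the coordinates of a zone to the plane *)

Definition point_of (b e ep X Y : R) : R * R := (1 + u_of b e ep X Y, 1 + v_of b e ep X Y).
Definition X_of (b e ep : R) (z : R * R) : R :=
  ep * (q_of b e * (fst z - 1) - p_of b e * (snd z - 1)) / basis_det b e.
Definition Y_of (b e ep : R) (z : R * R) : R :=
  ep * (3 * (snd z - 1) - 4 * (fst z - 1)) / basis_det b e.
Definition center_field (b e : R) (z : R * R) : R * R :=
  (fst z * (b * (fst z - 1) - k_of b e * (snd z - 1)), snd z * (e * (fst z - 1) - b * (snd z - 1))).
Definition side (i : zone) : R := match i with zone1 => 1 | zone2 => -1 end.

(** The common parametrization of the line; [X > 0] is [rho > 0] in zone 1 and [rho < 0]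
    in zone 2. *)
Definition gamma (rho : R) : R * R := (1 + 3 * rho, 1 + 4 * rho).
Definition sq_radius (b e : R) (z : R * R) : R := X_of b e 1 z ^ 2 + Y_of b e 1 z ^ 2.

(** The first integral of the zone in the original coordinates; it does not depend on
    the sign [ep]. *)
Definition plane_integral (b e : R) (z : R * R) : R := integral_uv b e (fst z - 1) (snd z - 1).
Definition sigma_level (b e rho : R) : R := plane_integral b e (gamma rho).

Lemma side_cases i : side i = 1 \/ side i = -1.
Proof. destruct i; simpl; auto. Qed.

Lemma side_sqr i : side i * side i = 1.
Proof. destruct i; simpl; ring. Qed.

Lemma basis_det_split b e : basis_det b e = 3 * q_of b e - 4 * p_of b e.
Proof. unfold basis_det, q_of, p_of. ring. Qed.

Lemma u_of_XY b e ep z : 0 < basis_det b e -> ep * ep = 1 ->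
    u_of b e ep (X_of b e ep z) (Y_of b e ep z) = fst z - 1.
Proof.
  intros Ho E. unfold u_of, X_of, Y_of. rewrite basis_det_split in *.
  transitivity (ep * ep * (fst z - 1)). field. lra. rewrite E. ring.
Qed.

Lemma v_of_XY b e ep z : 0 < basis_det b e -> ep * ep = 1 ->
    v_of b e ep (X_of b e ep z) (Y_of b e ep z) = snd z - 1.
Proof.
  intros Ho E. unfold v_of, X_of, Y_of. rewrite basis_det_split in *.
  transitivity (ep * ep * (snd z - 1)). field. lra. rewrite E. ring.
Qed.

Lemma point_of_XY b e ep z : 0 < basis_det b e -> ep * ep = 1 ->
    point_of b e ep (X_of b e ep z) (Y_of b e ep z) = z.
Proof.
  intros Ho E. unfold point_of. rewrite u_of_XY, v_of_XY by auto. destruct z; simpl. f_equal; ring.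
Qed.

Lemma X_of_point_of b e ep X Y : 0 < basis_det b e -> ep * ep = 1 -> X_of b e ep (point_of b e ep X Y) = X.
Proof.
  intros Ho E. unfold X_of, point_of, u_of, v_of. simpl. rewrite basis_det_split in *.
  transitivity (ep * ep * X). field. lra. rewrite E. ring.
Qed.

Lemma Y_of_point_of b e ep X Y : 0 < basis_det b e -> ep * ep = 1 -> Y_of b e ep (point_of b e ep X Y) = Y.
Proof.
  intros Ho E. unfold Y_of, point_of, u_of, v_of. simpl. rewrite basis_det_split in *.
  transitivity (ep * ep * Y). field. lra. rewrite E. ring.
Qed.

Lemma sq_radius_ep b e ep z : ep * ep = 1 -> X_of b e ep z ^ 2 + Y_of b e ep z ^ 2 = sq_radius b e z.
Proof.
  intros E. unfold sq_radius, X_of, Y_of, Rdiv.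
  set (a := q_of b e * (fst z - 1) - p_of b e * (snd z - 1)). set (c := 3 * (snd z - 1) - 4 * (fst z - 1)).
  transitivity (ep * ep * ((a * / basis_det b e) ^ 2 + (c * / basis_det b e) ^ 2)). ring. rewrite E. ring.
Qed.

Lemma h_Y_of b e ep z : 0 < basis_det b e -> ep * ep = 1 -> h z = - ep * basis_det b e * Y_of b e ep z.
Proof.
  intros Ho E. unfold h, Y_of. transitivity (- (ep * ep) * (3 * (snd z - 1) - 4 * (fst z - 1))).
  rewrite E. ring. field. lra.
Qed.

Lemma in_zone_Y_of b e i z : 0 < basis_det b e -> in_zone i z <-> 0 < Y_of b e (side i) z.
Proof.
  intros Ho. pose proof (h_Y_of b e (side i) z Ho (side_sqr i)) as Hh.
  destruct i; simpl in *; rewrite Hh; split; intros H; nra.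
Qed.

Lemma on_sigma_Y_of b e i z : 0 < basis_det b e -> on_sigma z <-> Y_of b e (side i) z = 0.
Proof.
  intros Ho. unfold on_sigma. rewrite (h_Y_of b e (side i) z Ho (side_sqr i)). split; intros H.
  - apply Rmult_integral in H. destruct H as [H|H]; auto. apply Rmult_integral in H.
    destruct i; simpl in *; lra.
  - rewrite H. ring.
Qed.

Lemma gamma_sigma rho : on_sigma (gamma rho).
Proof. unfold on_sigma, h, gamma. simpl. ring. Qed.

Lemma sigma_gamma z : on_sigma z -> z = gamma ((fst z - 1) / 3).
Proof. unfold on_sigma, h, gamma. destruct z; simpl. intros H. f_equal; lra. Qed.

Lemma gamma_inj r1 r2 : gamma r1 = gamma r2 -> r1 = r2.
Proof. unfold gamma. intros H. injection H. lra. Qed.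

Lemma point_of_axis b e ep X : point_of b e ep X 0 = gamma (ep * X).
Proof. unfold point_of, u_of, v_of, gamma. f_equal; ring. Qed.

Lemma X_of_gamma b e ep rho : 0 < basis_det b e -> ep * ep = 1 -> X_of b e ep (gamma rho) = ep * rho.
Proof.
  intros Ho E. replace (gamma rho) with (point_of b e ep (ep * rho) 0). now apply X_of_point_of.
  rewrite point_of_axis, <- Rmult_assoc, E, Rmult_1_l. reflexivity.
Qed.

Lemma sq_radius_gamma b e rho : 0 < basis_det b e -> sq_radius b e (gamma rho) = rho ^ 2.
Proof.
  intros Ho. unfold sq_radius. rewrite X_of_gamma by lra.
  replace (Y_of b e 1 (gamma rho)) with 0. ring. symmetry. apply (on_sigma_Y_of b e zone1); auto.
  apply gamma_sigma.
Qed.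

Lemma plane_integral_XY b e ep z : 0 < basis_det b e -> ep * ep = 1 ->
    integral_XY b e ep (X_of b e ep z) (Y_of b e ep z) = plane_integral b e z.
Proof. intros Ho E. unfold integral_XY, plane_integral. now rewrite u_of_XY, v_of_XY. Qed.

Lemma integral_XY_axis b e ep X : integral_XY b e ep X 0 = sigma_level b e (ep * X).
Proof. unfold sigma_level, plane_integral, integral_XY, gamma, u_of, v_of. simpl. f_equal; ring. Qed.

(** [solves_plane] and [plane_solves] transport solutions between the two coordinate
    systems. *)
Lemma solves_plane b e ep X Y t : 0 < basis_det b e -> ep * ep = 1 ->
  solves (X_dot b e ep) (Y_dot b e ep) X Y t ->
      is_solution_at (center_field b e) (fun t => point_of b e ep (X t) (Y t)) t.
Proof.
  intros Ho E [HX HY]. unfold is_solution_at, point_of, center_field. simpl.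
  set (u := u_of b e ep (X t) (Y t)). set (v := v_of b e ep (X t) (Y t)).
  assert (Ef : basis_det b e * X_dot b e ep (X t) (Y t) = ep * (q_of b e * u_dot b e u v - p_of b e
      * v_dot b e u v)).
  { unfold X_dot. fold u v. field. lra. }
  assert (Eg : basis_det b e * Y_dot b e ep (X t) (Y t) = ep * (3 * v_dot b e u v - 4 * u_dot b e u v)).
  { unfold Y_dot. fold u v. field. lra. }
  split.
  - apply is_derive_eq with (ep * (3 * X_dot b e ep (X t) (Y t) + p_of b e * Y_dot b e ep (X t) (Y t))).
    unfold u_of. auto_derive. repeat split; eexists; eassumption.
    erewrite (is_derive_unique (fun x => X x)) by exact HX.
    erewrite (is_derive_unique (fun x => Y x)) by exact HY. ring.
    apply Rmult_eq_reg_l with (basis_det b e); [|lra].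
    transitivity (ep * (3 * (basis_det b e * X_dot b e ep (X t) (Y t)) + p_of b e * (basis_det b e
        * Y_dot b e ep (X t) (Y t)))). ring.
    rewrite Ef, Eg. transitivity (ep * ep * (u_dot b e u v * (3 * q_of b e - 4 * p_of b e))). ring.
    rewrite E, <- basis_det_split. unfold u_dot. ring.
  - apply is_derive_eq with (ep * (4 * X_dot b e ep (X t) (Y t) + q_of b e * Y_dot b e ep (X t) (Y t))).
    unfold v_of. auto_derive. repeat split; eexists; eassumption.
    erewrite (is_derive_unique (fun x => X x)) by exact HX.
    erewrite (is_derive_unique (fun x => Y x)) by exact HY. ring.
    apply Rmult_eq_reg_l with (basis_det b e); [|lra].
    transitivity (ep * (4 * (basis_det b e * X_dot b e ep (X t) (Y t)) + q_of b e * (basis_det b e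
        * Y_dot b e ep (X t) (Y t)))). ring.
    rewrite Ef, Eg. transitivity (ep * ep * (v_dot b e u v * (3 * q_of b e - 4 * p_of b e))). ring.
    rewrite E, <- basis_det_split. unfold v_dot. ring.
Qed.

Lemma affine_derive (X1 Y1 : R -> R) a1 a2 w t dx dy : is_derive X1 t dx -> is_derive Y1 t dy ->
  is_derive (fun t => w * (a1 * (X1 t - 1) - a2 * (Y1 t - 1))) t (w * (a1 * dx - a2 * dy)).
Proof.
  intros H1 H2. auto_derive. repeat split; eexists; eassumption.
  erewrite (is_derive_unique (fun x => X1 x)) by exact H1.
  erewrite (is_derive_unique (fun x => Y1 x)) by exact H2. ring.
Qed.

Lemma plane_solves b e ep (psi : R -> R * R) t : 0 < basis_det b e -> ep * ep = 1 ->
  is_solution_at (center_field b e) psi t ->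
  solves (X_dot b e ep) (Y_dot b e ep) (fun t => X_of b e ep (psi t)) (fun t => Y_of b e ep (psi t)) t.
Proof.
  intros Ho E [H1 H2]. unfold center_field in H1, H2. simpl in H1, H2.
  unfold solves, X_dot, Y_dot. rewrite !u_of_XY, !v_of_XY by auto. unfold u_dot, v_dot.
  split.
  - eapply is_derive_ext; [|eapply is_derive_eq;
      [apply (affine_derive (fun s => fst (psi s)) (fun s => snd (psi s))
      (q_of b e) (p_of b e) (ep / basis_det b e) t _ _ H1 H2)|]].
    intros s. unfold X_of, Rdiv. apply Rminus_diag_uniq. simpl. ring. apply Rminus_diag_uniq.
    unfold Rdiv. ring.
  - eapply is_derive_ext; [|eapply is_derive_eq;
      [apply (affine_derive (fun s => fst (psi s)) (fun s => snd (psi s))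
      (-4) (-3) (ep / basis_det b e) t _ _ H1 H2)|]].
    intros s. unfold Y_of, Rdiv. apply Rminus_diag_uniq. simpl. ring. apply Rminus_diag_uniq.
    unfold Rdiv. ring.
Qed.

Lemma continuous_fst_comp {T : UniformSpace} (psi : T -> R * R) t : continuous psi t ->
    continuous (fun t => fst (psi t)) t.
Proof. intros H. apply (continuous_comp psi fst); auto. destruct (psi t). apply continuous_fst. Qed.

Lemma continuous_snd_comp {T : UniformSpace} (psi : T -> R * R) t : continuous psi t ->
    continuous (fun t => snd (psi t)) t.
Proof. intros H. apply (continuous_comp psi snd); auto. destruct (psi t). apply continuous_snd. Qed.

Lemma continuous_affine_comp {T : UniformSpace} (psi : T -> R * R) (a1 a2 a0 : R) t : continuous psi t ->
  continuous (fun t => a1 * fst (psi t) + a2 * snd (psi t) + a0) t.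
Proof.
  intros H. apply (continuous_plus (K := R_AbsRing) (fun t => a1 * fst (psi t) + a2 * snd (psi t))
      (fun _ => a0)).
  apply (continuous_plus (K := R_AbsRing) (fun t => a1 * fst (psi t)) (fun t => a2 * snd (psi t))).
  apply (continuous_scal_r (K := R_AbsRing) a1 (fun t => fst (psi t))). now apply continuous_fst_comp.
  apply (continuous_scal_r (K := R_AbsRing) a2 (fun t => snd (psi t))). now apply continuous_snd_comp.
  apply continuous_const.
Qed.

Lemma continuous_X_of {T : UniformSpace} b e ep (psi : T -> R * R) t : continuous psi t ->
    continuous (fun t => X_of b e ep (psi t)) t.
Proof.
  intros H. eapply continuous_ext; [|apply (continuous_affine_comp psi (ep * q_of b e / basis_det b
      e) (- ep * p_of b e / basis_det b e)
     (ep * (p_of b e - q_of b e) / basis_det b e) t H)]. intros s. unfold X_of, Rdiv.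
     apply Rminus_diag_uniq. simpl. ring.
Qed.

Lemma continuous_Y_of {T : UniformSpace} b e ep (psi : T -> R * R) t : continuous psi t ->
    continuous (fun t => Y_of b e ep (psi t)) t.
Proof.
  intros H. eapply continuous_ext; [|apply (continuous_affine_comp psi (- 4 * ep / basis_det b e)
      (3 * ep / basis_det b e)
     (ep / basis_det b e) t H)]. intros s. unfold Y_of, Rdiv. apply Rminus_diag_uniq. simpl. ring.
Qed.

Lemma zone_half_turn m R0 i b e x0 : 1 <= m -> zone_radius m R0 -> good m b e -> 0 < x0 < R0 / 5 ->
  exists T phi x1, 0 < T /\ phi 0 = gamma (side i * x0) /\ phi T = gamma (side i * x1) /\ x1 < 0 /\
      - (5 * x0) <= x1 /\
    sigma_level b e (side i * x1) = sigma_level b e (side i * x0) /\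
    (forall t, is_solution_at (center_field b e) phi t) /\
    (forall t, 0 < t < T -> in_zone i (phi t)) /\
    (forall t, 0 < sq_radius b e (phi t) <= 25 * x0 ^ 2) /\
    (forall t, plane_integral b e (phi t) = sigma_level b e (side i * x0)).
Proof.
  intros Hm (HR & _ & HZ) Hg Hx0. destruct (good_nonzero m b e Hm Hg) as (He & Ho & HN).
  destruct (HZ b e (side i) Hg (side_cases i)) as [Hrot _].
  destruct (half_turn _ _ _ _ R0 x0 Hrot Hx0) as (T & X & Y & HT & X0 & Y0 & XT & YT & Hs & HY & Hb & HK).
  pose proof (side_sqr i) as E.
  exists T, (fun t => point_of b e (side i) (X t) (Y t)), (X T).
  split; [exact HT|]. split; [now rewrite X0, Y0, point_of_axis|]. split; [now rewrite YT, point_of_axis|].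
  split; [exact XT|]. split.
  { destruct (Hb T) as (_ & _ & H). rewrite YT in H. nra. }
  split. { rewrite <- !integral_XY_axis. specialize (HK T). now rewrite YT in HK. }
  split. { intros t. apply (solves_plane b e (side i) X Y t Ho E (Hs t)). }
  split. { intros t Ht. apply (in_zone_Y_of b e i); auto. rewrite Y_of_point_of; auto. }
  split. { intros t. rewrite <- (sq_radius_ep b e (side i)), X_of_point_of, Y_of_point_of by auto.
  destruct (Hb t) as (_ & H1 & H2). lra. }
  intros t. rewrite <- (plane_integral_XY b e (side i)), X_of_point_of, Y_of_point_of, HK,
      integral_XY_axis by auto. reflexivity.
Qed.

(** Any arc of a trajectory through a zone is the half turn given by the level of its
    starting point. *)
Lemma zone_arc m R0 i b e (psi : R -> R * R) t0 t1 : 1 <= m -> zone_radius m R0 -> good m b e -> t0 < t1 ->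
  (forall t, t0 <= t <= t1 -> continuous psi t /\ 0 < sq_radius b e (psi t) < R0 ^ 2) ->
  (forall t, t0 < t < t1 -> is_solution_at (center_field b e) psi t /\ in_zone i (psi t)) ->
  on_sigma (psi t0) -> on_sigma (psi t1) ->
  exists r0 r1, psi t0 = gamma r0 /\ psi t1 = gamma r1 /\ 0 < side i * r0 /\ side i * r1 < 0 /\
    (forall t, t0 <= t <= t1 -> plane_integral b e (psi t) = sigma_level b e r0) /\
    (forall z, in_zone i z -> sq_radius b e z < R0 ^ 2 -> plane_integral b e z = sigma_level b e r0 ->
       exists t, t0 < t < t1 /\ psi t = z).
Proof.
  intros Hm (HR & _ & HZ) Hg Ht Hc Hs S0 S1. destruct (good_nonzero m b e Hm Hg) as (He & Ho & HN).
  destruct (HZ b e (side i) Hg (side_cases i)) as [Hrot _].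
  pose proof (side_sqr i) as E.
  assert (Y0 : Y_of b e (side i) (psi t0) = 0) by now apply on_sigma_Y_of.
  assert (Y1 : Y_of b e (side i) (psi t1) = 0) by now apply on_sigma_Y_of.
  destruct (arc_properties _ _ _ _ R0 (fun t => X_of b e (side i) (psi t)) (fun t => Y_of b e (side
      i) (psi t)) t0 t1 Hrot Ht)
    as (X0 & X1 & HK & Hcov); auto.
  - intros t Ht'. destruct (Hc t Ht') as [Hct Hn]. split; [|split].
    now apply continuous_X_of. now apply continuous_Y_of. now rewrite sq_radius_ep.
  - intros t Ht'. destruct (Hs t Ht') as [H1 H2]. split. now apply plane_solves. now apply in_zone_Y_of.
  - assert (G0 : gamma (side i * X_of b e (side i) (psi t0)) = psi t0).
    { rewrite <- (point_of_axis b e (side i)). rewrite <- Y0. now apply point_of_XY. }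
    assert (G1 : gamma (side i * X_of b e (side i) (psi t1)) = psi t1).
    { rewrite <- (point_of_axis b e (side i)). rewrite <- Y1. now apply point_of_XY. }
    exists (side i * X_of b e (side i) (psi t0)), (side i * X_of b e (side i) (psi t1)).
    split; [now symmetry|]. split; [now symmetry|].
    split. { rewrite <- Rmult_assoc, E. lra. }
    split. { rewrite <- Rmult_assoc, E. lra. }
    split. { intros t Ht'. specialize (HK t Ht'). cbv beta in HK.
    now rewrite plane_integral_XY, integral_XY_axis in HK. }
    intros z Hz Hn Hk.
    destruct (Hcov (X_of b e (side i) z) (Y_of b e (side i) z)) as (t & Htt & EX & EY).
    now apply in_zone_Y_of. now rewrite sq_radius_ep. now rewrite plane_integral_XY, integral_XY_axis.
    exists t. split; auto. rewrite <- (point_of_XY b e (side i) (psi t)),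
        <- (point_of_XY b e (side i) z) by auto.
    now rewrite EX, EY.
Qed.

(** * The normalised integral on the line *)

(** The slope of the normalised integral on the line has its second zero at [- 1 / s]
    and its third pole, where the line meets [1 - A u - B v = 0], at [- 1 / t]. *)
Definition s_of (b e : R) : R := 12 * (3 * e - 7 * b + 4 * k_of b e) / basis_det b e.
Definition t_of (b e : R) : R := - (3 * A_of b e + 4 * B_of b e).

(** The logarithmic derivatives of [x], [y] and [1 - A u - B v] along the line add up to
    a fraction whose numerator vanishes at 0, the equilibrium. *)
Lemma level_function m b e : 1 <= m -> good m b e -> Rabs (t_of b e) <= 10 ->
  level_of (s_of b e) (t_of b e) (sigma_level b e).
Proof.
  intros Hm Hg Ht x Hx. destruct (good_nonzero m b e Hm Hg) as (He & Ho & HN).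
  assert (Htx : Rabs (t_of b e * x) <= / 10) by (replace (/ 10) with (10 * / 100) by lra;
      now apply Rabs_le_mult).
  apply Rabs_le_between in Hx. apply Rabs_le_between in Htx.
  unfold sigma_level, plane_integral, integral_uv, gamma. simpl.
  assert (HNo : N_of b e * basis_det b e <> 0) by (apply Rmult_integral_contrapositive_currified; lra).
  eapply is_derive_eq.
  { auto_derive. 2: reflexivity. repeat split; try lra. unfold t_of in Htx. lra. }
  apply Rminus_diag_uniq.
  set (tt := t_of b e) in *.
  replace (1 + - (A_of b e * (1 + 3 * x + - (1))) + - (B_of b e * (1 + 4 * x + - (1)))) with (1 +
      tt * x) by (unfold tt, t_of; ring).
  unfold slope.
  assert (E1 : 3 * A_of b e * (4 + tt) + 4 * B_of b e * (3 + tt) + 7 * tt = N_of b e * basis_det b e).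
  { unfold tt, t_of, N_of, basis_det, A_of, B_of, k_of. field. lra. }
  assert (E2 : 12 * tt * (A_of b e + B_of b e + 1) = N_of b e * basis_det b e * s_of b e).
  { unfold s_of. transitivity (N_of b e * (12 * (3 * e - 7 * b + 4 * k_of b e))).
    unfold tt, t_of, N_of, A_of, B_of, k_of. field. lra. field. lra. }
  assert (E3 : 3 * A_of b e * ((1 + 4 * x) * (1 + tt * x)) + 4 * B_of b e * ((1 + 3 * x) * (1 + tt * x))
     + tt * ((1 + 3 * x) * (1 + 4 * x)) = N_of b e * basis_det b e * (x * (1 + s_of b e * x))).
  { transitivity (x * (3 * A_of b e * (4 + tt) + 4 * B_of b e * (3 + tt) + 7 * tt)
       + x * x * (12 * tt * (A_of b e + B_of b e + 1)) + (tt + 3 * A_of b e + 4 * B_of b e)). ring.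
    rewrite E1, E2. unfold tt at 1, t_of. ring. }
  transitivity ((3 * A_of b e * ((1 + 4 * x) * (1 + tt * x)) + 4 * B_of b e * ((1 + 3 * x) * (1 + tt * x))
     + tt * ((1 + 3 * x) * (1 + 4 * x))) / ((1 + 3 * x) * (1 + 4 * x) * (1 + tt * x)) / (N_of b e *
         basis_det b e)
     - x * (1 + s_of b e * x) / ((1 + 3 * x) * (1 + 4 * x) * (1 + tt * x))).
  { replace (- (A_of b e * (3 * 1)) + - (B_of b e * (4 * 1))) with tt by (unfold tt, t_of; ring).
    field. repeat split; lra. }
  rewrite E3. field. repeat split; lra.
Qed.

Lemma slope_sign s t x : Rabs s <= 10 -> Rabs t <= 10 -> Rabs x <= / 1000 ->
  (0 < x -> 0 < slope s t x) /\ (x < 0 -> slope s t x < 0).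
Proof.
  intros Hs Ht Hx.
  assert (Hsx : Rabs (s * x) <= / 100) by (replace (/ 100) with (10 * / 1000) by lra; now apply Rabs_le_mult).
  assert (Htx : Rabs (t * x) <= / 100) by (replace (/ 100) with (10 * / 1000) by lra; now apply Rabs_le_mult).
  apply Rabs_le_between in Hx. apply Rabs_le_between in Hsx. apply Rabs_le_between in Htx.
  unfold slope, Rdiv. rewrite Rmult_assoc.
  assert (Hp : 0 < (1 + s * x) * / ((1 + 3 * x) * (1 + 4 * x) * (1 + t * x))).
  { apply Rdiv_lt_0_compat. lra. repeat apply Rmult_lt_0_compat; lra. }
  split; intros H; nra.
Qed.

Lemma level_monotone s t G : Rabs s <= 10 -> Rabs t <= 10 -> level_of s t G ->
  (forall x y, 0 <= x -> x < y -> y <= / 1000 -> G x < G y) /\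
  (forall x y, - / 1000 <= x -> x < y -> y <= 0 -> G y < G x).
Proof.
  intros Hs Ht HG. split; intros x y Hx Hxy Hy.
  - destruct (mvt G (slope s t) x y Hxy) as (c & Hc & Heq).
    intros z Hz. apply HG. apply Rabs_le. lra.
    destruct (slope_sign s t c Hs Ht) as [Hp _]. apply Rabs_le; lra. specialize (Hp ltac:(lra)). nra.
  - destruct (mvt G (slope s t) x y Hxy) as (c & Hc & Heq).
    intros z Hz. apply HG. apply Rabs_le. lra.
    destruct (slope_sign s t c Hs Ht) as [_ Hp]. apply Rabs_le; lra. specialize (Hp ltac:(lra)). nra.
Qed.

Lemma level_injective s t G : Rabs s <= 10 -> Rabs t <= 10 -> level_of s t G ->
  (forall x y, 0 <= x <= / 1000 -> 0 <= y <= / 1000 -> G x = G y -> x = y) /\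
  (forall x y, - / 1000 <= x <= 0 -> - / 1000 <= y <= 0 -> G x = G y -> x = y).
Proof.
  intros Hs Ht HG. destruct (level_monotone s t G Hs Ht HG) as [H1 H2].
  split; intros x y Hx Hy E; destruct (Rtotal_order x y) as [H|[H|H]]; auto; exfalso.
  - pose proof (H1 x y). lra.
  - pose proof (H1 y x). lra.
  - pose proof (H2 x y). lra.
  - pose proof (H2 y x). lra.
Qed.

(** The disc of the zone coordinates lies in a given neighbourhood of [(1, 1)],
    uniformly in the parameters. *)
Lemma small_in_nbhd m (U : R * R -> Prop) : 1 <= m -> locally (1, 1) U ->
  exists d, 0 < d /\ forall b e z, good m b e -> sq_radius b e z <= d ^ 2 -> U z.
Proof.
  intros Hm (eps & HU). destruct (coefficient_bounds m Hm) as (B & HB & Hbd).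
  exists (eps / (2 * (4 + B))). pose proof (cond_pos eps) as He.
  split. apply Rdiv_lt_0_compat; lra.
  intros b e z Hg Hz. destruct (good_nonzero m b e Hm Hg) as (He0 & Ho & _).
  destruct (Hbd b e Hg) as (_ & _ & _ & Rp & Rq & _).
  set (d := eps / (2 * (4 + B))) in *. assert (Hd : 0 < d) by (apply Rdiv_lt_0_compat; lra).
  assert (Hed : (4 + B) * d < eps).
  { replace ((4 + B) * d) with (eps / 2) by (unfold d; field; lra). lra. }
  unfold sq_radius in Hz. set (X := X_of b e 1 z) in *. set (Y := Y_of b e 1 z) in *.
  assert (RX : Rabs X <= d) by (apply Rabs_le; clear - Hz Hd; nra).
  assert (RY : Rabs Y <= d) by (apply Rabs_le; clear - Hz Hd; nra).
  assert (R3 : Rabs 3 <= 3) by (rewrite Rabs_pos_eq; lra).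
  assert (R4 : Rabs 4 <= 4) by (rewrite Rabs_pos_eq; lra).
  assert (R1 : Rabs 1 <= 1) by (rewrite Rabs_R1; lra).
  apply HU. destruct z as [x y]. split; simpl.
  - change (Rabs (x - 1) < eps). pose proof (u_of_XY b e 1 (x, y) Ho ltac:(ring)) as E. simpl in E.
  rewrite <- E.
    fold X Y. apply Rle_lt_trans with (1 * (3 * d + B * d)). unfold u_of. bound_abs. lra.
  - change (Rabs (y - 1) < eps). pose proof (v_of_XY b e 1 (x, y) Ho ltac:(ring)) as E. simpl in E.
  rewrite <- E.
    fold X Y. apply Rle_lt_trans with (1 * (4 * d + B * d)). unfold v_of. bound_abs. lra.
Qed.

(** * The weak focus *)

Definition pw_centers (bf ef : zone -> R) : piecewise_field := fun i => center_field (bf i) (ef i).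

(** The bounds 10 on [s] and [t] are those under which the series of the involution was
    majorised. *)
Record setup (m R0 : R) (bf ef : zone -> R) : Prop := {
  su_m : 1 <= m;
  su_R : zone_radius m R0;
  su_g : forall i, good m (bf i) (ef i);
  su_s : forall i, Rabs (s_of (bf i) (ef i)) <= 10;
  su_t : forall i, Rabs (t_of (bf i) (ef i)) <= 10
}.
Arguments su_m {m R0 bf ef}.
Arguments su_R {m R0 bf ef}.
Arguments su_g {m R0 bf ef}.
Arguments su_s {m R0 bf ef}.
Arguments su_t {m R0 bf ef}.
Definition zone_s (bf ef : zone -> R) i := s_of (bf i) (ef i).
Definition zone_t (bf ef : zone -> R) i := t_of (bf i) (ef i).
Definition zone_level (bf ef : zone -> R) i := sigma_level (bf i) (ef i).

Lemma su_level m R0 bf ef i : setup m R0 bf ef ->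
    level_of (zone_s bf ef i) (zone_t bf ef i) (zone_level bf ef i).
Proof. intros H. apply (level_function m); apply H. Qed.

(** The endpoint of the half turn is on the level of its start, on the other side, and
    the integral is monotone on each side: the half-return map is the involution. *)
Lemma half_turn_zone1 m R0 bf ef r : setup m R0 bf ef -> 0 < r -> r < R0 / 5 -> r <= rmax ->
  exists T phi, 0 < T /\ phi 0 = gamma r /\ phi T = gamma (invol (zone_s bf ef zone1) (zone_t bf ef
      zone1) r) /\
    (forall t, is_solution_at (pw_centers bf ef zone1) phi t) /\
    (forall t, 0 < t < T -> in_zone zone1 (phi t)) /\
    (forall t, 0 < sq_radius (bf zone1) (ef zone1) (phi t) <= 25 * r ^ 2) /\
    (forall t, plane_integral (bf zone1) (ef zone1) (phi t) = zone_level bf ef zone1 r).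
Proof.
  intros H Hr0 HrR Hr.
  destruct (zone_half_turn m R0 zone1 (bf zone1) (ef zone1) r) as (T & phi & x1 & HT & P0 & PT &
      Hx1 & Hx1' & HG & Hs & Hz & Hn & HK);
    try apply H; auto.
  simpl in *. rewrite !Rmult_1_l in *.
  exists T, phi. split; [exact HT|]. split; [exact P0|]. split.
  { rewrite PT. f_equal.
    pose proof (invol_bounds (zone_s bf ef zone1) (zone_t bf ef zone1) r (su_s H _) (su_t H _)
        (conj Hr0 Hr)) as [Hb _].
    unfold rmax in Hr.
    destruct (level_injective _ _ _ (su_s H zone1) (su_t H zone1) (su_level m R0 bf ef zone1 H)) as [_ Hinj].
    apply Hinj; try lra. rewrite level_invariant; auto; try apply H. now apply (su_level m R0).
    unfold rmax; lra. }
  split; [exact Hs|]. split; [exact Hz|]. split; [exact Hn|]. exact HK.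
Qed.

(** Since the involution sends positive points to negative ones, the half turn through
    zone 2 that ends at [r > 0] starts at its image. *)
Lemma half_turn_zone2 m R0 bf ef r : setup m R0 bf ef -> 0 < r -> 2 * r < R0 / 5 -> r <= rmax ->
  exists T phi, 0 < T /\ phi 0 = gamma (invol (zone_s bf ef zone2) (zone_t bf ef zone2) r) /\
      phi T = gamma r /\
    (forall t, is_solution_at (pw_centers bf ef zone2) phi t) /\
    (forall t, 0 < t < T -> in_zone zone2 (phi t)) /\
    (forall t, 0 < sq_radius (bf zone2) (ef zone2) (phi t) <= 100 * r ^ 2) /\
    (forall t, plane_integral (bf zone2) (ef zone2) (phi t) = zone_level bf ef zone2 r).
Proof.
  intros H Hr0 HrR Hr.
  pose proof (invol_bounds (zone_s bf ef zone2) (zone_t bf ef zone2) r (su_s H _) (su_t H _) (conj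
      Hr0 Hr)) as [Hb _].
  set (z := invol (zone_s bf ef zone2) (zone_t bf ef zone2) r) in *.
  destruct (zone_half_turn m R0 zone2 (bf zone2) (ef zone2) (- z)) as (T & phi & x1 & HT & P0 & PT
      & Hx1 & Hx1' & HG & Hs & Hz & Hn & HK);
    try apply H; auto. lra.
  simpl in *.
  replace (-1 * - z) with z in * by ring.
  assert (Hinv : zone_level bf ef zone2 z = zone_level bf ef zone2 r).
  { apply level_invariant; try apply H. now apply (su_level m R0). lra. }
  exists T, phi. split; [exact HT|]. split; [exact P0|]. split.
  { rewrite PT. f_equal. unfold rmax in Hr.
    destruct (level_injective _ _ _ (su_s H zone2) (su_t H zone2) (su_level m R0 bf ef zone2 H)) as [Hinj _].
    apply Hinj; try lra. rewrite <- Hinv. exact HG. }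
  split; [exact Hs|]. split; [exact Hz|]. split.
  { intros t. specialize (Hn t). split. apply Hn. eapply Rle_trans. apply Hn. clear - Hb Hr0. nra. }
  intros t. rewrite HK. exact Hinv.
Qed.

Lemma linear_coordinate_gamma : linear_coordinate (1, 1) gamma.
Proof.
  exists (3, 4). split. intros E. injection E. lra.
  intros rho. split; [|apply gamma_sigma]. unfold gamma. simpl. f_equal; ring.
Qed.

Lemma Rmin3_lt a b c x : x < Rmin a (Rmin b c) -> x < a /\ x < b /\ x < c.
Proof.
  intros H. pose proof (Rmin_l a (Rmin b c)). pose proof (Rmin_r a (Rmin b c)).
  pose proof (Rmin_l b c). pose proof (Rmin_r b c). lra.
Qed.

Lemma rmax_pos : 0 < rmax. Proof. unfold rmax. lra. Qed.

Lemma half_return_intro (Z : piecewise_field) i (U : R * R -> Prop) z w T phi : 0 < T ->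
    phi 0 = z -> phi T = w ->
  (forall t, is_solution_at (Z i) phi t) -> (forall t, 0 < t < T -> in_zone i (phi t)) ->
  (forall t, U (phi t)) -> half_return Z i U z w.
Proof. intros. exists T, phi. repeat split; auto; apply H2. Qed.

Lemma focus_monodromic m R0 bf ef : setup m R0 bf ef ->
    monodromic_equilibrium (pw_centers bf ef) (1, 1) gamma.
Proof.
  intros H. pose proof (su_m H) as Hm. destruct (su_R H) as (HR & _).
  split. { unfold on_sigma, h. simpl. ring. }
  split. { intros i. unfold pw_centers, center_field. simpl. f_equal; ring. }
  intros U HU. destruct (small_in_nbhd m U Hm HU) as (d & Hd & Hin).
  exists (Rmin (R0 / 5) (Rmin rmax (d / 5))).
  pose proof rmax_pos. split. repeat apply Rmin_glb_lt; lra.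
  intros r [Hr0 Hr]. apply Rmin3_lt in Hr. destruct Hr as (Hr1 & Hr2 & Hr3).
  split.
  - destruct (zone_half_turn m R0 zone1 (bf zone1) (ef zone1) r) as (T & phi & x1 & HT & P0 & PT &
      Hx1 & Hx1' & HG & Hs & Hz & Hn & HK);
      try apply H; auto.
    simpl in *. rewrite !Rmult_1_l in *.
    exists x1. split; auto. apply half_return_intro with T phi; auto.
    intros t. apply (Hin (bf zone1) (ef zone1)). apply H. eapply Rle_trans. apply Hn. nra.
  - destruct (zone_half_turn m R0 zone2 (bf zone2) (ef zone2) r) as (T & phi & x1 & HT & P0 & PT &
      Hx1 & Hx1' & HG & Hs & Hz & Hn & HK);
      try apply H; auto.
    simpl in *. replace (-1 * r) with (- r) in * by ring.
    exists (-1 * x1). split. lra. apply half_return_intro with T phi; auto.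
    intros t. apply (Hin (bf zone2) (ef zone2)). apply H. eapply Rle_trans. apply Hn. nra.
Qed.

(** The difference map is [sigma2 - sigma1], a power series whose order is given by
    [order_eight]. *)
Lemma weak_focus_eight m R0 bf ef : setup m R0 bf ef ->
  let s1 := zone_s bf ef zone1 in let t1 := zone_t bf ef zone1 in
  let s2 := zone_s bf ef zone2 in let t2 := zone_t bf ef zone2 in
  kappa2 s1 t1 = 0 -> kappa3 s1 t1 <> 0 ->
  s2 = - (t1 + kappa1 s1 t1) -> t2 = - (s1 + kappa1 s1 t1) -> cross s1 t1 s2 t2 <> 0 ->
  weak_focus (pw_centers bf ef) (1, 1) 8.
Proof.
  intros H s1 t1 s2 t2 K2 K3 E1 E2 Hb. destruct (su_R H) as (HR & _).
  pose proof (su_s H zone1) as Bs1. pose proof (su_t H zone1) as Bt1.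
  pose proof (su_s H zone2) as Bs2. pose proof (su_t H zone2) as Bt2.
  exists gamma. split. apply linear_coordinate_gamma. split. now apply (focus_monodromic m R0).
  exists (diff_ser s1 t1 s2 t2).
  destruct (order_eight s1 t1 s2 t2 (zone_level bf ef zone2)) as [W0 W8]; auto. now apply (su_level m R0).
  split; [|split; auto].
  - split. now apply diff_ser_radius.
    exists (Rmin (R0 / 10) (Rmin rmax rmax)). pose proof rmax_pos. split. repeat apply Rmin_glb_lt; lra.
    intros r [Hr0 Hr]. apply Rmin3_lt in Hr. destruct Hr as (Hr1 & Hr2 & _).
    pose proof (invol_bounds s1 t1 r Bs1 Bt1 ltac:(lra)) as [Z1 _].
    pose proof (invol_bounds s2 t2 r Bs2 Bt2 ltac:(lra)) as [Z2 _].
    exists (invol s1 t1 r), (invol s2 t2 r). split. lra. split. lra.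
    destruct (half_turn_zone1 m R0 bf ef r) as (T & phi & HT & P0 & PT & Hs & Hz & _); auto; try lra.
    destruct (half_turn_zone2 m R0 bf ef r) as (T2 & phi2 & HT2 & P02 & PT2 & Hs2 & Hz2 & _); auto; try lra.
    split. { apply half_return_intro with T phi; auto. intros; exact I. }
    split. { apply half_return_intro with T2 phi2; auto. intros; exact I. }
    apply diff_ser_correct; auto. apply small_in_disc. lra.
  - intros j Hj. apply W0. lia.
Qed.

(** * Periodic concatenation of two arcs *)

(** [Int_part] counts the turns; at the junctions the two arcs agree, so that either
    formula may be used there ([wrap_base]). *)
Definition wrap (a b : R -> R * R) (T1 T2 t : R) : R * R :=
  let T := T1 + T2 in
  let s := t - T * IZR (Int_part (t / T)) in
  if Rle_dec s T1 then a s else b (s - T1).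

Lemma wrap_periodic a b T1 T2 t : 0 < T1 -> 0 < T2 -> wrap a b T1 T2 (t + (T1 + T2)) = wrap a b T1 T2 t.
Proof.
  intros H1 H2. unfold wrap. set (T := T1 + T2).
  assert (HT : 0 < T) by (unfold T; lra).
  assert (E : Int_part ((t + T) / T) = (Int_part (t / T) + 1)%Z).
  { symmetry. apply Int_part_spec. rewrite plus_IZR.
    destruct (base_Int_part (t / T)) as [B1 B2].
    replace ((t + T) / T) with (t / T + 1) by (field; lra). lra. }
  rewrite E, plus_IZR.
  replace (t + T - T * (IZR (Int_part (t / T)) + 1)) with (t - T * IZR (Int_part (t / T))) by ring.
  reflexivity.
Qed.

Lemma wrap_base a b T1 T2 n t : 0 < T1 -> 0 < T2 -> a T1 = b 0 -> b T2 = a 0 ->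
  let s := t - (T1 + T2) * IZR n in
  (0 <= s <= T1 -> wrap a b T1 T2 t = a s) /\
  (0 <= s - T1 <= T2 -> wrap a b T1 T2 t = b (s - T1)).
Proof.
  intros H1 H2 E1 E2 s. set (T := T1 + T2). assert (HT : 0 < T) by (unfold T; lra).
  assert (Hn : 0 <= s < T -> Int_part (t / T) = n).
  { intros Hs. symmetry. apply Int_part_spec.
    assert (Es : t / T = IZR n + s / T) by (unfold s; fold T; field; lra).
    assert (0 <= s / T < 1).
    { split. apply Rdiv_le_0_compat; lra. apply Rmult_lt_reg_r with T; auto. unfold Rdiv.
      rewrite Rmult_assoc, Rinv_l by lra. lra. }
    lra. }
  split; intros Hs.
  - unfold wrap. fold T. rewrite Hn by (unfold T; lra). fold T in s. fold s.
    destruct (Rle_dec s T1); [reflexivity|lra].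
  - destruct (Req_dec s T) as [Es|Es].
    + assert (Et : t = T * IZR (n + 1)) by (rewrite plus_IZR; unfold s in Es; fold T in Es; lra).
      unfold wrap. fold T.
      replace (Int_part (t / T)) with (n + 1)%Z.
      2:{ apply Int_part_spec. rewrite Et. replace (T * IZR (n + 1) / T) with (IZR (n + 1)) by
          (field; lra). lra. }
      rewrite <- Et. rewrite Rminus_diag. destruct (Rle_dec 0 T1); [|lra].
      rewrite Es. unfold T. replace (T1 + T2 - T1) with T2 by ring. now symmetry.
    + unfold wrap. fold T. rewrite Hn by (unfold T in *; lra). fold T in s. fold s.
      destruct (Rle_dec s T1) as [Hle|Hle]; auto.
      assert (E : s = T1) by lra. rewrite E, Rminus_diag. exact E1.
Qed.

(** Continuity and the differential equation are local properties; they are checked in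
    each of these four forms. *)
Lemma wrap_cases a b T1 T2 t : 0 < T1 -> 0 < T2 -> a T1 = b 0 -> b T2 = a 0 ->
  let f := wrap a b T1 T2 in
  (exists c, 0 < t - c < T1 /\ forall s, 0 <= s - c <= T1 -> f s = a (s - c)) \/
  (exists c, 0 < t - c < T2 /\ forall s, 0 <= s - c <= T2 -> f s = b (s - c)) \/
  ((forall s, t - T1 <= s <= t -> f s = a (T1 + (s - t))) /\ (forall s, t <= s <= t + T2 ->
      f s = b (s - t))) \/
  ((forall s, t - T2 <= s <= t -> f s = b (T2 + (s - t))) /\ (forall s, t <= s <= t + T1 -> f s = a (s - t))).
Proof.
  intros H1 H2 E1 E2 f. set (T := T1 + T2). assert (HT : 0 < T) by (unfold T; lra).
  set (n := Int_part (t / T)). set (c := T * IZR n).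
  assert (Hc : 0 <= t - c < T).
  { destruct (base_Int_part (t / T)) as [B1 B2]. fold n in B1, B2. unfold c.
    assert (Et : t = T * (t / T)) by (field; lra). split.
    - rewrite Et. assert (T * IZR n <= T * (t / T)) by (apply Rmult_le_compat_l; lra). lra.
    - rewrite Et at 1. assert (T * (t / T) < T * (IZR n + 1)) by (apply Rmult_lt_compat_l; lra). lra. }
  assert (HA : forall s, 0 <= s - c <= T1 -> f s = a (s - c)) by (intros s Hs;
      now apply (wrap_base a b T1 T2 n s)).
  assert (HB : forall s, 0 <= s - c - T1 <= T2 -> f s = b (s - c - T1)) by (intros s Hs;
      now apply (wrap_base a b T1 T2 n s)).
  destruct (Rtotal_order (t - c) T1) as [Hlt|[Heq|Hgt]].
  - destruct (Req_dec (t - c) 0) as [E0|E0].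
    + right; right; right. assert (Ec : t = c) by lra. split.
      * intros s Hs.
        assert (Hm : IZR (n - 1) = IZR n - 1) by (rewrite minus_IZR; reflexivity).
        assert (Es : s - T * IZR (n - 1) - T1 = T2 + (s - t)) by (rewrite Hm, Ec; unfold c, T; ring).
        rewrite <- Es. apply (wrap_base a b T1 T2 (n - 1) s H1 H2 E1 E2). fold T. lra.
      * intros s Hs. rewrite Ec. apply HA. lra.
    + left. exists c. split. lra. exact HA.
  - right; right; left. split.
    + intros s Hs. replace (T1 + (s - t)) with (s - c) by lra. apply HA. lra.
    + intros s Hs. replace (s - t) with (s - c - T1) by lra. apply HB. lra.
  - right; left. exists (c + T1). split. unfold T in Hc. lra.
    intros s Hs. replace (s - (c + T1)) with (s - c - T1) by ring. apply HB. lra.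
Qed.

Lemma continuous_glue (f a b : R -> R * R) t d : 0 < d -> continuous a t -> continuous b t ->
  (forall s, t - d <= s <= t -> f s = a s) -> (forall s, t <= s <= t + d -> f s = b s) -> continuous f t.
Proof.
  intros Hd Ha Hb Fa Fb P HP.
  assert (Ea : f t = a t) by (apply Fa; lra). assert (Eb : f t = b t) by (apply Fb; lra).
  rewrite Ea in HP. destruct (Ha P HP) as (d1 & H1). rewrite <- Ea, Eb in HP. destruct (Hb P HP) as (d2 & H2).
  assert (Hm : 0 < Rmin d (Rmin d1 d2)) by (repeat apply Rmin_glb_lt; auto; apply cond_pos).
  exists (mkposreal _ Hm). intros s Hs. change (Rabs (s - t) < Rmin d (Rmin d1 d2)) in Hs.
  pose proof (Rmin_l d (Rmin d1 d2)). pose proof (Rmin_r d (Rmin d1 d2)).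
  pose proof (Rmin_l d1 d2). pose proof (Rmin_r d1 d2).
  assert (Hs1 : ball t d1 s) by (change (Rabs (s - t) < d1); lra).
  assert (Hs2 : ball t d2 s) by (change (Rabs (s - t) < d2); lra).
  assert (Hs3 := Rabs_def2 _ _ Hs).
  destruct (Rle_dec s t) as [Hle|Hle].
  - rewrite Fa by lra. now apply H1.
  - rewrite Fb by lra. now apply H2.
Qed.

Lemma continuous_shift (a : R -> R * R) c t : continuous a (t + c) -> continuous (fun s => a (s + c)) t.
Proof.
  intros H. apply (continuous_comp (fun s => s + c) a); auto.
  apply (continuous_plus (K := R_AbsRing) (fun s => s) (fun _ => c)). apply continuous_id.
  apply continuous_const.
Qed.

Lemma continuous_local (f a : R -> R * R) c t d1 d2 : d1 < t < d2 -> continuous a (t + c) ->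
  (forall s, d1 <= s <= d2 -> f s = a (s + c)) -> continuous f t.
Proof.
  intros Ht Ha Hf.
  apply (continuous_glue f (fun s => a (s + c)) (fun s => a (s + c)) t (Rmin (t - d1) (d2 - t))).
  apply Rmin_glb_lt; lra. now apply continuous_shift. now apply continuous_shift.
  intros s Hs. apply Hf. pose proof (Rmin_l (t - d1) (d2 - t)). pose proof (Rmin_r (t - d1) (d2 - t)). lra.
  intros s Hs. apply Hf. pose proof (Rmin_l (t - d1) (d2 - t)). pose proof (Rmin_r (t - d1) (d2 - t)). lra.
Qed.

Lemma wrap_continuous a b T1 T2 t : 0 < T1 -> 0 < T2 -> a T1 = b 0 -> b T2 = a 0 ->
  (forall t, continuous a t) -> (forall t, continuous b t) -> continuous (wrap a b T1 T2) t.
Proof.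
  intros H1 H2 E1 E2 Ca Cb.
  destruct (wrap_cases a b T1 T2 t H1 H2 E1 E2) as [(c & Hc & Hf)|[(c & Hc & Hf)|[[Hl Hr]|[Hl Hr]]]].
  - apply (continuous_local _ a (- c) t c (c + T1)); auto. lra. intros s Hs. rewrite Hf by lra. f_equal.
  - apply (continuous_local _ b (- c) t c (c + T2)); auto. lra. intros s Hs. rewrite Hf by lra. f_equal.
  - apply (continuous_glue _ (fun s => a (s + (T1 - t))) (fun s => b (s + - t)) t (Rmin T1 T2)).
    apply Rmin_glb_lt; auto. apply continuous_shift, Ca. apply continuous_shift, Cb.
    intros s Hs. pose proof (Rmin_l T1 T2). rewrite Hl by lra. f_equal. ring.
    intros s Hs. pose proof (Rmin_r T1 T2). rewrite Hr by lra. f_equal.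
  - apply (continuous_glue _ (fun s => b (s + (T2 - t))) (fun s => a (s + - t)) t (Rmin T1 T2)).
    apply Rmin_glb_lt; auto. apply continuous_shift, Cb. apply continuous_shift, Ca.
    intros s Hs. pose proof (Rmin_r T1 T2). rewrite Hl by lra. f_equal. ring.
    intros s Hs. pose proof (Rmin_l T1 T2). rewrite Hr by lra. f_equal.
Qed.

(** * Crossing periodic orbits from zeros of the displacement function *)

Lemma sup_attained (P : R -> Prop) t0 b : P t0 -> t0 <= b ->
  (forall t, ~ P t -> exists d, 0 < d /\ forall s, Rabs (s - t) < d -> ~ P s) ->
  exists t1, t0 <= t1 <= b /\ P t1 /\ forall s, t1 < s <= b -> ~ P s.
Proof.
  intros H0 Hb Hcl.
  destruct (completeness (fun t => t0 <= t <= b /\ P t)) as (t1 & Hub & Hlub).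
  - exists b. intros x Hx. lra.
  - exists t0. split; auto. lra.
  - exists t1.
    assert (Ht0 : t0 <= t1) by (apply Hub; split; auto; lra).
    assert (Ht1 : t1 <= b) by (apply Hlub; intros x Hx; lra).
    split. lra. split.
    + destruct (Classical_Prop.classic (P t1)) as [|HN]; auto. exfalso.
      destruct (Hcl t1 HN) as (d & Hd & Hs).
      assert (t1 <= t1 - d); [|lra].
      apply Hlub. intros x [Hx Px]. destruct (Rle_dec x (t1 - d)) as [|Hgt]; auto. exfalso.
      assert (x <= t1) by (apply Hub; split; auto).
      apply (Hs x); auto. rewrite Rabs_left1; lra.
    + intros s Hs HP. assert (s <= t1) by (apply Hub; split; auto; lra). lra.
Qed.

Lemma solution_continuous F phi t : is_solution_at F phi t -> continuous phi t.
Proof.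
  intros [H1 H2].
  assert (C1 : continuous (fun s => fst (phi s)) t) by (apply (ex_derive_continuous (fun s => fst
      (phi s))); eexists; exact H1).
  assert (C2 : continuous (fun s => snd (phi s)) t) by (apply (ex_derive_continuous (fun s => snd
      (phi s))); eexists; exact H2).
  intros P (eps & HP).
  destruct (C1 (fun y => ball (fst (phi t)) eps y)) as (d1 & H3). now exists eps.
  destruct (C2 (fun y => ball (snd (phi t)) eps y)) as (d2 & H4). now exists eps.
  assert (Hm : 0 < Rmin d1 d2) by (apply Rmin_glb_lt; apply cond_pos).
  exists (mkposreal _ Hm). intros s Hs. change (Rabs (s - t) < Rmin d1 d2) in Hs.
  pose proof (Rmin_l d1 d2). pose proof (Rmin_r d1 d2).
  apply HP. split.
  - apply H3. change (Rabs (s - t) < d1). lra.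
  - apply H4. change (Rabs (s - t) < d2). lra.
Qed.

Lemma is_derive_shift (F : R -> R) (c t l : R) : is_derive F (t + c) l -> is_derive (fun s => F (s + c)) t l.
Proof.
  intros H. apply is_derive_eq with (1 * l); [|ring].
  apply (is_derive_comp F (fun s => s + c)). exact H. auto_derive; auto; ring.
Qed.

Lemma solution_local F phi a c t d1 d2 : d1 < t < d2 -> is_solution_at F a (t + c) ->
  (forall s, d1 <= s <= d2 -> phi s = a (s + c)) -> is_solution_at F phi t.
Proof.
  intros Ht [H1 H2] He.
  assert (Hloc : locally t (fun s => a (s + c) = phi s)).
  { assert (Hm : 0 < Rmin (t - d1) (d2 - t)) by (apply Rmin_glb_lt; lra).
    exists (mkposreal _ Hm). intros s Hs. change (Rabs (s - t) < Rmin (t - d1) (d2 - t)) in Hs.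
    pose proof (Rmin_l (t - d1) (d2 - t)). pose proof (Rmin_r (t - d1) (d2 - t)).
    apply Rabs_def2 in Hs. symmetry. apply He. lra. }
  unfold is_solution_at. rewrite He by lra. split.
  - apply (is_derive_ext_loc (fun s => fst (a (s + c)))).
    apply (filter_imp (fun s => a (s + c) = phi s)); auto. intros s E; now rewrite E.
    now apply (is_derive_shift (fun s => fst (a s))).
  - apply (is_derive_ext_loc (fun s => snd (a (s + c)))).
    apply (filter_imp (fun s => a (s + c) = phi s)); auto. intros s E; now rewrite E.
    now apply (is_derive_shift (fun s => snd (a s))).
Qed.

Lemma zone_not_sigma i z : in_zone i z -> ~ on_sigma z.
Proof. unfold on_sigma. destruct i; simpl; lra. Qed.

Lemma zone_unique i j z : in_zone i z -> in_zone j z -> i = j.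
Proof. destruct i, j; simpl; intros; auto; lra. Qed.

Lemma zone_or_sigma z : on_sigma z \/ exists i, in_zone i z.
Proof.
  unfold on_sigma. destruct (Rtotal_order (h z) 0) as [H|[H|H]]; auto.
  right; now exists zone1. right; now exists zone2.
Qed.

(** The field crosses the line with a speed proportional to [x (1 + s x)], hence in the
    same direction in both zones for small [x], whatever [s] is. *)
Lemma lie_h_gamma b e x : 0 < basis_det b e ->
    lie_h (center_field b e) (gamma x) = - basis_det b e * (x * (1 + s_of b e * x)).
Proof.
  intros Ho. unfold s_of.
  transitivity (- (x * (basis_det b e + 12 * (3 * e - 7 * b + 4 * k_of b e) * x))).
  unfold lie_h, center_field, gamma, basis_det. simpl. ring. field. lra.
Qed.

Lemma crossing_gamma m R0 bf ef x : setup m R0 bf ef -> x <> 0 -> Rabs x <= / 1000 ->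
  crossing_point (pw_centers bf ef) (gamma x).
Proof.
  intros H Hx0 Hx. split. apply gamma_sigma. unfold pw_centers.
  destruct (good_nonzero m _ _ (su_m H) (su_g H zone1)) as (_ & O1 & _).
  destruct (good_nonzero m _ _ (su_m H) (su_g H zone2)) as (_ & O2 & _).
  rewrite !lie_h_gamma by auto.
  assert (Hs : forall i, 0 < 1 + s_of (bf i) (ef i) * x).
  { intros i. assert (Hb : Rabs (s_of (bf i) (ef i) * x) <= 10 * / 1000) by (apply Rabs_le_mult;
      auto; apply H).
    apply Rabs_le_between in Hb. lra. }
  pose proof (Hs zone1) as S1. pose proof (Hs zone2) as S2.
  match goal with |- 0 < ?Z => replace Z with ((x * x) * ((basis_det (bf zone1) (ef zone1) * (1 +
      s_of (bf zone1) (ef zone1) * x)) *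
     (basis_det (bf zone2) (ef zone2) * (1 + s_of (bf zone2) (ef zone2) * x)))) by ring end.
  apply Rmult_lt_0_compat. now apply Rlt_0_sqr.
  repeat apply Rmult_lt_0_compat; auto.
Qed.

(** Two half turns that fit together. The bounds keep them in the region where the
    levels and the line are controlled. *)
Record loop (bf ef : zone -> R) (r sig : R) (a b : R -> R * R) (T1 T2 : R) : Prop := {
  lp_T1 : 0 < T1; lp_T2 : 0 < T2;
  lp_a0 : a 0 = gamma r; lp_a1 : a T1 = gamma sig; lp_b0 : b 0 = gamma sig; lp_b1 : b T2 = gamma r;
  lp_sa : forall t, is_solution_at (pw_centers bf ef zone1) a t;
  lp_sb : forall t, is_solution_at (pw_centers bf ef zone2) b t;
  lp_za : forall t, 0 < t < T1 -> in_zone zone1 (a t);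
  lp_zb : forall t, 0 < t < T2 -> in_zone zone2 (b t);
  lp_na : forall t, 0 < sq_radius (bf zone1) (ef zone1) (a t) <= 100 * r ^ 2;
  lp_nb : forall t, 0 < sq_radius (bf zone2) (ef zone2) (b t) <= 100 * r ^ 2;
  lp_ka : forall t, plane_integral (bf zone1) (ef zone1) (a t) = zone_level bf ef zone1 r;
  lp_kb : forall t, plane_integral (bf zone2) (ef zone2) (b t) = zone_level bf ef zone2 r;
  lp_r : 0 < r <= / 1000; lp_sig : - / 1000 <= sig < 0
}.
Arguments lp_T1 {bf ef r sig a b T1 T2}.
Arguments lp_T2 {bf ef r sig a b T1 T2}.
Arguments lp_a0 {bf ef r sig a b T1 T2}.
Arguments lp_a1 {bf ef r sig a b T1 T2}.
Arguments lp_b0 {bf ef r sig a b T1 T2}.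
Arguments lp_b1 {bf ef r sig a b T1 T2}.
Arguments lp_sa {bf ef r sig a b T1 T2}.
Arguments lp_sb {bf ef r sig a b T1 T2}.
Arguments lp_za {bf ef r sig a b T1 T2}.
Arguments lp_zb {bf ef r sig a b T1 T2}.
Arguments lp_na {bf ef r sig a b T1 T2}.
Arguments lp_nb {bf ef r sig a b T1 T2}.
Arguments lp_ka {bf ef r sig a b T1 T2}.
Arguments lp_kb {bf ef r sig a b T1 T2}.
Arguments lp_r {bf ef r sig a b T1 T2}.
Arguments lp_sig {bf ef r sig a b T1 T2}.

(** A zero of the displacement says that [sigma1 r] is also on the level of [r] for zone
    2, hence equals [sigma2 r]; the half turns then match. *)
Lemma loop_exists m R0 bf ef r : setup m R0 bf ef -> 0 < r -> 2 * r < R0 / 5 -> r <= rmax ->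
  disp (zone_s bf ef zone1) (zone_t bf ef zone1) (zone_level bf ef zone2) r = 0 ->
  exists sig a b T1 T2, loop bf ef r sig a b T1 T2.
Proof.
  intros H Hr0 HR Hr Hd.
  pose proof (su_s H zone1) as Bs1. pose proof (su_t H zone1) as Bt1.
  pose proof (su_s H zone2) as Bs2. pose proof (su_t H zone2) as Bt2.
  fold (zone_s bf ef zone1) in Bs1. fold (zone_t bf ef zone1) in Bt1.
  fold (zone_s bf ef zone2) in Bs2. fold (zone_t bf ef zone2) in Bt2.
  pose proof (invol_bounds _ _ r Bs1 Bt1 (conj Hr0 Hr)) as [Z1 _].
  pose proof (invol_bounds _ _ r Bs2 Bt2 (conj Hr0 Hr)) as [Z2 _].
  assert (Es : invol (zone_s bf ef zone2) (zone_t bf ef zone2) r = invol (zone_s bf ef zone1)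
      (zone_t bf ef zone1) r).
  { destruct (level_injective _ _ _ Bs2 Bt2 (su_level m R0 bf ef zone2 H)) as [_ Hinj].
    unfold rmax in Hr. apply Hinj; try lra.
    unfold disp in Hd. rewrite level_invariant; auto. lra. now apply (su_level m R0). unfold rmax; lra. }
  destruct (half_turn_zone1 m R0 bf ef r H) as (T1 & a & HT1 & A0 & A1 & Sa & Za & Na & Ka); auto; try lra.
  destruct (half_turn_zone2 m R0 bf ef r H) as (T2 & b & HT2 & B0 & B1 & Sb & Zb & Nb & Kb); auto; try lra.
  exists (invol (zone_s bf ef zone1) (zone_t bf ef zone1) r), a, b, T1, T2.
  rewrite Es in B0. unfold rmax in Hr.
  split; auto; try lra. intros t. specialize (Na t). split. lra. nra.
Qed.

Lemma loop_periodic m R0 bf ef r sig a b T1 T2 : setup m R0 bf ef -> loop bf ef r sig a b T1 T2 ->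
  periodic_orbit (pw_centers bf ef) (wrap a b T1 T2).
Proof.
  intros H L. destruct L as [H1 H2 A0 A1 B0 B1 Sa Sb Za Zb Na Nb Ka Kb Hr Hs].
  assert (E1 : a T1 = b 0) by congruence. assert (E2 : b T2 = a 0) by congruence.
  assert (Ca : forall t, continuous a t) by (intros t; eapply solution_continuous, Sa).
  assert (Cb : forall t, continuous b t) by (intros t; eapply solution_continuous, Sb).
  assert (Xr : crossing_point (pw_centers bf ef) (gamma r)) by (apply (crossing_gamma m R0); auto;
      [|apply Rabs_le]; lra).
  assert (Xs : crossing_point (pw_centers bf ef) (gamma sig)) by (apply (crossing_gamma m R0);
      auto; [|apply Rabs_le]; lra).
  split; [|split].
  - intros t. split. now apply wrap_continuous.
    destruct (wrap_cases a b T1 T2 t H1 H2 E1 E2) as [(c & Hc & Hf)|[(c & Hc & Hf)|[[Hl Hrr]|[Hl Hrr]]]].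
    + assert (Hz : in_zone zone1 (wrap a b T1 T2 t)) by (rewrite Hf by lra; apply Za; lra).
      split. 2:{ intros Hsg. exfalso. now apply (zone_not_sigma zone1 _ Hz). }
      intros i Hi. rewrite <- (zone_unique _ _ _ Hz Hi).
      apply (solution_local _ _ a (- c) t c (c + T1)); auto. lra. intros s Hs'. rewrite Hf by lra. f_equal.
    + assert (Hz : in_zone zone2 (wrap a b T1 T2 t)) by (rewrite Hf by lra; apply Zb; lra).
      split. 2:{ intros Hsg. exfalso. now apply (zone_not_sigma zone2 _ Hz). }
      intros i Hi. rewrite <- (zone_unique _ _ _ Hz Hi).
      apply (solution_local _ _ b (- c) t c (c + T2)); auto. lra. intros s Hs'. rewrite Hf by lra. f_equal.
    + assert (Et : wrap a b T1 T2 t = gamma sig).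
      { rewrite Hrr by lra. rewrite Rminus_diag. exact B0. }
      split. { intros i Hi. exfalso. apply (zone_not_sigma _ _ Hi). rewrite Et. apply gamma_sigma. }
      intros _. split. now rewrite Et.
      assert (Hm : 0 < Rmin T1 T2) by (apply Rmin_glb_lt; auto).
      exists (mkposreal _ Hm). intros s Hs' Hne. change (Rabs (s - t) < Rmin T1 T2) in Hs'.
      pose proof (Rmin_l T1 T2). pose proof (Rmin_r T1 T2). apply Rabs_def2 in Hs'.
      destruct (Rlt_dec s t) as [Hlt|Hlt].
      * rewrite Hl by lra. apply (zone_not_sigma zone1), Za. lra.
      * rewrite Hrr by lra. apply (zone_not_sigma zone2), Zb. lra.
    + assert (Et : wrap a b T1 T2 t = gamma r).
      { rewrite Hrr by lra. rewrite Rminus_diag. exact A0. }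
      split. { intros i Hi. exfalso. apply (zone_not_sigma _ _ Hi). rewrite Et. apply gamma_sigma. }
      intros _. split. now rewrite Et.
      assert (Hm : 0 < Rmin T1 T2) by (apply Rmin_glb_lt; auto).
      exists (mkposreal _ Hm). intros s Hs' Hne. change (Rabs (s - t) < Rmin T1 T2) in Hs'.
      pose proof (Rmin_l T1 T2). pose proof (Rmin_r T1 T2). apply Rabs_def2 in Hs'.
      destruct (Rlt_dec s t) as [Hlt|Hlt].
      * rewrite Hl by lra. apply (zone_not_sigma zone2), Zb. lra.
      * rewrite Hrr by lra. apply (zone_not_sigma zone1), Za. lra.
  - exists (T1 + T2). split. lra. intros t. now apply wrap_periodic.
  - exists 0, T1. destruct (wrap_base a b T1 T2 0 0 H1 H2 E1 E2) as [W0 _].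
    destruct (wrap_base a b T1 T2 0 T1 H1 H2 E1 E2) as [W1 _]. simpl in W0, W1.
    rewrite W0, W1 by lra. replace (0 - (T1 + T2) * 0) with 0 by ring.
    replace (T1 - (T1 + T2) * 0) with T1 by ring.
    rewrite A0, A1. intros E. apply gamma_inj in E. lra.
Qed.

Lemma loop_orbit m R0 bf ef r sig a b T1 T2 z : setup m R0 bf ef -> loop bf ef r sig a b T1 T2 ->
  orbit (wrap a b T1 T2) z <-> (exists t, 0 <= t <= T1 /\ z = a t) \/ (exists t, 0 <= t <= T2 /\ z = b t).
Proof.
  intros H L. destruct L as [H1 H2 A0 A1 B0 B1 Sa Sb Za Zb Na Nb Ka Kb Hr Hs].
  assert (E1 : a T1 = b 0) by congruence. assert (E2 : b T2 = a 0) by congruence.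
  split.
  - intros (t & <-).
    destruct (wrap_cases a b T1 T2 t H1 H2 E1 E2) as [(c & Hc & Hf)|[(c & Hc & Hf)|[[Hl Hrr]|[Hl Hrr]]]].
    + left. exists (t - c). split. lra. apply Hf. lra.
    + right. exists (t - c). split. lra. apply Hf. lra.
    + right. exists (t - t). split. lra. apply Hrr. lra.
    + left. exists (t - t). split. lra. apply Hrr. lra.
  - intros [(t & Ht & ->)|(t & Ht & ->)].
    + exists t. destruct (wrap_base a b T1 T2 0 t H1 H2 E1 E2) as [W0 _]. simpl in W0.
      replace (t - (T1 + T2) * 0) with t in W0 by ring. now apply W0.
    + exists (T1 + t). destruct (wrap_base a b T1 T2 0 (T1 + t) H1 H2 E1 E2) as [_ W0]. simpl in W0.
      replace (T1 + t - (T1 + T2) * 0 - T1) with t in W0 by ring. now apply W0.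
Qed.

(** * Isolation of the periodic orbits *)

Definition closed_zone (i : zone) (z : R * R) : Prop :=
  match i with zone1 => h z <= 0 | zone2 => 0 <= h z end.

(** The annulus between the levels of [lo] and [hi]. On the line both conditions are
    required, so that the set is open there although the integrals of the two zones
    differ ([tube_open]). *)
Definition tube (bf ef : zone -> R) (R1 lo hi : R) (z : R * R) : Prop :=
  forall i, closed_zone i z -> sq_radius (bf i) (ef i) z < R1 ^ 2 /\
     zone_level bf ef i lo < plane_integral (bf i) (ef i) z < zone_level bf ef i hi.

Lemma continuous_sq_radius b e z : continuous (sq_radius b e) z.
Proof.
  unfold sq_radius. apply (continuous_plus (K := R_AbsRing) (fun z => X_of b e 1 z ^ 2) (fun z =>
      Y_of b e 1 z ^ 2)).
  - apply (continuous_ext (fun z => X_of b e 1 z * X_of b e 1 z)). intros; apply Rminus_diag_uniq; ring.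
    apply (continuous_mult (K := R_AbsRing) (fun z => X_of b e 1 z) (fun z => X_of b e 1 z));
      apply (continuous_X_of b e 1 (fun z => z)); apply continuous_id.
  - apply (continuous_ext (fun z => Y_of b e 1 z * Y_of b e 1 z)). intros; apply Rminus_diag_uniq; ring.
    apply (continuous_mult (K := R_AbsRing) (fun z => Y_of b e 1 z) (fun z => Y_of b e 1 z));
      apply (continuous_Y_of b e 1 (fun z => z)); apply continuous_id.
Qed.

Lemma continuous_h {T : UniformSpace} (psi : T -> R * R) t : continuous psi t ->
    continuous (fun t => h (psi t)) t.
Proof.
  intros H. eapply continuous_ext; [|apply (continuous_affine_comp psi 4 (-3) (-1) t H)].
  intros s. unfold h. apply Rminus_diag_uniq. simpl. ring.
Qed.

Lemma continuous_plane_integral m R0 b e z : 1 <= m -> zone_radius m R0 -> good m b e ->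
    sq_radius b e z < R0 ^ 2 ->
  continuous (plane_integral b e) z.
Proof.
  intros Hm (_ & _ & HZ) Hg Hn. destruct (good_nonzero m b e Hm Hg) as (_ & Ho & _).
  destruct (HZ b e 1 Hg (or_introl eq_refl)) as [Hrot _].
  apply (continuous_ext (fun z => integral_XY b e 1 (X_of b e 1 z) (Y_of b e 1 z))).
  intros w. apply plane_integral_XY; auto; ring.
  apply (continuous_comp_2 (fun z => X_of b e 1 z) (fun z => Y_of b e 1 z) (integral_XY b e 1)).
  apply (continuous_X_of b e 1 (fun z => z)), continuous_id.
  apply (continuous_Y_of b e 1 (fun z => z)), continuous_id.
  apply (rot_cK Hrot). exact Hn.
Qed.

Lemma locally_lt {T : UniformSpace} (F : T -> R) z c : continuous F z -> F z < c ->
    locally z (fun w => F w < c).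
Proof. intros HF Hc. apply (HF (fun y => y < c)). now apply open_lt. Qed.

Lemma locally_gt {T : UniformSpace} (F : T -> R) z c : continuous F z -> c < F z ->
    locally z (fun w => c < F w).
Proof. intros HF Hc. apply (HF (fun y => c < y)). now apply open_gt. Qed.

Lemma tube_open m R0 bf ef R1 lo hi : setup m R0 bf ef -> 0 < R1 <= R0 -> open (tube bf ef R1 lo hi).
Proof.
  intros H HR z Hz.
  assert (Hi : forall i, locally z (fun w => closed_zone i w -> sq_radius (bf i) (ef i) w < R1 ^ 2 /\
     zone_level bf ef i lo < plane_integral (bf i) (ef i) w < zone_level bf ef i hi)).
  { intros i.
    assert (Hcase : closed_zone i z \/ locally z (fun w => ~ closed_zone i w)).
    { assert (Hh : continuous h z) by (apply (continuous_h (fun z => z)), continuous_id).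
      destruct i; simpl.
      - destruct (Rle_dec (h z) 0) as [|Hn]; auto. right.
        apply (filter_imp (fun w => 0 < h w)). intros; lra. apply locally_gt; auto; lra.
      - destruct (Rle_dec 0 (h z)) as [|Hn]; auto. right.
        apply (filter_imp (fun w => h w < 0)). intros; lra. apply locally_lt; auto; lra. }
    destruct Hcase as [Hcl|Hn].
    2:{ apply (filter_imp (fun w => ~ closed_zone i w)); auto. intros w H1 H2. contradiction. }
    destruct (Hz i Hcl) as (H1 & H2 & H3).
    assert (HK : continuous (plane_integral (bf i) (ef i)) z).
    { apply (continuous_plane_integral m R0); try apply H.
    assert (R1 ^ 2 <= R0 ^ 2) by (apply pow_incr; lra). lra. }
    apply (filter_imp (fun w => sq_radius (bf i) (ef i) w < R1 ^ 2 /\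
        (zone_level bf ef i lo < plane_integral (bf i) (ef i) w /\
        plane_integral (bf i) (ef i) w < zone_level bf ef i hi))).
    auto. apply filter_and. apply locally_lt; auto using continuous_sq_radius.
    apply filter_and. now apply locally_gt. now apply locally_lt. }
  apply (filter_imp (fun w => (closed_zone zone1 w -> sq_radius (bf zone1) (ef zone1) w < R1 ^ 2 /\
     zone_level bf ef zone1 lo < plane_integral (bf zone1) (ef zone1) w < zone_level bf ef zone1
         hi) /\ (closed_zone zone2 w -> sq_radius (bf zone2) (ef zone2) w < R1 ^ 2 /\
     zone_level bf ef zone2 lo < plane_integral (bf zone2) (ef zone2) w < zone_level bf ef zone2 hi))).
  - intros w [W1 W2] [|]; auto.
  - apply filter_and; apply Hi.
Qed.

Record tube_setup (m R0 : R) (bf ef : zone -> R) (R1 lo hi : R) : Prop := {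
  ts_su : setup m R0 bf ef; ts_R : 0 < R1 <= R0; ts_R' : R1 <= / 1000;
  ts_lo : 0 < lo; ts_hi : lo < hi; ts_hi' : hi <= / 1000
}.
Arguments ts_su {m R0 bf ef R1 lo hi}.
Arguments ts_R {m R0 bf ef R1 lo hi}.
Arguments ts_R' {m R0 bf ef R1 lo hi}.
Arguments ts_lo {m R0 bf ef R1 lo hi}.
Arguments ts_hi {m R0 bf ef R1 lo hi}.
Arguments ts_hi' {m R0 bf ef R1 lo hi}.

Lemma ts_mono {m R0 bf ef R1 lo hi} i : tube_setup m R0 bf ef R1 lo hi ->
  (forall x y, 0 <= x -> x < y -> y <= / 1000 -> zone_level bf ef i x < zone_level bf ef i y) /\
  (forall x y, - / 1000 <= x -> x < y -> y <= 0 -> zone_level bf ef i y < zone_level bf ef i x).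
Proof.
  intros H. apply (level_monotone (zone_s bf ef i) (zone_t bf ef i)); try apply (su_level m R0); apply H.
Qed.

Lemma zone_closed i z : in_zone i z -> closed_zone i z.
Proof. destruct i; simpl; lra. Qed.

Lemma sigma_closed i z : on_sigma z -> closed_zone i z.
Proof. unfold on_sigma. destruct i; simpl; lra. Qed.

Lemma ts_basis_det {m R0 bf ef R1 lo hi} i : tube_setup m R0 bf ef R1 lo hi -> 0 < basis_det (bf i) (ef i).
Proof. intros [H _ _ _ _ _]. apply (good_nonzero m); apply H. Qed.

Lemma tube_sq_radius {m R0 bf ef R1 lo hi} i z : tube_setup m R0 bf ef R1 lo hi -> tube bf ef R1 lo hi z ->
  closed_zone i z -> 0 < sq_radius (bf i) (ef i) z < R0 ^ 2.
Proof.
  intros H HU Hc. destruct (HU i Hc) as (H1 & H2 & _).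
  pose proof (ts_R H) as HR. assert (R1 ^ 2 <= R0 ^ 2) by (apply pow_incr; lra).
  split; [|lra]. apply Rnot_le_lt. intros Hle.
  pose proof (ts_basis_det i H) as Ho.
  unfold sq_radius in Hle. set (X := X_of (bf i) (ef i) 1 z) in *. set (Y := Y_of (bf i) (ef i) 1 z) in *.
  assert (EX : X = 0) by (clear - Hle; nra). assert (EY : Y = 0) by (clear - Hle; nra).
  assert (Ez : z = gamma 0).
  { rewrite <- (point_of_XY (bf i) (ef i) 1 z Ho ltac:(ring)). fold X Y.
  rewrite EX, EY, point_of_axis. f_equal. ring. }
  rewrite Ez in H2. change (plane_integral (bf i) (ef i) (gamma 0)) with (zone_level bf ef i 0) in H2.
  destruct (ts_mono i H) as [Hm _].
  pose proof (Hm 0 lo ltac:(lra) (ts_lo H)) as Hm'.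
  pose proof (ts_hi H). pose proof (ts_hi' H). lra.
Qed.

Lemma tube_sigma {m R0 bf ef R1 lo hi} x : tube_setup m R0 bf ef R1 lo hi -> tube bf ef R1 lo hi (gamma x) ->
  x <> 0 /\ - / 1000 < x < / 1000 /\ (0 < x -> lo < x < hi).
Proof.
  intros H HU. pose proof (sigma_closed zone1 _ (gamma_sigma x)) as Hc.
  pose proof (tube_sq_radius _ _ H HU Hc) as Hn. destruct (HU zone1 Hc) as (H1 & H2 & H3).
  pose proof (ts_basis_det zone1 H) as Ho.
  rewrite sq_radius_gamma in Hn, H1 by auto. pose proof (ts_R H) as HR. pose proof (ts_R' H) as HR'.
  assert (Hx : - / 1000 < x < / 1000) by (clear - H1 HR HR'; split; nra).
  split. { intros E. rewrite E in Hn. lra. }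
  split; auto. intros Hx0.
  change (plane_integral (bf zone1) (ef zone1) (gamma x)) with (zone_level bf ef zone1 x) in H2, H3.
  destruct (ts_mono zone1 H) as [Hm _].
  destruct H. split; apply Rnot_le_lt; intros Hle.
  - destruct Hle as [Hl|E]. pose proof (Hm x lo). lra. rewrite E in H2. lra.
  - destruct Hle as [Hl|E]. pose proof (Hm hi x). lra. rewrite E in H3. lra.
Qed.

Lemma same_zone (psi : R -> R * R) i a b : (forall t, continuous psi t) ->
  (forall t, Rmin a b <= t <= Rmax a b -> ~ on_sigma (psi t)) -> in_zone i (psi a) -> in_zone i (psi b).
Proof.
  intros Hc Hn Ha.
  assert (Hh : forall t, continuity_pt (fun t => h (psi t)) t).
  { intros t. apply continuity_pt_filterlim. now apply continuous_h. }
  destruct (zone_or_sigma (psi b)) as [Hs|[j Hb]].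
  { exfalso. apply (Hn b); auto. split. apply Rmin_r. apply Rmax_r. }
  assert (Hex : i = j \/ exists t, Rmin a b <= t <= Rmax a b /\ h (psi t) = 0).
  { destruct i, j; simpl in Ha, Hb; auto; right.
    - destruct (IVT_gen (fun t => h (psi t)) a b 0) as (t & Ht & Et). exact Hh.
      rewrite Rmin_left, Rmax_right by lra. lra. now exists t.
    - destruct (IVT_gen (fun t => h (psi t)) a b 0) as (t & Ht & Et). exact Hh.
      rewrite Rmin_right, Rmax_left by lra. lra. now exists t. }
  destruct Hex as [->|(t & Ht & Et)]; auto. exfalso. now apply (Hn t).
Qed.

(** Otherwise the polar angle would increase for ever along a periodic orbit that stays
    in a half-plane. *)
Lemma no_zone_forever {m R0 bf ef R1 lo hi} psi i : tube_setup m R0 bf ef R1 lo hi ->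
  periodic_orbit (pw_centers bf ef) psi -> (forall t, tube bf ef R1 lo hi (psi t)) ->
      ~ (forall t, in_zone i (psi t)).
Proof.
  intros H (Hcs & (T & HT & Hper) & _) HU Hz.
  destruct H as [Hsu HR HR' Hlo Hhi Hhi'].
  assert (H : tube_setup m R0 bf ef R1 lo hi) by (split; auto).
  pose proof (ts_basis_det i H) as Ho.
  destruct (su_R Hsu) as (_ & _ & HZ).
  destruct (HZ (bf i) (ef i) (side i) (su_g Hsu i) (side_cases i)) as [Hrot _].
  pose proof (quotient_decreasing _ _ _ _ R0 (fun t => X_of (bf i) (ef i) (side i) (psi t)) (fun t
      => Y_of (bf i) (ef i) (side i) (psi t)) 0 T Hrot HT) as Hq.
  cbv beta in Hq. pose proof (Hper 0) as E0. rewrite Rplus_0_l in E0. rewrite E0 in Hq.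
  assert (Hlt : X_of (bf i) (ef i) (side i) (psi 0) / Y_of (bf i) (ef i) (side i) (psi 0) <
     X_of (bf i) (ef i) (side i) (psi 0) / Y_of (bf i) (ef i) (side i) (psi 0)); [|lra].
  apply Hq. intros t Ht. split; [|split].
  - apply plane_solves; auto using side_sqr. destruct (Hcs t) as (_ & Hs & _). now apply Hs.
  - now apply in_zone_Y_of.
  - rewrite sq_radius_ep by apply side_sqr. apply (tube_sq_radius _ _ H (HU t)). now apply zone_closed.
Qed.

Lemma hit_exists {m R0 bf ef R1 lo hi} psi : tube_setup m R0 bf ef R1 lo hi ->
  periodic_orbit (pw_centers bf ef) psi -> (forall t, tube bf ef R1 lo hi (psi t)) ->
      exists t, on_sigma (psi t).
Proof.
  intros H Hp HU. destruct (Classical_Prop.classic (exists t, on_sigma (psi t))) as [|Hn]; auto. exfalso.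
  destruct (zone_or_sigma (psi 0)) as [Hs|[i Hi]]. apply Hn; now exists 0.
  apply (no_zone_forever psi i H Hp HU). intros t.
  apply (same_zone psi i 0 t); auto. intros s. apply Hp. intros s _ Hs. apply Hn. now exists s.
Qed.

(** The crossing times are isolated, and periodicity brings the orbit back to the
    line. *)
Lemma next_hit {m R0 bf ef R1 lo hi} psi t0 : tube_setup m R0 bf ef R1 lo hi ->
  periodic_orbit (pw_centers bf ef) psi -> (forall t, tube bf ef R1 lo hi (psi t)) -> on_sigma (psi t0) ->
  exists t1 i, t0 < t1 /\ on_sigma (psi t1) /\ forall t, t0 < t < t1 -> in_zone i (psi t).
Proof.
  intros H Hp HU H0. assert (Hp' := Hp). destruct Hp' as (Hcs & (T & HT & Hper) & _).
  assert (Hc : forall t, continuous psi t) by (intros t; apply Hcs).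
  assert (HTs : on_sigma (psi (t0 + T))) by now rewrite Hper.
  destruct (Hcs t0) as (_ & _ & Hcr). destruct (Hcr H0) as (_ & (d & Hd)).
  assert (Hd' : forall t, t0 < t < t0 + d -> ~ on_sigma (psi t)).
  { intros t Ht. apply Hd. change (Rabs (t - t0) < d). rewrite Rabs_pos_eq; lra. lra. }
  pose proof (cond_pos d) as Hd0.
  destruct (completeness (fun s => t0 <= s <= t0 + T /\ forall t, t0 < t < s ->
      ~ on_sigma (psi t))) as (t1 & Hub & Hlub).
  { exists (t0 + T). intros s Hs. apply Hs. }
  { exists t0. split. lra. intros t Ht. lra. }
  assert (Ht1 : t1 <= t0 + T) by (apply Hlub; intros s Hs; apply Hs).
  assert (Ht0 : t0 < t1).
  { apply Rlt_le_trans with (Rmin (t0 + d) (t0 + T)). apply Rmin_glb_lt; lra.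
    apply Hub. split. split. apply Rmin_glb; lra. apply Rmin_r.
    intros t Ht. apply Hd'. pose proof (Rmin_l (t0 + d) (t0 + T)). lra. }
  assert (Hno : forall t, t0 < t < t1 -> ~ on_sigma (psi t)).
  { intros t Ht Hs. assert (t1 <= t); [|lra]. apply Hlub. intros s [Hs1 Hs2].
    apply Rnot_lt_le. intros Hlt. apply (Hs2 t); auto. lra. }
  assert (Hs1 : on_sigma (psi t1)).
  { destruct (Classical_Prop.classic (on_sigma (psi t1))) as [|Hn]; auto. exfalso.
    assert (Hlt : t1 < t0 + T). { destruct Ht1 as [|E]; auto. rewrite E in Hn. contradiction. }
    assert (Hloc : locally t1 (fun t => ~ on_sigma (psi t))).
    { unfold on_sigma in *. destruct (Rtotal_order (h (psi t1)) 0) as [Hl|[Hl|Hl]].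
      - apply (filter_imp (fun t => h (psi t) < 0)). intros; lra.
      apply (locally_lt (fun t => h (psi t))); auto. now apply continuous_h.
      - contradiction.
      - apply (filter_imp (fun t => 0 < h (psi t))). intros; lra.
      apply (locally_gt (fun t => h (psi t))); auto. now apply continuous_h. }
    destruct Hloc as (d2 & Hd2). pose proof (cond_pos d2) as Hd20.
    set (s := Rmin (t1 + d2) (t0 + T)).
    assert (Hs : t1 < s) by (unfold s; apply Rmin_glb_lt; lra).
    assert (s <= t1); [|lra]. apply Hub. split. split. lra. apply Rmin_r.
    intros t Ht. destruct (Rlt_dec t t1) as [|Hge]. apply Hno; lra.
    apply Hd2. change (Rabs (t - t1) < d2). assert (s <= t1 + d2) by apply Rmin_l. rewrite Rabs_pos_eq; lra. }
  destruct (zone_or_sigma (psi ((t0 + t1) / 2))) as [Hs|[i Hi]]. exfalso.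
  apply (Hno ((t0 + t1) / 2)); auto. lra.
  exists t1, i. split; auto. split; auto. intros t Ht.
  apply (same_zone psi i ((t0 + t1) / 2) t); auto. intros s Hs. apply Hno.
  unfold Rmin, Rmax in Hs. destruct (Rle_dec ((t0 + t1) / 2) t); lra.
Qed.

(** Between two consecutive crossings the orbit is a half turn of the zone that it
    enters, which is decided by the side of the crossing point. *)
Lemma hit_step {m R0 bf ef R1 lo hi} psi t0 r0 : tube_setup m R0 bf ef R1 lo hi ->
  periodic_orbit (pw_centers bf ef) psi -> (forall t, tube bf ef R1 lo hi (psi t)) -> psi t0 = gamma r0 ->
  exists t1 i r1, t0 < t1 /\ psi t1 = gamma r1 /\ (forall t, t0 < t < t1 -> in_zone i (psi t)) /\
    0 < side i * r0 /\ side i * r1 < 0 /\ zone_level bf ef i r1 = zone_level bf ef i r0 /\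
    (forall t, t0 <= t <= t1 -> plane_integral (bf i) (ef i) (psi t) = zone_level bf ef i r0) /\
    (forall z, in_zone i z -> sq_radius (bf i) (ef i) z < R0 ^ 2 ->
        plane_integral (bf i) (ef i) z = zone_level bf ef i r0 ->
       exists t, psi t = z).
Proof.
  intros H Hp HU E0.
  destruct (next_hit psi t0 H Hp HU) as (t1 & i & Ht & Hs1 & Hz). rewrite E0. apply gamma_sigma.
  assert (Hp' := Hp). destruct Hp' as (Hcs & _).
  destruct (zone_arc m R0 i (bf i) (ef i) psi t0 t1) as (r0' & r1 & P0 & P1 & S0 & S1 & HK & Hcov);
      auto; try apply H.
  - intros t Htt. split. apply Hcs. apply (tube_sq_radius _ _ H (HU t)).
    destruct (Req_dec t t0) as [->|]. rewrite E0. apply sigma_closed, gamma_sigma.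
    destruct (Req_dec t t1) as [->|]. now apply sigma_closed. apply zone_closed, Hz. lra.
  - intros t Htt. split; [|now apply Hz]. destruct (Hcs t) as (_ & Hs & _). now apply (Hs i), Hz.
  - rewrite E0. apply gamma_sigma.
  - assert (Er : r0' = r0) by (apply gamma_inj; congruence). subst r0'.
    exists t1, i, r1. split; auto. split; auto. split; auto. split; auto. split; auto. split.
    { unfold zone_level. rewrite <- (HK t1) by lra. now rewrite P1. }
    split. exact HK.
    intros z Hz1 Hz2 Hz3. destruct (Hcov z Hz1 Hz2 Hz3) as (t & _ & Ht'). now exists t.
Qed.

(** The relation of one turn around the focus, defined by levels only; it is a partial
    map because the levels are injective on each half-line. *)
Definition turn (bf ef : zone -> R) (x x' : R) : Prop :=
  exists s, - / 1000 <= s < 0 /\ zone_level bf ef zone1 s = zone_level bf ef zone1 x /\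
      zone_level bf ef zone2 x' = zone_level bf ef zone2 s.

(** Both half-return maps reverse the order of the line. *)
Lemma turn_monotone {m R0 bf ef R1 lo hi} x x' y y' : tube_setup m R0 bf ef R1 lo hi ->
  turn bf ef x x' -> turn bf ef y y' -> 0 < x <= / 1000 -> 0 < y <= / 1000 -> 0 < x' <= / 1000 ->
      0 < y' <= / 1000 ->
  x <= y -> x' <= y'.
Proof.
  intros H (s & Hs & E1 & E2) (s' & Hs' & E1' & E2') Hx Hy Hx' Hy' Hxy.
  destruct (ts_mono zone1 H) as [M1 M1'].
  destruct (ts_mono zone2 H) as [M2 M2'].
  apply Rnot_lt_le. intros Hlt. pose proof (M2 y' x' ltac:(lra) Hlt ltac:(lra)) as H2.
  assert (Hss : s < s').
  { apply Rnot_le_lt. intros Hle. destruct Hle as [Hl|E]. pose proof (M2' s' s). lra. rewrite E in *. lra. }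
  pose proof (M1' s s' ltac:(lra) Hss ltac:(lra)) as H1. rewrite E1, E1' in H1.
  destruct Hxy as [Hl|E]. pose proof (M1 x y). lra. rewrite E in H1. lra.
Qed.

Lemma two_step {m R0 bf ef R1 lo hi} psi t0 r0 : tube_setup m R0 bf ef R1 lo hi ->
  periodic_orbit (pw_centers bf ef) psi -> (forall t, tube bf ef R1 lo hi (psi t)) ->
      psi t0 = gamma r0 -> 0 < r0 ->
  exists t2 r2, t0 < t2 /\ psi t2 = gamma r2 /\ 0 < r2 /\ turn bf ef r0 r2 /\
    (forall t x, t0 < t -> psi t = gamma x -> 0 < x -> t2 <= t).
Proof.
  intros H Hp HU E0 Hr0.
  destruct (hit_step psi t0 r0 H Hp HU E0) as (t1 & i & r1 & Ht1 & E1 & Hz1 & S0 & S1 & G1 & _).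
  assert (i = zone1) by (destruct i; auto; simpl in S0; lra). subst i. simpl in S1.
  destruct (hit_step psi t1 r1 H Hp HU E1) as (t2 & j & r2 & Ht2 & E2 & Hz2 & S2 & S3 & G2 & _).
  assert (j = zone2) by (destruct j; auto; simpl in S2; lra). subst j. simpl in S3.
  exists t2, r2. split. lra. split; auto. split. lra. split.
  - exists r1. split; auto. pose proof (HU t1) as HU1. rewrite E1 in HU1. apply (tube_sigma _ H) in HU1. lra.
  - intros t x Ht E Hx. assert (Hsg : on_sigma (psi t)) by (rewrite E; apply gamma_sigma).
    apply Rnot_lt_le. intros Hlt.
    destruct (Rtotal_order t t1) as [Hl|[Hl|Hl]].
    + exact (zone_not_sigma zone1 (psi t) (Hz1 t (conj Ht Hl)) Hsg).
    + subst t. rewrite E in E1. apply gamma_inj in E1. lra.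
    + exact (zone_not_sigma zone2 (psi t) (Hz2 t (conj Hl Hlt)) Hsg).
Qed.

(** If the next return [r2] to the positive half-line were different from [r0], then by
    monotonicity all later returns would stay on the side of [r2] away from [r0], while
    periodicity brings the orbit back to [r0]. The last time before [t0 + T] at which a
    return is beyond [r2] gives the contradiction. *)
Lemma hit_fixed m R0 bf ef R1 lo hi psi t0 r0 : tube_setup m R0 bf ef R1 lo hi ->
  periodic_orbit (pw_centers bf ef) psi -> (forall t, tube bf ef R1 lo hi (psi t)) ->
      psi t0 = gamma r0 -> 0 < r0 ->
  turn bf ef r0 r0.
Proof.
  intros H Hp HU E0 Hr0. assert (Hp' := Hp). destruct Hp' as (Hcs & (T & HT & Hper) & _).
  assert (Hc : forall t, continuous psi t) by (intros t; apply Hcs).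
  assert (Hrange : forall t x, psi t = gamma x -> x <> 0 /\ - / 1000 < x < / 1000).
  { intros t x E. pose proof (HU t) as HUt. rewrite E in HUt.
  destruct (tube_sigma _ H HUt) as (A & B & _). auto. }
  destruct (two_step psi t0 r0 H Hp HU E0 Hr0) as (t2 & r2 & Ht2 & E2 & Hr2 & Hret & Hmin).
  destruct (Req_dec r2 r0) as [E|Hne]. now rewrite E in Hret. exfalso.
  assert (ET : psi (t0 + T) = gamma r0) by now rewrite Hper.
  (* the returns never come back past r2, on whichever side of r0 it lies *)
  assert (Hk : exists k, (k = 1 \/ k = -1) /\ k * r0 < k * r2).
  { destruct (Rtotal_order r0 r2) as [Hl|[Hl|Hl]]. exists 1; split; auto; lra. congruence.
  exists (-1); split; auto; lra. }
  destruct Hk as (k & Hk & Hlt).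
  set (P := fun t => h (psi t) = 0 /\ 1 <= fst (psi t) /\ k * (1 + 3 * r2) <= k * fst (psi t)).
  assert (HPgam : forall t x, psi t = gamma x -> 0 < x -> k * r2 <= k * x -> P t).
  { intros t x E Hx Hkx. unfold P. rewrite E. split. apply gamma_sigma. simpl. lra. }
  assert (HP : forall t, P t -> exists x, psi t = gamma x /\ 0 < x /\ k * r2 <= k * x).
  { intros t (P1 & P2 & P3). exists ((fst (psi t) - 1) / 3).
    assert (E : psi t = gamma ((fst (psi t) - 1) / 3)) by now apply sigma_gamma.
    split; auto. destruct (Hrange _ _ E) as [Hn0 _]. split. lra. destruct Hk as [-> | ->]; lra. }
  destruct (sup_attained P t2 (t0 + T)) as (ts & Hts & HPs & Hsup).
  - apply (HPgam t2 r2); auto. lra.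
  - apply (Hmin (t0 + T) r0); auto. lra.
  - intros t Hn.
    assert (Hl : locally t (fun s => ~ P s)).
    { assert (Hh : continuous (fun s => h (psi s)) t) by now apply continuous_h.
      assert (Hf : continuous (fun s => fst (psi s)) t) by now apply continuous_fst_comp.
      assert (Hkf : continuous (fun s => k * fst (psi s)) t) by now apply (continuous_scal_r (K :=
          R_AbsRing) k (fun s => fst (psi s))).
      destruct (Rtotal_order (h (psi t)) 0) as [Hl|[Hl|Hl]].
      - apply (filter_imp (fun s => h (psi s) < 0)). intros s Hs (P1 & _). lra.
      now apply (locally_lt (fun s => h (psi s))).
      - destruct (Rlt_dec (fst (psi t)) 1) as [Hl1|Hl1].
        apply (filter_imp (fun s => fst (psi s) < 1)). intros s Hs (_ & P1 & _). lra.
        now apply (locally_lt (fun s => fst (psi s))).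
        destruct (Rlt_dec (k * fst (psi t)) (k * (1 + 3 * r2))) as [Hl2|Hl2].
        apply (filter_imp (fun s => k * fst (psi s) < k * (1 + 3 * r2))). intros s Hs (_ & _ & P1).
        lra. now apply (locally_lt (fun s => k * fst (psi s))).
        exfalso. apply Hn. unfold P. lra.
      - apply (filter_imp (fun s => 0 < h (psi s))). intros s Hs (P1 & _). lra.
      now apply (locally_gt (fun s => h (psi s))). }
    destruct Hl as (d & Hd). exists d. split. apply cond_pos. intros s Hs. now apply Hd.
  - destruct (HP ts HPs) as (x & Ex & Hx & Hkx).
    assert (Hne2 : ts <> t0 + T). { intros E. rewrite E, ET in Ex. apply gamma_inj in Ex. subst x. lra. }
    destruct (two_step psi ts x H Hp HU Ex Hx) as (t3 & x' & Ht3 & E3 & Hx' & Hret' & Hmin').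
    assert (t3 <= t0 + T) by (apply (Hmin' (t0 + T) r0); auto; lra).
    apply (Hsup t3). lra. apply (HPgam t3 x'); auto.
    pose proof (Hrange _ _ E0). pose proof (Hrange _ _ E2). pose proof (Hrange _ _ Ex).
    pose proof (Hrange _ _ E3).
    destruct Hk as [-> | ->].
    + assert (r2 <= x') by (apply (turn_monotone r0 r2 x x' H); auto; lra). lra.
    + assert (x' <= r2) by (apply (turn_monotone x x' r0 r2 H); auto; lra). lra.
Qed.

Lemma turn_fixed_disp m R0 bf ef R1 lo hi x : tube_setup m R0 bf ef R1 lo hi -> 0 < x <= rmax ->
    turn bf ef x x ->
  disp (zone_s bf ef zone1) (zone_t bf ef zone1) (zone_level bf ef zone2) x = 0.
Proof.
  intros H Hx (s & Hs & E1 & E2). destruct H as [Hsu _ _ _ _ _].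
  pose proof (su_s Hsu zone1) as Bs. pose proof (su_t Hsu zone1) as Bt.
  pose proof (invol_bounds (zone_s bf ef zone1) (zone_t bf ef zone1) x Bs Bt Hx) as [Z _].
  assert (E : s = invol (zone_s bf ef zone1) (zone_t bf ef zone1) x).
  { destruct (level_injective _ _ _ Bs Bt (su_level m R0 bf ef zone1 Hsu)) as [_ Hinj].
    unfold rmax in Hx. apply Hinj; try lra. rewrite level_invariant; auto.
    now apply (su_level m R0). unfold rmax; lra. }
  unfold disp. rewrite <- E. lra.
Qed.

(** The integrals are constant along the two arcs, and monotone on the line. *)
Lemma loop_in_tube m R0 bf ef R1 lo hi r sig a b T1 T2 t : tube_setup m R0 bf ef R1 lo hi ->
  loop bf ef r sig a b T1 T2 -> lo < r < hi -> 100 * r ^ 2 < R1 ^ 2 -> tube bf ef R1 lo hi (wrap a b T1 T2 t).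
Proof.
  intros H L Hr HR1.
  assert (Hrange : forall i, zone_level bf ef i lo < zone_level bf ef i r < zone_level bf ef i hi).
  { intros i. destruct (ts_mono i H) as [M _]. destruct H. split; apply M; lra. }
  assert (Hsg : forall z i, z = gamma r \/ z = gamma sig -> sq_radius (bf i) (ef i) z < R1 ^ 2 /\
     zone_level bf ef i lo < plane_integral (bf i) (ef i) z < zone_level bf ef i hi).
  { intros z i Hz.
    assert (Ks : forall i, zone_level bf ef i sig = zone_level bf ef i r).
    { intros [|]. pose proof (lp_ka L T1) as K. rewrite (lp_a1 L) in K. exact K.
      pose proof (lp_kb L 0) as K. rewrite (lp_b0 L) in K. exact K. }
    assert (Hsig : sig ^ 2 <= 100 * r ^ 2).
    { pose proof (lp_na L T1) as K. rewrite (lp_a1 L) in K.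
      rewrite sq_radius_gamma in K. lra. apply (ts_basis_det zone1 H). }
    assert (0 <= r ^ 2) by apply pow2_ge_0.
    destruct Hz as [-> | ->]; rewrite sq_radius_gamma by apply (ts_basis_det i H).
    split. lra. apply Hrange. split. lra. change (plane_integral (bf i) (ef i) (gamma sig)) with
        (zone_level bf ef i sig). rewrite Ks. apply Hrange. }
  pose proof (lp_T1 L) as H1. pose proof (lp_T2 L) as H2.
  assert (Ho : orbit (wrap a b T1 T2) (wrap a b T1 T2 t)) by now exists t.
  apply (loop_orbit m R0 bf ef r sig) in Ho; auto; [|apply H].
  intros i Hi. destruct Ho as [(s & Hs & E)|(s & Hs & E)]; rewrite E in *.
  - destruct (Req_dec s 0) as [->|]. apply Hsg. left. apply L.
    destruct (Req_dec s T1) as [->|]. apply Hsg. right. apply L.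
    pose proof (lp_za L s ltac:(lra)) as Hz. destruct i; simpl in Hi, Hz; [|lra].
    rewrite (lp_ka L). split; [|apply Hrange]. pose proof (lp_na L s). lra.
  - destruct (Req_dec s 0) as [->|]. apply Hsg. right. apply L.
    destruct (Req_dec s T2) as [->|]. apply Hsg. left. apply L.
    pose proof (lp_zb L s ltac:(lra)) as Hz. destruct i; simpl in Hi, Hz; [lra|].
    rewrite (lp_kb L). split; [|apply Hrange]. pose proof (lp_nb L s). lra.
Qed.

(** By [zone_arc] each arc is the whole part of its level in the zone. *)
Lemma loop_cover m R0 bf ef R1 lo hi r sig a b T1 T2 i z : tube_setup m R0 bf ef R1 lo hi ->
  loop bf ef r sig a b T1 T2 -> 100 * r ^ 2 < R1 ^ 2 -> in_zone i z -> sq_radius (bf i) (ef i) z < R0 ^ 2 ->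
  plane_integral (bf i) (ef i) z = zone_level bf ef i r -> orbit (wrap a b T1 T2) z.
Proof.
  intros H L HR1 Hz Hn HK. assert (Hsu := ts_su H).
  assert (HR : R1 ^ 2 <= R0 ^ 2) by (apply pow_incr; pose proof (ts_R H); lra).
  apply (loop_orbit m R0 bf ef r sig); auto.
  destruct L as [H1 H2 A0 A1 B0 B1 Sa Sb Za Zb Na Nb Ka Kb Hr Hs].
  destruct i.
  - left. destruct (zone_arc m R0 zone1 (bf zone1) (ef zone1) a 0 T1) as (r0 & r1 & P0 & P1 & _ & _
      & _ & Hcov); auto; try apply Hsu.
    + intros t Ht. split. eapply solution_continuous, Sa. specialize (Na t). lra.
    + rewrite A0. apply gamma_sigma.
    + rewrite A1. apply gamma_sigma.
    + assert (r0 = r) by (apply gamma_inj; congruence). subst r0.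
      destruct (Hcov z Hz Hn HK) as (t & Ht & E). exists t. split. lra. now symmetry.
  - right. destruct (zone_arc m R0 zone2 (bf zone2) (ef zone2) b 0 T2) as (r0 & r1 & P0 & P1 & _ &
      _ & HKb & Hcov); auto; try apply Hsu.
    + intros t Ht. split. eapply solution_continuous, Sb. specialize (Nb t). lra.
    + rewrite B0. apply gamma_sigma.
    + rewrite B1. apply gamma_sigma.
    + destruct (Hcov z Hz Hn) as (t & Ht & E). rewrite HK. specialize (HKb 0). rewrite Kb in HKb.
    apply HKb. lra.
      exists t. split. lra. now symmetry.
Qed.

(** A periodic orbit in the tube crosses the positive half-line at fixed points of the
    turn, hence at [r] only, and therefore the negative one at [sig] only. Its arcs are
    then on the levels of the loop, and are covered by the loop and cover it. *)
Lemma loop_limit_cycle m R0 bf ef R1 lo hi r sig a b T1 T2 : tube_setup m R0 bf ef R1 lo hi ->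
  loop bf ef r sig a b T1 T2 -> lo < r < hi -> hi <= rmax -> 100 * r ^ 2 < R1 ^ 2 ->
  (forall x, lo < x < hi -> disp (zone_s bf ef zone1) (zone_t bf ef zone1) (zone_level bf ef zone2)
      x = 0 -> x = r) ->
  crossing_limit_cycle (pw_centers bf ef) (wrap a b T1 T2).
Proof.
  intros H L Hr Hhi HR1 Hiso. assert (Hsu := ts_su H).
  assert (HR : R1 ^ 2 <= R0 ^ 2) by (apply pow_incr; pose proof (ts_R H); lra).
  assert (Ho := loop_orbit m R0 bf ef r sig a b T1 T2).
  split; [|split].
  - now apply (loop_periodic m R0 bf ef r sig).
  - assert (H1 := lp_T1 L). assert (H2 := lp_T2 L).
    intros [|].
    + destruct (Ho (a (T1 / 2)) Hsu L) as [_ Hx]. destruct Hx as (t & E).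
    left; exists (T1 / 2); split; auto; lra.
      exists t. rewrite E. apply L. lra.
    + destruct (Ho (b (T2 / 2)) Hsu L) as [_ Hx]. destruct Hx as (t & E).
    right; exists (T2 / 2); split; auto; lra.
      exists t. rewrite E. apply L. lra.
  - exists (tube bf ef R1 lo hi).
    split. apply (tube_open m R0); auto. apply H.
    split. intros t. now apply (loop_in_tube m R0 bf ef R1 lo hi r sig).
    intros psi Hp HU. assert (Hp' := Hp). destruct Hp' as (Hcs & (T & HT & Hper) & _).
    assert (Hfix : forall t x, psi t = gamma x -> 0 < x -> x = r).
    { intros t x E Hx. pose proof (HU t) as HUt. rewrite E in HUt.
      destruct (tube_sigma _ H HUt) as (_ & _ & Hlh). specialize (Hlh Hx).
      apply Hiso; auto. apply (turn_fixed_disp m R0 bf ef R1 lo hi); auto. lra.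
      now apply (hit_fixed m R0 bf ef R1 lo hi psi t). }
    assert (Gs : forall i, zone_level bf ef i sig = zone_level bf ef i r).
    { intros [|]. pose proof (lp_ka L T1) as K. rewrite (lp_a1 L) in K. exact K.
      pose proof (lp_kb L 0) as K. rewrite (lp_b0 L) in K. exact K. }
    assert (Hsig := lp_sig L).
    assert (Hneg : forall t x, psi t = gamma x -> x < 0 -> x = sig).
    { intros t x E Hx.
      destruct (hit_step psi t x H Hp HU E) as (t1 & i & x1 & Ht1 & E1 & Hz & S0 & S1 & G & _).
      assert (i = zone2) by (destruct i; auto; simpl in S0; lra). subst i. simpl in S1.
      rewrite (Hfix t1 x1 E1) in G by lra. rewrite <- Gs in G.
      pose proof (HU t) as HUt. rewrite E in HUt. destruct (tube_sigma _ H HUt) as (_ & Hb & _).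
      destruct (level_injective _ _ _ (su_s Hsu zone2) (su_t Hsu zone2) (su_level m R0 bf ef zone2
          Hsu)) as [_ Hinj].
      symmetry. apply Hinj; lra. }
    assert (Hlev : forall t i, in_zone i (psi t) ->
        plane_integral (bf i) (ef i) (psi t) = zone_level bf ef i r).
    { intros t i Hi.
      destruct (hit_exists psi H Hp HU) as (th & Hth).
      assert (Hbefore : exists t0, t0 <= t /\ on_sigma (psi t0)).
      { assert (Hn : forall n : nat, psi (th - INR n * T) = psi th).
        { induction n as [|n IH]. f_equal. simpl. ring. rewrite <- IH, <- (Hper (th - INR (S n) * T)).
          f_equal. rewrite S_INR. ring. }
        destruct (nfloor_ex (Rabs (th - t) / T)) as (n & _ & Hn2).
        apply Rdiv_le_0_compat; auto using Rabs_pos.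
        exists (th - INR (S n) * T). split. 2:{ now rewrite Hn. }
        rewrite S_INR. assert (Rabs (th - t) < (INR n + 1) * T).
        { apply Rmult_lt_reg_r with (/ T). now apply Rinv_0_lt_compat.
        rewrite Rmult_assoc, Rinv_r, Rmult_1_r by lra. exact Hn2. }
        pose proof (Rle_abs (th - t)). lra. }
      destruct Hbefore as (t0 & Ht0 & Hs0).
      destruct (sup_attained (fun s => on_sigma (psi s)) t0 t Hs0 Ht0) as (ts & Hts & Hss & Hsup).
      { intros s Hn. assert (Hh : continuous (fun s => h (psi s)) s) by (apply continuous_h, Hcs).
        assert (Hl : locally s (fun s => ~ on_sigma (psi s))).
        { unfold on_sigma in *. destruct (Rtotal_order (h (psi s)) 0) as [Hl|[Hl|Hl]].
          - apply (filter_imp (fun s => h (psi s) < 0)). intros; lra.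
          now apply (locally_lt (fun s => h (psi s))).
          - contradiction.
          - apply (filter_imp (fun s => 0 < h (psi s))). intros; lra.
          now apply (locally_gt (fun s => h (psi s))). }
        destruct Hl as (d & Hd). exists d. split. apply cond_pos. intros u Hu. now apply Hd. }
      assert (Hne : ts <> t). { intros E. rewrite E in Hss. now apply (zone_not_sigma i (psi t)). }
      pose proof (sigma_gamma _ Hss) as Ex. set (x := (fst (psi ts) - 1) / 3) in *.
      destruct (hit_step psi ts x H Hp HU Ex) as (t1 & j & x1 & Ht1 & E1 & Hz & S0 & S1 & G & HKj & _).
      assert (Ht1t : t < t1).
      { apply Rnot_le_lt. intros Hle. apply (Hsup t1). lra. rewrite E1. apply gamma_sigma. }
      assert (Eij : j = i) by (apply (zone_unique j i (psi t)); auto; apply Hz; lra). subst j.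
      rewrite HKj by lra. destruct i; simpl in S0.
      - rewrite (Hfix ts x Ex). reflexivity. lra.
      - rewrite (Hneg ts x Ex). apply Gs. lra. }
    assert (Hsub : forall z, orbit psi z -> orbit (wrap a b T1 T2) z).
    { intros z (t & <-). destruct (zone_or_sigma (psi t)) as [Hs|[i Hi]].
      - pose proof (sigma_gamma _ Hs) as Ex. set (x := (fst (psi t) - 1) / 3) in *.
        apply Ho; auto. assert (H1 := lp_T1 L).
        pose proof (HU t) as HUt. rewrite Ex in HUt. destruct (tube_sigma _ H HUt) as (Hn0 & _ & _).
        left. destruct (Rlt_dec 0 x) as [Hx|Hx].
        + exists 0. split. lra. rewrite Ex, (Hfix t x Ex Hx). symmetry. apply L.
        + exists T1. split. lra. rewrite Ex, (Hneg t x Ex). symmetry. apply L. lra.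
      - apply (loop_cover m R0 bf ef R1 lo hi r sig a b T1 T2 i); auto.
        apply (tube_sq_radius _ _ H (HU t)). now apply zone_closed. }
    assert (Hpos : exists t, psi t = gamma r).
    { destruct (hit_exists psi H Hp HU) as (t & Ht). pose proof (sigma_gamma _ Ht) as Ex.
      set (x := (fst (psi t) - 1) / 3) in *.
      pose proof (HU t) as HUt. rewrite Ex in HUt. destruct (tube_sigma _ H HUt) as (Hn0 & _ & _).
      destruct (Rlt_dec 0 x) as [Hx|Hx]. exists t. now rewrite Ex, (Hfix t x Ex Hx).
      destruct (hit_step psi t x H Hp HU Ex) as (t1 & i & x1 & Ht1 & E1 & Hz & S0 & S1 & _).
      assert (i = zone2) by (destruct i; auto; simpl in S0; lra). subst i. simpl in S1.
      exists t1. rewrite E1, (Hfix t1 x1 E1); auto. lra. }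
    destruct Hpos as (tp & Etp).
    assert (Hr0 := lp_r L).
    destruct (hit_step psi tp r H Hp HU Etp) as (t1 & i & x1 & Ht1 & E1 & Hz1 & S0 & S1 & G1 & HK1 & Hc1).
    assert (i = zone1) by (destruct i; auto; simpl in S0; lra). subst i. simpl in S1.
    assert (x1 = sig) by (apply (Hneg t1); auto; lra). subst x1.
    destruct (hit_step psi t1 sig H Hp HU E1) as (t2 & j & x2 & Ht2 & E2 & Hz2 & S2 & S3 & G2 & HK2 & Hc2).
    assert (j = zone2) by (destruct j; auto; simpl in S2; lra). subst j.
    intros z. split. apply Hsub.
    intros Hz. apply Ho in Hz; auto. destruct Hz as [(t & Ht & ->)|(t & Ht & ->)].
    + destruct (Req_dec t 0) as [->|]. exists tp. rewrite Etp. symmetry. apply L.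
      destruct (Req_dec t T1) as [->|]. exists t1. rewrite E1. symmetry. apply L.
      destruct (Hc1 (a t)) as (s & Es). apply L; lra. pose proof (lp_na L t). lra. apply L. now exists s.
    + destruct (Req_dec t 0) as [->|]. exists t1. rewrite E1. symmetry. apply L.
      destruct (Req_dec t T2) as [->|]. exists tp. rewrite Etp. symmetry. apply L.
      destruct (Hc2 (b t)) as (s & Es). apply L; lra. pose proof (lp_nb L t). lra. rewrite Gs.
      apply L. now exists s.
Qed.

(** * Three limit cycles *)

(** The last conclusion recovers [r] from the orbit, which shows that distinct zeros
    give distinct orbits. *)
Lemma one_cycle m R0 bf ef lo hi r d (U : R * R -> Prop) : setup m R0 bf ef -> 0 < d ->
  (forall b e z, good m b e -> sq_radius b e z <= d ^ 2 -> U z) ->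
  0 < lo -> lo < r < hi -> hi <= rmax -> 10 * hi < R0 -> 10 * hi < / 1000 -> 10 * hi <= d ->
  disp (zone_s bf ef zone1) (zone_t bf ef zone1) (zone_level bf ef zone2) r = 0 ->
  (forall x, lo < x < hi -> disp (zone_s bf ef zone1) (zone_t bf ef zone1) (zone_level bf ef zone2)
      x = 0 -> x = r) ->
  exists phi, crossing_limit_cycle (pw_centers bf ef) phi /\ (forall t, U (phi t)) /\
    orbit phi (gamma r) /\ (forall x, 0 < x -> orbit phi (gamma x) -> x = r).
Proof.
  intros H Hd HU Hlo Hr Hhi H1 H2 H3 Hz Hiso.
  destruct (loop_exists m R0 bf ef r H) as (sig & a & b & T1 & T2 & L); auto; try lra.
  destruct (su_R H) as (HR & _).
  assert (Ho := fun z => loop_orbit m R0 bf ef r sig a b T1 T2 z H L).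
  exists (wrap a b T1 T2).
  assert (HT1 := lp_T1 L). assert (HT2 := lp_T2 L).
  split; [|split; [|split]].
  - assert (Hm1 : 0 < Rmin R0 (/ 1000)) by (apply Rmin_glb_lt; lra).
    assert (Hm2 : 10 * hi < Rmin R0 (/ 1000)) by (apply Rmin_glb_lt; lra).
    pose proof (Rmin_l R0 (/ 1000)). pose proof (Rmin_r R0 (/ 1000)).
    apply (loop_limit_cycle m R0 bf ef (Rmin R0 (/ 1000)) lo hi r sig); auto.
    + split; auto; lra.
    + replace (100 * r ^ 2) with ((10 * r) ^ 2) by ring. set (w := Rmin R0 (/ 1000)) in *. nra.
  - intros t. assert (Hr2 : 100 * r ^ 2 <= d ^ 2) by (replace (100 * r ^ 2) with ((10 * r) ^ 2) by
      ring; apply pow_incr; lra).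
    assert (Hot : orbit (wrap a b T1 T2) (wrap a b T1 T2 t)) by now exists t.
    apply Ho in Hot. destruct Hot as [(s & Hs & ->)|(s & Hs & ->)].
    + apply (HU (bf zone1) (ef zone1)). apply H. pose proof (lp_na L s). lra.
    + apply (HU (bf zone2) (ef zone2)). apply H. pose proof (lp_nb L s). lra.
  - apply Ho. left. exists 0. split. lra. symmetry. apply L.
  - intros x Hx Hox. apply Ho in Hox. pose proof (lp_sig L) as Hsig.
    destruct Hox as [(s & Hs & E)|(s & Hs & E)].
    + destruct (Req_dec s 0) as [->|]. rewrite (lp_a0 L) in E. now apply gamma_inj.
      destruct (Req_dec s T1) as [->|]. rewrite (lp_a1 L) in E. apply gamma_inj in E. lra.
      exfalso. apply (zone_not_sigma zone1 (a s)). apply L. lra. rewrite <- E. apply gamma_sigma.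
    + destruct (Req_dec s 0) as [->|]. rewrite (lp_b0 L) in E. apply gamma_inj in E. lra.
      destruct (Req_dec s T2) as [->|]. rewrite (lp_b1 L) in E. now apply gamma_inj.
      exfalso. apply (zone_not_sigma zone2 (b s)). apply L. lra. rewrite <- E. apply gamma_sigma.
Qed.

Lemma three_cycles m R0 k (U : R * R -> Prop) : 1 <= m -> zone_radius m R0 -> 0 < k -> locally (1, 1) U ->
  exists eps0, 0 < eps0 /\ forall eps bf ef m0 m1, 0 < eps < eps0 -> setup m R0 bf ef ->
  let s1 := zone_s bf ef zone1 in let t1 := zone_t bf ef zone1 in
  let s2 := zone_s bf ef zone2 in let t2 := zone_t bf ef zone2 in
  k <= Rabs (kappa3 s1 t1) ->
  kappa2 s1 t1 = 98 / 9 * kappa3 s1 t1 * eps ^ 2 ->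
  m0 = 12 * kappa3 s1 t1 * eps ^ 6 ->
  m1 = kappa1 s1 t1 - 245 / 9 * kappa3 s1 t1 * eps ^ 4 ->
  s2 * (1 - m0 * t1) = - (t1 + m1) -> t2 * (1 - m0 * s1) = - (s1 + m1) ->
  cross s1 t1 s2 t2 <> 0 ->
  exists phi : nat -> R -> R * R,
    (forall i : nat, (i < 3)%nat -> crossing_limit_cycle (pw_centers bf ef) (phi i) /\
        forall t, U (phi i t)) /\
    (forall i j : nat, (i < j < 3)%nat -> ~ same_orbit (phi i) (phi j)).
Proof.
  intros Hm HZ Hk HU. destruct (small_in_nbhd m U Hm HU) as (d & Hd & Hin).
  destruct (disp_three_zeros k Hk) as (e1 & He1 & H3).
  assert (HR := proj1 HZ).
  set (q := Rmin (R0 / 100) (Rmin (/ 100000) (d / 100))).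
  assert (Hq : 0 < q) by (unfold q; repeat apply Rmin_glb_lt; lra).
  exists (Rmin e1 q). split. now apply Rmin_glb_lt.
  intros eps bf ef m0 m1 [He0 He] H s1 t1 s2 t2 Hk3 K2 E0 E1 E2 E3 Hb.
  assert (Hee : eps < e1) by (eapply Rlt_le_trans; [exact He|apply Rmin_l]).
  assert (Heq : eps < q) by (eapply Rlt_le_trans; [exact He|apply Rmin_r]).
  unfold q in Heq. apply Rmin3_lt in Heq. destruct Heq as (Q1 & Q2 & Q3).
  destruct (H3 eps s1 t1 s2 t2 m0 m1 (zone_level bf ef zone2)) as (H4 & Hz); auto; try apply H.
  now apply (su_level m R0).
  assert (Hcyc : forall i, i = 1 \/ i = 2 \/ i = 3 -> exists r phi, eps * (i - / 10) < r < eps * (i + / 10) /\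
     crossing_limit_cycle (pw_centers bf ef) phi /\ (forall t, U (phi t)) /\
     orbit phi (gamma r) /\ (forall x, 0 < x -> orbit phi (gamma x) -> x = r)).
  { intros i Hi. destruct (Hz i Hi) as (r & Hr & Hr0 & Hiso). exists r.
    assert (B1 : eps * (9 / 10) <= eps * (i - / 10)) by (apply Rmult_le_compat_l; lra).
    assert (B2 : eps * (i + / 10) <= eps * (31 / 10)) by (apply Rmult_le_compat_l; lra).
    destruct (one_cycle m R0 bf ef (eps * (i - / 10)) (eps * (i + / 10)) r d U) as (phi & Hp); auto; try lra.
    - intros x Hx. apply Hiso. lra.
    - now exists phi. }
  destruct (Hcyc 1) as (r1 & p1 & B1 & C1 & U1 & O1 & X1). lra.
  destruct (Hcyc 2) as (r2 & p2 & B2 & C2 & U2 & O2 & X2). lra.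
  destruct (Hcyc 3) as (r3 & p3 & B3 & C3 & U3 & O3 & X3). lra.
  exists (fun n => match n with 0%nat => p1 | 1%nat => p2 | _ => p3 end). split.
  - intros [|[|n]] Hn; auto.
  - intros i j Hij Hs.
    assert (Hcase : (i = 0 /\ j = 1 \/ i = 0 /\ j = 2 \/ i = 1 /\ j = 2)%nat) by lia.
    destruct Hcase as [[-> ->]|[[-> ->]|[-> ->]]].
    + apply (Hs (gamma r1)) in O1. apply X2 in O1; nra.
    + apply (Hs (gamma r1)) in O1. apply X3 in O1; nra.
    + apply (Hs (gamma r2)) in O2. apply X3 in O2; nra.
Qed.

(** * A curve of parameters through a center *)

(** The parameters are expanded at [s = 19/20], close to the root 0.9475... of
    [5 s^3 - 35 s^2 + 73 s - 42], and [z = 0], where [kappa3] is close to 58; the other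
    terms are bounded one by one. *)
Lemma kappa3_range s z : 9 / 10 <= s <= 1 -> Rabs z <= / 100 -> 1 <= kappa3 s (14 - 5 * s + z) <= 100.
Proof.
  intros Hs Hz. set (x := s - 19 / 20).
  assert (Hx : Rabs x <= / 20) by (unfold x; apply Rabs_le; lra).
  assert (Hmono : forall i j, - ((/ 20) ^ i * (/ 100) ^ j) <= x ^ i * z ^ j <= (/ 20) ^ i * (/ 100) ^ j).
  { intros i j. apply Rabs_le_between. apply Rabs_le_mult; now apply Rabs_le_pow. }
  replace (kappa3 s (14 - 5 * s + z)) with
    ((323104241 / 5600000) * (x ^ 0 * z ^ 0) + (105934337 / 1680000) * (x ^ 0 * z ^ 1) +
     (1958123 / 126000) * (x ^ 0 * z ^ 2) + (261239 / 189000) * (x ^ 0 * z ^ 3) + (16 /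
     525) * (x ^ 0 * z ^ 4) + (-8 / 8505) * (x ^ 0 * z ^ 5) + (-21192113 / 56000) * (x ^
     1 * z ^ 0) + (-3645737 / 21000) * (x ^ 1 * z ^ 1) + (-49351 / 2100) * (x ^ 1 * z ^
     2) + (-4219 / 4725) * (x ^ 1 * z ^ 3) + (32 / 2835) * (x ^ 1 * z ^ 4) + (140517 /
     280) * (x ^ 2 * z ^ 0) + (279851 / 2100) * (x ^ 2 * z ^ 1) + (391 / 45) * (x ^ 2 *
     z ^ 2) + (-2 / 945) * (x ^ 2 * z ^ 3) + (-17097 / 70) * (x ^ 3 * z ^ 0) + (-3554 /
     105) * (x ^ 3 * z ^ 1) + (-4 / 9) * (x ^ 3 * z ^ 2) + (289 / 7) * (x ^ 4 * z ^ 0) +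
     (34 / 21) * (x ^ 4 * z ^ 1) + (-4 / 7) * (x ^ 5 * z ^ 0)).
  2:{ unfold x, kappa3. field. }
  pose proof (Hmono 0%nat 0%nat) as M00.
  pose proof (Hmono 0%nat 1%nat) as M01.
  pose proof (Hmono 0%nat 2%nat) as M02.
  pose proof (Hmono 0%nat 3%nat) as M03.
  pose proof (Hmono 0%nat 4%nat) as M04.
  pose proof (Hmono 0%nat 5%nat) as M05.
  pose proof (Hmono 1%nat 0%nat) as M10.
  pose proof (Hmono 1%nat 1%nat) as M11.
  pose proof (Hmono 1%nat 2%nat) as M12.
  pose proof (Hmono 1%nat 3%nat) as M13.
  pose proof (Hmono 1%nat 4%nat) as M14.
  pose proof (Hmono 2%nat 0%nat) as M20.
  pose proof (Hmono 2%nat 1%nat) as M21.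
  pose proof (Hmono 2%nat 2%nat) as M22.
  pose proof (Hmono 2%nat 3%nat) as M23.
  pose proof (Hmono 3%nat 0%nat) as M30.
  pose proof (Hmono 3%nat 1%nat) as M31.
  pose proof (Hmono 3%nat 2%nat) as M32.
  pose proof (Hmono 4%nat 0%nat) as M40.
  pose proof (Hmono 4%nat 1%nat) as M41.
  pose proof (Hmono 5%nat 0%nat) as M50.
  simpl pow in *. split; lra.
Qed.

(** For [z = 0] this is [- 4/5 (5 s^3 - 35 s^2 + 73 s - 42)]. *)
Lemma kappa2_line s z : kappa2 s (14 - 5 * s + z) =
  - 4 * s ^ 3 + 28 * s ^ 2 - 292 / 5 * s + 168 / 5
  + z * (2 * s ^ 2 - 28 / 3 * s + 146 / 15 + z * (14 / 15 - 2 / 5 * s + 4 / 135 * z)).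
Proof. unfold kappa2. field. Qed.

Lemma kappa2_decreasing s s' z : 9 / 10 <= s <= 1 -> 9 / 10 <= s' <= 1 -> Rabs z <= / 100 -> s < s' ->
  10 * (s' - s) <= kappa2 s (14 - 5 * s + z) - kappa2 s' (14 - 5 * s' + z).
Proof.
  intros Hs Hs' Hz Hlt. rewrite !kappa2_line.
  match goal with |- _ <= ?E => replace E with
   ((s' - s) * (4 * (s ^ 2 + s * s' + s' ^ 2) - 28 * (s + s') + 292 / 5 - z * (2 * (s + s') - 28 /
       3 - 2 / 5 * z))) by field end.
  rewrite Rmult_comm. apply Rmult_le_compat_l. lra.
  assert (Hq : Rabs (z * (2 * (s + s') - 28 / 3 - 2 / 5 * z)) <= / 100 * 14).
  { apply Rabs_le_mult; auto. apply Rabs_le_between in Hz. apply Rabs_le. lra. }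
  apply Rabs_le_between in Hq. nra.
Qed.

(** [kappa2] moves at speed at least 10 along the line, so its value controls the
    position of [s]. *)
Lemma kappa2_gap s s' z : 9 / 10 <= s <= 1 -> 9 / 10 <= s' <= 1 -> Rabs z <= / 100 ->
  10 * Rabs (s' - s) <= Rabs (kappa2 s (14 - 5 * s + z) - kappa2 s' (14 - 5 * s' + z)).
Proof.
  intros Hs Hs' Hz. destruct (Rtotal_order s s') as [H|[H|H]].
  - pose proof (kappa2_decreasing s s' z Hs Hs' Hz H). rewrite !Rabs_pos_eq; lra.
  - subst. rewrite !Rminus_diag, Rabs_R0. lra.
  - pose proof (kappa2_decreasing s' s z Hs' Hs Hz H). rewrite !Rabs_left1; lra.
Qed.

Lemma kappa2_shift s z : 9 / 10 <= s <= 1 -> Rabs z <= / 100 ->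
  Rabs (kappa2 s (14 - 5 * s + z) - kappa2 s (14 - 5 * s + 0)) <= 20 * Rabs z.
Proof.
  intros Hs Hz. rewrite !kappa2_line.
  match goal with |- Rabs ?E <= _ => replace E with
    ((2 * s ^ 2 - 28 / 3 * s + 146 / 15 + z * (14 / 15 - 2 / 5 * s + 4 / 135 * z)) * z) by field end.
  apply Rabs_le_mult; [|lra].
  assert (Hq : Rabs (z * (14 / 15 - 2 / 5 * s + 4 / 135 * z)) <= / 100 * 2).
  { apply Rabs_le_mult; auto. apply Rabs_le_between in Hz. apply Rabs_le. lra. }
  apply Rabs_le_between in Hq. apply Rabs_le. nra.
Qed.

(** [kappa2] changes sign between [s = 9/10] and [s = 1], and the right-hand side is too
    small to change that. The case [q = 0] gives weak foci, the case [q = (98/9) eps^2]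
    their unfolding. *)
Lemma root_exists z q : Rabs z <= / 100 -> 0 <= q <= / 1000 ->
  exists s, 9 / 10 <= s <= 1 /\ kappa2 s (14 - 5 * s + z) = q * kappa3 s (14 - 5 * s + z).
Proof.
  intros Hz Hq. set (f := fun s => q * kappa3 s (14 - 5 * s + z) - kappa2 s (14 - 5 * s + z)).
  assert (Hd : forall x, continuity_pt f x).
  { intros x. apply continuity_pt_filterlim. apply (ex_derive_continuous f).
  unfold f, kappa2, kappa3. auto_derive. auto. }
  destruct (Ranalysis5.IVT_interv f (9 / 10) 1) as (s & Hs & Es).
  - intros a _. apply Hd.
  - lra.
  - unfold f. pose proof (kappa3_range (9 / 10) z ltac:(lra) Hz) as K.
    assert (q * kappa3 (9 / 10) (14 - 5 * (9 / 10) + z) <= / 1000 * 100) by (apply Rmult_le_compat; lra).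
    pose proof (kappa2_shift (9 / 10) z ltac:(lra) Hz) as S.
    rewrite (kappa2_line (9 / 10) 0) in S. apply Rabs_le_between in S. lra.
  - unfold f. pose proof (kappa3_range 1 z ltac:(lra) Hz) as K.
    assert (0 <= q * kappa3 1 (14 - 5 * 1 + z)) by (apply Rmult_le_pos; lra).
    pose proof (kappa2_shift 1 z ltac:(lra) Hz) as S.
    rewrite (kappa2_line 1 0) in S. apply Rabs_le_between in S. lra.
  - exists s. split; auto. unfold f in Es. lra.
Qed.

(** * Recovering the parameters from the invariants *)

(** The inverse of [(b, e) |-> (s, t)]. With [r = b / e] put [y = e^2 (3 - 4 r)] and
    [v = (1 - r) y + 4]. Then [t = r v] and [s = 12 v / ((3 - 4 r) y + 16)]. Eliminating
    [r] and [y] leaves the linear equation [3 (4 - s) v = 4 (s - s t + 3 t)], and then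
    [y = 4 v (s - 3) / s] and [1 / e^2 = (3 - 4 r) / y], which is [z_inv]. *)
Definition v_inv (s t : R) : R := 4 * (s - t * s + 3 * t) * / (3 * (4 - s)).
Definition r_inv (s t : R) : R := t * / v_inv s t.
Definition y_inv (s t : R) : R := 4 * v_inv s t * (s - 3) * / s.
Definition z_inv (s t : R) : R := (3 - 4 * r_inv s t) * / y_inv s t.
Definition e_inv (s t : R) : R := / sqrt (z_inv s t).
Definition b_inv (s t : R) : R := r_inv s t * e_inv s t.

(** The region where the inverse formulas give a positive value of [1 / e^2]. *)
Definition box (s t : R) : Prop := 0 < s < 2 /\ 5 < t < 10.

Lemma box_signs s t : box s t -> 0 < v_inv s t /\ 1 < r_inv s t /\ y_inv s t < 0 /\
    0 < z_inv s t /\ 0 < e_inv s t.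
Proof.
  intros [Hs Ht].
  assert (Hn : 0 < s - t * s + 3 * t) by nra.
  assert (Hv : 0 < v_inv s t) by (unfold v_inv; apply Rdiv_lt_0_compat; lra).
  assert (Hvt : v_inv s t < t).
  { unfold v_inv. apply Rmult_lt_reg_r with (3 * (4 - s)). lra. rewrite Rmult_assoc, Rinv_l by lra. nra. }
  assert (Hr : 1 < r_inv s t).
  { unfold r_inv. apply Rmult_lt_reg_r with (v_inv s t). lra. rewrite Rmult_assoc, Rinv_l by lra. lra. }
  assert (Hy : y_inv s t < 0).
  { unfold y_inv. apply Ropp_lt_cancel. rewrite Ropp_0.
    replace (- (4 * v_inv s t * (s - 3) * / s)) with (4 * v_inv s t * (3 - s) / s) by (unfold Rdiv; ring).
    apply Rdiv_lt_0_compat; [|lra]. apply Rmult_lt_0_compat; lra. }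
  assert (Hz : 0 < z_inv s t).
  { unfold z_inv. replace ((3 - 4 * r_inv s t) * / y_inv s t) with ((4 * r_inv s t - 3) / - y_inv s
      t) by (field; lra).
    apply Rdiv_lt_0_compat; lra. }
  repeat split; auto. unfold e_inv. apply Rinv_0_lt_compat. now apply sqrt_lt_R0.
Qed.

Lemma box_invariants s t : box s t ->
  s_of (b_inv s t) (e_inv s t) = s /\ t_of (b_inv s t) (e_inv s t) = t /\
  b_inv s t <> 0 /\ 1 + A_of (b_inv s t) (e_inv s t) <> 0 /\ e_inv s t <> b_inv s t.
Proof.
  intros Hb. destruct (box_signs s t Hb) as (Hv & Hr & Hy & Hz & He). destruct Hb as [Hs Ht].
  set (v := v_inv s t) in *. set (r := r_inv s t) in *. set (y := y_inv s t) in *. set (e := e_inv s t) in *.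
  assert (Eb : b_inv s t = r * e) by reflexivity. rewrite Eb.
  assert (Ee : e * e * z_inv s t = 1).
  { unfold e, e_inv. pose proof (sqrt_sqrt (z_inv s t) ltac:(lra)) as Hq.
  pose proof (sqrt_lt_R0 (z_inv s t) Hz).
    rewrite <- Hq at 3. field. lra. }
  assert (F1 : e * e * (3 - 4 * r) = y).
  { replace (3 - 4 * r) with (z_inv s t * y) by (unfold z_inv; fold r y; field; lra).
    rewrite <- Rmult_assoc, Ee. ring. }
  assert (F3 : r * v = t) by (unfold r, r_inv; fold v; field; lra).
  assert (Ey : y * s = 4 * v * (s - 3)) by (unfold y, y_inv; fold v; field; lra).
  assert (Ev : v * (3 * (4 - s)) = 4 * (s - t * s + 3 * t)) by (unfold v, v_inv; field; lra).
  assert (F2 : (1 - r) * y + 4 = v).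
  { apply Rmult_eq_reg_l with (v * s); [|apply Rmult_integral_contrapositive_currified; lra].
    transitivity ((v - r * v) * (y * s) + 4 * v * s). ring. rewrite F3, Ey.
    apply Rminus_diag_uniq. transitivity (v * (4 * (s - t * s + 3 * t) - v * (3 * (4 - s)))). ring.
    rewrite Ev. ring. }
  assert (F4 : (3 - 4 * r) * y + 16 = 12 * v / s).
  { apply Rmult_eq_reg_r with s; [|lra].
    transitivity (4 * ((1 - r) * y + 4) * s - y * s). ring. rewrite F2, Ey. field. lra. }
  assert (Eo : basis_det (r * e) e * e = 12 * v / s).
  { rewrite <- F4, <- F1. unfold basis_det, k_of. field. lra. }
  assert (Ho : basis_det (r * e) e <> 0).
  { intros E. rewrite E in Eo. assert (0 < 12 * v / s) by (apply Rdiv_lt_0_compat; lra). lra. }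
  assert (Hre : 0 < r * e) by (apply Rmult_lt_0_compat; lra).
  split; [|split; [|split; [|split]]].
  - unfold s_of. apply Rmult_eq_reg_r with (basis_det (r * e) e * e);
      [|apply Rmult_integral_contrapositive_currified; lra].
    transitivity (12 * ((1 - r) * (e * e * (3 - 4 * r)) + 4)).
    { replace (12 * (3 * e - 7 * (r * e) + 4 * k_of (r * e) e) / basis_det (r * e) e * (basis_det
        (r * e) e * e))
        with (12 * (3 * e - 7 * (r * e) + 4 * k_of (r * e) e) * e) by (field; auto).
      unfold k_of. field. lra. }
    rewrite F1, F2, Eo. field. lra.
  - rewrite <- F3, <- F2, <- F1. unfold t_of, A_of, B_of, k_of. field. lra.
  - lra.
  - unfold A_of. assert (0 < r * e * (r * e - e)). { apply Rmult_lt_0_compat; auto. nra. } lra.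
  - intros E. nra.
Qed.

Lemma cont2_sqrt F a b : 0 < F a b -> cont2 F a b -> cont2 (fun x y => sqrt (F x y)) a b.
Proof.
  intros H HF. apply (continuous_comp (fun p => F (fst p) (snd p)) sqrt). exact HF.
  apply continuity_pt_filterlim. apply continuity_pt_sqrt. simpl. lra.
Qed.

Lemma box_continuous s t : box s t -> cont2 b_inv s t /\ cont2 e_inv s t.
Proof.
  intros Hb. destruct (box_signs s t Hb) as (Hv & Hr & Hy & Hz & He). destruct Hb as [Hs Ht].
  assert (Cv : cont2 v_inv s t). { unfold v_inv. solve_cont2. lra. }
  assert (Cr : cont2 r_inv s t). { unfold r_inv. apply cont2_mult. apply cont2_snd.
  apply cont2_inv; auto. lra. }
  assert (Cy : cont2 y_inv s t).
  { unfold y_inv. apply (cont2_mult (fun s t => 4 * v_inv s t * (s - 3)) (fun s _ => / s)).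
    apply (cont2_mult (fun s t => 4 * v_inv s t) (fun s _ => s - 3)).
    apply (cont2_mult (fun _ _ => 4)); auto. solve_cont2. solve_cont2.
    apply (cont2_inv (fun s _ => s)). lra. apply cont2_fst. }
  assert (Cz : cont2 z_inv s t).
  { unfold z_inv. apply (cont2_mult (fun s t => 3 - 4 * r_inv s t) (fun s t => / y_inv s t)).
    apply (cont2_minus (fun _ _ => 3) (fun s t => 4 * r_inv s t)). solve_cont2.
    apply (cont2_mult (fun _ _ => 4)); auto. solve_cont2.
    apply (cont2_inv y_inv); auto. lra. }
  assert (Ce : cont2 e_inv s t).
  { unfold e_inv. apply (cont2_inv (fun s t => sqrt (z_inv s t))). apply Rgt_not_eq. now apply sqrt_lt_R0.
    now apply cont2_sqrt. }
  split; auto. unfold b_inv. now apply cont2_mult.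
Qed.

Lemma box_close s t d : box s t -> 0 < d -> exists e, 0 < e /\ forall s' t', Rabs (s' - s) < e ->
    Rabs (t' - t) < e ->
  Rabs (b_inv s' t' - b_inv s t) < d /\ Rabs (e_inv s' t' - e_inv s t) < d.
Proof.
  intros Hb Hd. destruct (box_continuous s t Hb) as [Cb Ce].
  destruct (cont2_eps _ _ _ Cb d Hd) as (e1 & He1 & H1).
  destruct (cont2_eps _ _ _ Ce d Hd) as (e2 & He2 & H2).
  exists (Rmin e1 e2). split. now apply Rmin_glb_lt.
  pose proof (Rmin_l e1 e2). pose proof (Rmin_r e1 e2).
  intros s' t' Hs Ht. split. apply H1; lra. apply H2; lra.
Qed.

(** * Weak foci of order eight and their unfoldings *)

(** All the equations of the unfolding, and for [eps = 0] those of the weak focus. For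
    [eps = 0] one has exactly [s2 = s1 - z / 3] and [t2 = t1 - z / 3], so that [cross]
    is [z / 3 (s1 - t1)], nonzero when the correction, at most [11 eps], is smaller. *)
Lemma invariants_exist z eps : 0 < z <= / 200 -> 0 <= eps <= / 1000 ->
  exists s1 t1 s2 t2 m0 m1, 9 / 10 <= s1 <= 1 /\ t1 = 14 - 5 * s1 + z /\
    kappa2 s1 t1 = 98 / 9 * kappa3 s1 t1 * eps ^ 2 /\ 1 <= kappa3 s1 t1 <= 100 /\
    m0 = 12 * kappa3 s1 t1 * eps ^ 6 /\ m1 = kappa1 s1 t1 - 245 / 9 * kappa3 s1 t1 * eps ^ 4 /\
    s2 * (1 - m0 * t1) = - (t1 + m1) /\ t2 * (1 - m0 * s1) = - (s1 + m1) /\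
    Rabs (s2 - (s1 - z / 3)) <= eps /\ Rabs (t2 - (t1 - z / 3)) <= eps /\
    (11 * eps < z -> cross s1 t1 s2 t2 <> 0).
Proof.
  intros Hz He. assert (Rz : Rabs z <= / 100) by (rewrite Rabs_pos_eq; lra).
  destruct (root_exists z (98 / 9 * eps ^ 2) Rz) as (s1 & Hs1 & K2). nra.
  set (t1 := 14 - 5 * s1 + z). pose proof (kappa3_range s1 z Hs1 Rz) as K3. fold t1 in K2, K3.
  set (k3 := kappa3 s1 t1) in *.
  set (m0 := 12 * k3 * eps ^ 6). set (m1 := kappa1 s1 t1 - 245 / 9 * k3 * eps ^ 4).
  assert (Hp : forall n, 0 <= eps ^ S n <= (/ 1000) ^ n * eps).
  { intros n. split. apply pow_le; lra. simpl. rewrite Rmult_comm. apply Rmult_le_compat_r. lra.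
  apply pow_incr. lra. }
  pose proof (Hp 5%nat) as P6. pose proof (Hp 3%nat) as P4.
  assert (Hm0 : 0 <= m0 <= eps / 1000).
  { unfold m0. split. apply Rmult_le_pos; lra.
    apply Rle_trans with (12 * 100 * ((/ 1000) ^ 5 * eps)). apply Rmult_le_compat; lra. lra. }
  set (w := 245 / 9 * k3 * eps ^ 4).
  assert (Hw : 0 <= w <= eps / 100).
  { unfold w. split. apply Rmult_le_pos; lra.
    apply Rle_trans with (245 / 9 * 100 * ((/ 1000) ^ 3 * eps)). apply Rmult_le_compat; lra. lra. }
  assert (Ht1 : 9 <= t1 <= 10) by (unfold t1; lra).
  assert (Hd1 : / 2 <= 1 - m0 * t1) by nra. assert (Hd2 : / 2 <= 1 - m0 * s1) by nra.
  exists s1, t1, (- (t1 + m1) / (1 - m0 * t1)), (- (s1 + m1) / (1 - m0 * s1)), m0, m1.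
  assert (D1 : Rabs (- (t1 + m1) / (1 - m0 * t1) - (s1 - z / 3)) <= eps).
  { replace (- (t1 + m1) / (1 - m0 * t1) - (s1 - z / 3)) with ((w + m0 * t1 * (s1 - z / 3)) * / (1
      - m0 * t1)).
    2:{ unfold m1. fold w. unfold kappa1. apply Rmult_eq_reg_r with (1 - m0 * t1); [|lra].
    field_simplify; [|lra..].
        replace s1 with ((14 + z - t1) / 5) by (unfold t1; field). field. }
    replace eps with (eps / 2 * 2) by field. apply Rabs_le_mult.
    assert (0 <= m0 * t1 <= eps / 100) by nra. assert (0 <= s1 - z / 3 <= 1) by lra.
    rewrite Rabs_pos_eq; nra.
    rewrite Rabs_pos_eq. replace 2 with (/ / 2) by field. apply Rinv_le_contravar; lra.
    apply Rlt_le, Rinv_0_lt_compat; lra. }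
  assert (D2 : Rabs (- (s1 + m1) / (1 - m0 * s1) - (t1 - z / 3)) <= eps).
  { replace (- (s1 + m1) / (1 - m0 * s1) - (t1 - z / 3)) with ((w + m0 * s1 * (t1 - z / 3)) * / (1
      - m0 * s1)).
    2:{ unfold m1. fold w. unfold kappa1. apply Rmult_eq_reg_r with (1 - m0 * s1); [|lra].
    field_simplify; [|lra..].
        replace s1 with ((14 + z - t1) / 5) by (unfold t1; field). field. }
    replace eps with (eps / 2 * 2) by field. apply Rabs_le_mult.
    assert (0 <= m0 * s1 <= eps / 1000) by nra. assert (0 <= t1 - z / 3 <= 10) by lra.
    rewrite Rabs_pos_eq; nra.
    rewrite Rabs_pos_eq. replace 2 with (/ / 2) by field. apply Rinv_le_contravar; lra.
    apply Rlt_le, Rinv_0_lt_compat; lra. }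
  split; [exact Hs1|]. split; [reflexivity|]. split. { rewrite K2. fold k3. ring. } split; [exact K3|].
  split; [reflexivity|]. split; [reflexivity|].
  split. { field. lra. } split. { field. lra. }
  split; [exact D1|]. split; [exact D2|].
  intros Hez. set (s2 := - (t1 + m1) / (1 - m0 * t1)) in *. set (t2 := - (s1 + m1) / (1 - m0 * s1)) in *.
  unfold cross. intros E.
  assert (E' : z / 3 * (t1 - s1) = (s2 - (s1 - z / 3)) * t1 - s1 * (t2 - (t1 - z / 3))) by lra.
  assert (Hb : Rabs ((s2 - (s1 - z / 3)) * t1 - s1 * (t2 - (t1 - z / 3))) <= eps * 10 + 1 * eps).
  { apply Rabs_le_minus; apply Rabs_le_mult; auto; rewrite Rabs_pos_eq; lra. }
  rewrite <- E' in Hb. rewrite Rabs_pos_eq in Hb by nra. nra.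
Qed.

Definition by_zone {A : Type} (a b : A) (i : zone) : A := match i with zone1 => a | zone2 => b end.

Definition lambda_of (b0 e0 : R) (bf ef : zone -> R) : lambda_space :=
  ((ef zone1 - e0, bf zone1 - b0), (ef zone2 - e0, bf zone2 - b0)).

(** The family consists of all pairs of centers: [lambda] is the difference between
    [(e, b)] of each zone and the base point. *)
Lemma kolmogorov_lambda_of b0 e0 bf ef : e0 <> 0 -> (forall i, ef i <> 0) ->
  kolmogorov ((b0, e0), lambda_of b0 e0 bf ef) = pw_centers bf ef /\
      admissible ((b0, e0), lambda_of b0 e0 bf ef).
Proof.
  intros He0 He. pose proof (He zone1). pose proof (He zone2). split.
  - apply functional_extensionality. intros i. apply functional_extensionality. intros [x y].
    unfold pw_centers, center_field, k_of. destruct i; simpl; unfold Xc, Yc, Xi, Yi; f_equal; try ring;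
    field; repeat split; auto; lra.
  - intros [|]; simpl; apply Rmult_integral_contrapositive_currified; auto; lra.
Qed.

Lemma box_setup m R0 (s t : zone -> R) : 1 <= m -> zone_radius m R0 -> (forall i, box (s i) (t i)) ->
  (forall i, Rabs (b_inv (s i) (t i)) <= m /\ / m <= e_inv (s i) (t i) <= m) ->
  let bf := fun i => b_inv (s i) (t i) in let ef := fun i => e_inv (s i) (t i) in
  setup m R0 bf ef /\ (forall i, zone_s bf ef i = s i) /\ (forall i, zone_t bf ef i = t i).
Proof.
  intros Hm HZ Hb Hbd bf ef.
  assert (Hinv := fun i => box_invariants _ _ (Hb i)).
  split; [split|split]; auto; intros i; destruct (Hinv i) as (Es & Et & Hg);
      unfold zone_s, zone_t, bf, ef; auto.
  - split. apply Hbd. split. apply Hbd. exact Hg.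
  - rewrite Es. destruct (Hb i). rewrite Rabs_pos_eq; lra.
  - rewrite Et. destruct (Hb i). rewrite Rabs_pos_eq; lra.
Qed.

(** The bound [m] is fixed by the weak focus; it still holds for the nearby parameters
    of the unfolding. *)
Lemma near_bounds m b e b' e' : 0 < e -> 4 + Rabs b + 2 * e + 2 / e <= m -> Rabs (b' - b) < 1 ->
    Rabs (e' - e) < e / 2 ->
  Rabs b' <= m /\ / m <= e' <= m.
Proof.
  intros He Hm Hb' He'.
  assert (0 < 2 / e) by (apply Rdiv_lt_0_compat; lra). pose proof (Rabs_pos b).
  apply Rabs_lt_between in He'. split.
  - replace b' with (b' - b + b) by ring. eapply Rle_trans. apply Rabs_triang. lra.
  - split; [|lra]. apply Rle_trans with (e / 2); [|lra].
    replace (e / 2) with (/ (2 / e)) by (field; lra). apply Rinv_le_contravar; lra.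
Qed.

Lemma ball_small (x y e : R) : Rabs (y - x) < e -> @ball R_UniformSpace x e y.
Proof. intros H. exact H. Qed.

Theorem proposition4p1 :
  exists mu : R * R,
    forall V : (R * R) * (R * R) -> Prop, locally ((0, 0), (0, 0)) V ->
      exists lambda : (R * R) * (R * R),
        V lambda /\
        admissible (mu, lambda) /\
        weak_focus (kolmogorov (mu, lambda)) (1, 1) 8 /\
        unfolds_at_least admissible kolmogorov (mu, lambda) (1, 1) 3.
Proof.
  destruct (root_exists 0 0) as (s0 & Hs0 & K0). rewrite Rabs_R0; lra. lra.
  set (t0 := 14 - 5 * s0 + 0). rewrite Rmult_0_l in K0.
  assert (B0 : box s0 t0) by (unfold box, t0; lra).
  set (b0 := b_inv s0 t0). set (e0 := e_inv s0 t0).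
  assert (He0 : 0 < e0) by apply (box_signs s0 t0 B0).
  exists (b0, e0). intros V (epsV & HV).
  destruct (box_close s0 t0 epsV B0 (cond_pos epsV)) as (eta & Heta & Hclose).
  (* [s1 - s0] and [t1 - t0] will be at most [2 z] and [11 z] *)
  set (z := Rmin (/ 200) (eta / 20)).
  assert (Hz : 0 < z) by (unfold z; apply Rmin_glb_lt; lra).
  assert (Hz1 : z <= / 200) by apply Rmin_l. assert (Hz2 : z <= eta / 20) by apply Rmin_r.
  assert (Rz : Rabs z <= / 100) by (rewrite Rabs_pos_eq; lra).
  destruct (invariants_exist z 0) as (s1 & t1 & s2 & t2 & m0 & m1 & Hs1 & Et1 & K2 & K3 & Em0 & Em1
      & E2 & E3 & D1 & D2 & Hbb); try lra.
  specialize (Hbb ltac:(lra)).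
  assert (F2 : s2 = s1 - z / 3). { apply Rabs_le_between in D1. lra. }
  assert (F3 : t2 = t1 - z / 3). { apply Rabs_le_between in D2. lra. }
  assert (G1 : Rabs (s1 - s0) <= 2 * z).
  { pose proof (kappa2_gap s0 s1 0 Hs0 Hs1) as Hg. rewrite Rabs_R0 in Hg. specialize (Hg ltac:(lra)).
    pose proof (kappa2_shift s1 z Hs1 Rz) as Hsh. rewrite <- Et1, K2 in Hsh.
    rewrite (Rabs_pos_eq z) in Hsh by lra.
    rewrite K0 in Hg.
    replace (98 / 9 * kappa3 s1 t1 * 0 ^ 2 - kappa2 s1 (14 - 5 * s1 + 0)) with (0 - kappa2 s1 (14 -
        5 * s1 + 0)) in Hsh by ring.
    lra. }
  assert (G2 : Rabs (t1 - t0) <= 11 * z).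
  { rewrite Et1. unfold t0. apply Rabs_le_between in G1. apply Rabs_le. lra. }
  set (sf := by_zone s1 s2). set (tf := by_zone t1 t2).
  assert (Bx : forall i, box (sf i) (tf i)) by (intros [|]; unfold box; simpl; lra).
  assert (Hnear : forall i, Rabs (sf i - s0) < eta /\ Rabs (tf i - t0) < eta).
  { apply Rabs_le_between in G1. apply Rabs_le_between in G2.
  intros [|]; simpl; split; apply Rabs_def1; lra. }
  set (bf := fun i => b_inv (sf i) (tf i)). set (ef := fun i => e_inv (sf i) (tf i)).
  assert (Hef : forall i, 0 < ef i) by (intros i; apply (box_signs _ _ (Bx i))).
  assert (HefN : forall i, ef i <> 0) by (intros i; specialize (Hef i); lra).
  destruct (kolmogorov_lambda_of b0 e0 bf ef ltac:(lra) HefN) as [EK Had].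
  (* a bound that also holds at the parameters of the unfolding *)
  set (M := fun i => 4 + Rabs (bf i) + 2 * ef i + 2 / ef i).
  set (m := M zone1 + M zone2).
  assert (HM : forall i, 4 <= M i).
  { intros i. unfold M. specialize (Hef i). assert (0 < 2 / ef i) by (apply Rdiv_lt_0_compat; lra).
    pose proof (Rabs_pos (bf i)). lra. }
  assert (Hm : forall i, M i <= m) by (intros [|]; unfold m; pose proof (HM zone1);
      pose proof (HM zone2); lra).
  assert (Hm1 : 1 <= m) by (pose proof (HM zone1); pose proof (Hm zone1); lra).
  destruct (zone_rotor m Hm1) as (R0 & HZ).
  exists (lambda_of b0 e0 bf ef). split; [|split; [|split]].
  - apply HV. destruct (Hnear zone1) as [N1 N2]. destruct (Hnear zone2) as [N3 N4].
    destruct (Hclose _ _ N1 N2) as [C1 C2]. destruct (Hclose _ _ N3 N4) as [C3 C4].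
    split; split; apply ball_small; rewrite Rminus_0_r; assumption.
  - exact Had.
  - cut (weak_focus (pw_centers bf ef) (1, 1) 8). { intros Hw. rewrite <- EK in Hw. exact Hw. }
    destruct (box_setup m R0 sf tf Hm1 HZ Bx) as (Hsu & Hss & Htt).
    { intros i. apply (near_bounds m (bf i) (ef i)); auto. apply Hm. rewrite Rminus_diag, Rabs_R0; lra.
      unfold ef. rewrite Rminus_diag, Rabs_R0. specialize (Hef i). unfold ef in Hef. lra. }
    fold bf ef in Hsu, Hss, Htt.
    apply (weak_focus_eight m R0); auto; rewrite !Hss, !Htt; simpl.
    + rewrite K2. ring.
    + lra.
    + rewrite Em0, Em1 in E2. lra.
    + rewrite Em0, Em1 in E3. lra.
    + exact Hbb.
  - intros U HU V' (eps2 & HV').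
    destruct (three_cycles m R0 1 U Hm1 HZ Rlt_0_1 HU) as (epsc & Hepsc & Hcyc).
    assert (Hd : forall i, exists e, 0 < e /\ forall s' t', Rabs (s' - sf i) < e -> Rabs (t' - tf i) < e ->
       Rabs (b_inv s' t' - bf i) < Rmin eps2 (Rmin 1 (ef i / 2)) /\
           Rabs (e_inv s' t' - ef i) < Rmin eps2 (Rmin 1 (ef i / 2))).
    { intros i. apply (box_close (sf i) (tf i)); auto. specialize (Hef i). pose proof (cond_pos eps2).
      repeat apply Rmin_glb_lt; lra. }
    destruct (Hd zone1) as (d1 & Hd1 & Hc1). destruct (Hd zone2) as (d2 & Hd2 & Hc2).
    set (eps := Rmin (Rmin (/ 10000) (z / 20)) (Rmin (epsc / 2) (Rmin (d1 / 20) (d2 / 20)))).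
    assert (Heps : 0 < eps) by (unfold eps; repeat apply Rmin_glb_lt; lra).
    assert (L1 : eps <= / 10000) by (unfold eps; eapply Rle_trans; apply Rmin_l).
    assert (L2 : eps <= z / 20) by (unfold eps; eapply Rle_trans; [apply Rmin_l|apply Rmin_r]).
    assert (L3 : eps <= epsc / 2) by (unfold eps; eapply Rle_trans; [apply Rmin_r|apply Rmin_l]).
    assert (L4 : eps <= d1 / 20) by (unfold eps; eapply Rle_trans; [apply Rmin_r|eapply Rle_trans;
        [apply Rmin_r|apply Rmin_l]]).
    assert (L5 : eps <= d2 / 20) by (unfold eps; eapply Rle_trans; [apply Rmin_r|eapply Rle_trans;
        [apply Rmin_r|apply Rmin_r]]).
    destruct (invariants_exist z eps) as (s1' & t1' & s2' & t2' & m0' & m1' & Hs1' & Et1' & K2' &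
        K3' & Em0' & Em1' & E2' & E3' & D1' & D2' & Hbb'); try lra.
    specialize (Hbb' ltac:(lra)).
    assert (G1' : Rabs (s1' - s1) <= eps).
    { pose proof (kappa2_gap s1 s1' z Hs1 Hs1' Rz) as Hg. rewrite <- Et1, <- Et1', K2, K2' in Hg.
      assert (Hle : Rabs (98 / 9 * kappa3 s1 t1 * 0 ^ 2 - 98 / 9 * kappa3 s1' t1' * eps ^ 2) <= 98
          / 9 * 100 * (/ 10000 * eps)).
      { replace (98 / 9 * kappa3 s1 t1 * 0 ^ 2 - 98 / 9 * kappa3 s1' t1' * eps ^ 2) with (- (98 / 9
          * kappa3 s1' t1' * (eps * eps))) by ring.
        apply Rabs_le_opp. apply Rabs_le_mult. rewrite Rabs_pos_eq; lra. rewrite Rabs_pos_eq; nra. }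
      lra. }
    set (sf' := by_zone s1' s2'). set (tf' := by_zone t1' t2').
    apply Rabs_le_between in G1'. apply Rabs_le_between in D1'. apply Rabs_le_between in D2'.
    assert (Bx' : forall i, box (sf' i) (tf' i)) by (intros [|]; unfold box; simpl; lra).
    set (bf' := fun i => b_inv (sf' i) (tf' i)). set (ef' := fun i => e_inv (sf' i) (tf' i)).
    assert (Hcl : forall i, Rabs (bf' i - bf i) < Rmin eps2 (Rmin 1 (ef i / 2)) /\
        Rabs (ef' i - ef i) < Rmin eps2 (Rmin 1 (ef i / 2))).
    { intros [|]; [apply Hc1|apply Hc2]; simpl; apply Rabs_def1; lra. }
    assert (Hcl' : forall i, Rabs (bf' i - bf i) < eps2 /\ Rabs (ef' i - ef i) < eps2 /\
        Rabs (bf' i - bf i) < 1 /\ Rabs (ef' i - ef i) < ef i / 2).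
    { intros i. destruct (Hcl i) as [A1 A2]. apply Rmin3_lt in A1. apply Rmin3_lt in A2. lra. }
    assert (Hef' : forall i, ef' i <> 0).
    { intros i. pose proof (box_signs _ _ (Bx' i)) as Hb. unfold ef'. lra. }
    destruct (kolmogorov_lambda_of b0 e0 bf' ef' ltac:(lra) Hef') as [EK' Had'].
    exists ((b0, e0), lambda_of b0 e0 bf' ef'). split; [|split].
    + apply HV'. destruct (Hcl' zone1) as (C1 & C2 & _). destruct (Hcl' zone2) as (C3 & C4 & _).
      split. apply ball_center.
      split; split; apply ball_small; simpl.
      replace (ef' zone1 - e0 - (ef zone1 - e0)) with (ef' zone1 - ef zone1) by ring. exact C2.
      replace (bf' zone1 - b0 - (bf zone1 - b0)) with (bf' zone1 - bf zone1) by ring. exact C1.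
      replace (ef' zone2 - e0 - (ef zone2 - e0)) with (ef' zone2 - ef zone2) by ring. exact C4.
      replace (bf' zone2 - b0 - (bf zone2 - b0)) with (bf' zone2 - bf zone2) by ring. exact C3.
    + exact Had'.
    + cut (exists phi : nat -> R -> R * R,
        (forall i : nat, (i < 3)%nat -> crossing_limit_cycle (pw_centers bf' ef') (phi i) /\
            forall t, U (phi i t)) /\
        (forall i j : nat, (i < j < 3)%nat -> ~ same_orbit (phi i) (phi j))).
      { intros Hw. rewrite <- EK' in Hw. exact Hw. }
      destruct (box_setup m R0 sf' tf' Hm1 HZ Bx') as (Hsu & Hss & Htt).
      { intros i. apply (near_bounds m (bf i) (ef i)); auto; try apply Hm; apply Hcl'. }
      fold bf' ef' in Hsu, Hss, Htt.
      apply (Hcyc eps bf' ef' m0' m1'); auto; rewrite ?Hss, ?Htt; simpl; auto.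
      lra. rewrite Rabs_pos_eq; lra.
Qed.
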